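(* Let $b_1^*,\dots,b_K^*:\mathbb{R}^2\to\mathbb{R}$ be bounded and Lipschitz as in the context. Let $\xi^{[Y]}=(\xi_t^{[Y]})_{t\in[0,1]}$ be the unique strong solution of the McKean--Vlasov equation $$d\xi_t^{[Y]}=b_Y^*[\xi_t^{[Y]},\mu_t^{[Y]}]\,dt+dW_t,\qquad \xi_0^{[Y]}=x_0,$$ and let $(\mu^{[k]}_t)_{t\in[0,1]}$ denote its marginal distributions conditionally on $Y=k$. For $k\in\mathcal{Y}$ define $$F_k^*(\xi^{[Y]}):=\int_0^1 b_k^*[\xi_s^{[Y]},\mu_s^{[k]}]\,d\xi_s^{[Y]}-\frac12\int_0^1 \big(b_k^*[\xi_s^{[Y]},\mu_s^{[k]}]\big)^2ds .$$ Then for each $k\in\mathcal{Y}$ the conditional probability $\pi_k^*(\xi^{[Y]})=\mathbb{P}(Y=k\mid \xi^{[Y]})$ satisfies $$\pi_k^*(\xi^{[Y]})=\frac{\exp\big(F_k^*(\xi^{[Y]})\big)}{\sum_{j=1}^K\exp\big(F_j^*(\xi^{[Y]})\big)}\qquad \mathbb{P}\text{-a.s.}$$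
   Context: $K$ is a positive integer, $\mathcal{Y}=\{1,\dots,K\}$, $x_0\in\mathbb{R}$, the label $Y$ is uniformly distributed on $\mathcal{Y}$, and $W$ is a standard Brownian motion independent of $Y$. The functions $b_k^*$ are bounded and there is $L>0$ such that $|b_k^*(x_1,y_1)-b_k^*(x_2,y_2)|\le L(|x_1-x_2|+|y_1-y_2|)$ for all $k\in\mathcal{Y}$ and all reals. For $x\in\mathbb{R}$ and a probability measure $\mu$ on $\mathbb{R}$, $b_k^*[x,\mu]:=\int_{\mathbb{R}}b_k^*(x,z)\,\mu(dz)$. In the McKean--Vlasov equation, conditionally on $Y=k$, the drift is $b_k^*$ and $\mu^{[k]}_t$ is the law of $\xi_t^{[k]}$, where the superscript $[k]$ means conditionally on $Y=k$. The processes are defined on a filtered probability space satisfying the usual conditions. *)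

(* Defs.v *)
From HB Require Import structures.
From mathcomp Require Export all_boot all_order all_algebra.
From mathcomp Require Export all_classical all_reals all_analysis.

Set Implicit Arguments.
Unset Strict Implicit.
Unset Printing Implicit Defensive.

Import Order.TTheory GRing.Theory Num.Theory.
Import numFieldNormedType.Exports.

Local Open Scope classical_set_scope.
Local Open Scope ring_scope.

(* All processes are maps [X : R -> Omega -> R], time first; only the values at
   times in [0, 1] are ever constrained or used. *)

Section stochastic_basis.
Context {R : realType} {d : measure_display} {Omega : measurableType d}.
Variable P : probability Omega R.

Definition measurable_wrt (G : set (set Omega)) (f : Omega -> R) : Prop :=
  forall B : set R, measurable B -> G (f @^-1` B).

Definition sigma_process (X : R -> Omega -> R) : set (set Omega) :=
  <<s \bigcup_(t in `[0%R, 1%R]) preimage_set_system setT (X t) measurable >>.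

Record usual_filtration (F : R -> set (set Omega)) : Prop := {
  filtration_sigma_algebra : forall t : R, 0 <= t <= 1 -> sigma_algebra setT (F t);
  filtration_measurable : forall t : R, 0 <= t <= 1 -> F t `<=` measurable;
  filtration_nondecreasing : forall s t : R, 0 <= s -> s <= t -> t <= 1 ->
    F s `<=` F t;
  filtration_complete : forall N, P.-negligible N -> F 0 N;
  filtration_right_continuous : forall t : R, 0 <= t < 1 ->
    \bigcap_(s in `]t, 1%R]) F s `<=` F t }.

Definition adapted (F : R -> set (set Omega)) (X : R -> Omega -> R) : Prop :=
  forall t : R, 0 <= t <= 1 -> measurable_wrt (F t) (X t).

Definition continuous_process (X : R -> Omega -> R) : Prop :=
  forall w, {within `[0%R, 1%R], continuous (X ^~ w)}.

(* [normal_prob] takes the standard deviation, and is a Gaussian law only when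
   it is nonzero. *)
Record brownian_motion (F : R -> set (set Omega)) (W : R -> Omega -> R)
    : Prop := {
  bm_continuous : continuous_process W;
  bm_adapted : adapted F W;
  bm_start : {ae P, forall w, W 0 w = 0};
  bm_independent_increments : forall s t : R, 0 <= s -> s < t -> t <= 1 ->
    forall (A : set Omega) (B : set R), F s A -> measurable B ->
      P (A `&` (W t \- W s)%R @^-1` B)
      = (P A * P ((W t \- W s)%R @^-1` B))%E;
  bm_gaussian_increments : forall s t : R, 0 <= s -> s < t -> t <= 1 ->
    forall B : set R, measurable B ->
      P ((W t \- W s)%R @^-1` B) = normal_prob 0 (Num.sqrt (t - s)) B }.

Definition uniform_label (K : nat) (Y : Omega -> 'I_K) : Prop :=
  forall k, measurable (Y @^-1` [set k]) /\
            P (Y @^-1` [set k]) = (K%:R^-1)%:E.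

Definition independent_label (K : nat) (W : R -> Omega -> R)
    (Y : Omega -> 'I_K) : Prop :=
  forall (A : set Omega) (k : 'I_K), sigma_process W A ->
    P (A `&` Y @^-1` [set k]) = (P A * P (Y @^-1` [set k]))%E.

(* [p] is a version of the conditional probability of [E] given the
   sigma-algebra [G]. *)
Record is_cond_prob (G : set (set Omega)) (E : set Omega) (p : Omega -> R)
    : Prop := {
  cond_prob_measurable : measurable_wrt G p;
  cond_prob_integrable : P.-integrable setT (EFin \o p);
  cond_prob_integral : forall A, G A ->
    (\int[P]_(w in A) (p w)%:E = P (A `&` E))%E }.

(* The elementary process
   sum_(i < n) c_i 1_(]t_i, t_(i+1)]),  0 <= t_0 <= ... <= t_n <= 1. *)
Record simple_process := SimpleProcess {
  sp_size : nat;
  sp_time : nat -> R;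
  sp_coef : nat -> Omega -> R }.

Record simple_process_wf (F : R -> set (set Omega)) (S : simple_process)
    : Prop := {
  sp_time_ge0 : 0 <= sp_time S 0;
  sp_time_le1 : sp_time S (sp_size S) <= 1;
  sp_time_nondecreasing : forall i, (i < sp_size S)%N ->
    sp_time S i <= sp_time S i.+1;
  sp_coef_measurable : forall i, (i < sp_size S)%N ->
    measurable_wrt (F (sp_time S i)) (sp_coef S i);
  sp_coef_bounded : forall i, (i < sp_size S)%N ->
    exists M : R, forall w, `|sp_coef S i w| <= M }.

Definition simple_value (S : simple_process) (s : R) (w : Omega) : R :=
  \sum_(i < sp_size S)
    sp_coef S i w * \1_(`]sp_time S i, sp_time S i.+1]) s.

Definition simple_integral (W : R -> Omega -> R) (S : simple_process)
    (w : Omega) : R :=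
  \sum_(i < sp_size S)
    sp_coef S i w * (W (sp_time S i.+1) w - W (sp_time S i) w).

Record ito_integrand (F : R -> set (set Omega)) (H : R -> Omega -> R)
    : Prop := {
  ito_integrand_measurable :
    measurable_fun [set p : measurableTypeR R * Omega | 0 <= p.1 <= 1]
      (fun p => H p.1 p.2);
  ito_integrand_adapted : adapted F H;
  ito_integrand_square_integrable :
    (\int[P]_w \int[lebesgue_measure]_(s in `[0%R, 1%R]) ((H s w) ^+ 2)%:E
      < +oo)%E }.

(* [I] is a version of the Ito integral of [H] against [W] over [0, 1]: the
   L^2(P)-limit of the integrals of simple processes converging to [H] in
   L^2(ds x P).  It is determined up to P-almost sure equality. *)
Definition is_ito_integral (F : R -> set (set Omega)) (W H : R -> Omega -> R)
    (I : Omega -> R) : Prop :=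
  [/\ ito_integrand F H,
      measurable_fun setT I &
      exists S : nat -> simple_process,
      [/\ forall n, simple_process_wf F (S n),
        (fun n => \int[P]_w \int[lebesgue_measure]_(s in `[0%R, 1%R])
            ((simple_value (S n) s w - H s w) ^+ 2)%:E)%E @ \oo --> 0%E &
        (fun n => \int[P]_w
            ((simple_integral W (S n) w - I w) ^+ 2)%:E)%E @ \oo --> 0%E]].

(* [J] is a version of the integral over [0, 1] of [H] against an Ito process
   with stochastic differential beta dt + dW. *)
Definition is_ito_process_integral (F : R -> set (set Omega))
    (W beta H : R -> Omega -> R) (J : Omega -> R) : Prop :=
  exists2 I, is_ito_integral F W H I &
    {ae P, forall w, J w =
      \int[lebesgue_measure]_(s in `[0%R, 1%R]) (H s w * beta s w) + I w}.

End stochastic_basis.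

Definition mean_drift {R : realType} (b : R -> R -> R) (x : R)
    (m : probability (measurableTypeR R) R) : R :=
  \int[m]_z b x z.

Section mckean_vlasov.
Context {R : realType} {d : measure_display} {Omega : measurableType d}.
Variables (P : probability Omega R) (F : R -> set (set Omega)).
Variables (K : nat) (x0 : R) (b : 'I_K -> R -> R -> R).
Variables (Y : Omega -> 'I_K) (W : R -> Omega -> R).

(* [mu k] is the flow of the conditional marginal laws of [xi] given Y = k. *)
Definition conditional_marginals (xi : R -> Omega -> R)
    (mu : 'I_K -> R -> probability (measurableTypeR R) R) : Prop :=
  forall (k : 'I_K) (t : R), 0 <= t <= 1 -> forall A : set R, measurable A ->
    mu k t A = (P (xi t @^-1` A `&` Y @^-1` [set k])
                / P (Y @^-1` [set k]))%E.

Record mckean_vlasov_solution (xi : R -> Omega -> R)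
    (mu : 'I_K -> R -> probability (measurableTypeR R) R) : Prop := {
  mv_continuous : continuous_process xi;
  mv_adapted : adapted F xi;
  mv_marginals : conditional_marginals xi mu;
  mv_equation : {ae P, forall w, forall t : R, 0 <= t <= 1 ->
    xi t w = x0
      + \int[lebesgue_measure]_(s in `[0%R, t])
          mean_drift (b (Y w)) (xi s w) (mu (Y w) s)
      + W t w} }.

Variables (xi : R -> Omega -> R)
  (mu : 'I_K -> R -> probability (measurableTypeR R) R).

Definition drift_along (k : 'I_K) (s : R) (w : Omega) : R :=
  mean_drift (b k) (xi s w) (mu k s).

(* [J] stands for (a version of) the stochastic integral of [drift_along k]
   against d xi. *)
Definition log_likelihood (k : 'I_K) (J : Omega -> R) (w : Omega) : R :=
  J w - 2^-1 * \int[lebesgue_measure]_(s in `[0%R, 1%R])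
                  (drift_along k s w) ^+ 2.

End mckean_vlasov.

(* Main.v *)
From HB Require Import structures.
Require Import Defs.
From mathcomp Require Import ring lra zify measurable_realfun normal_distribution random_variable.

Set Implicit Arguments.
Unset Strict Implicit.
Unset Printing Implicit Defensive.

Import Order.TTheory GRing.Theory Num.Theory.
Import numFieldNormedType.Exports.

Local Open Scope classical_set_scope.
Local Open Scope ring_scope.

(** Once the flow [mu] is fixed, the equation given Y = k is an ordinary one, with additive noise
    and a bounded drift H_k that is Lipschitz in space. Girsanov's theorem says that the law of the
    path given Y = j has density exp(F_j - F_k) with respect to its law given Y = k, and Bayes'
    formula with a uniform prior does the rest. Precisely, the core identity is
    E[1_A 1_{Y=k} exp(F_j - F_k)] = P(A, Y = j) for every A in the sigma-algebra generated by [xi].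
    Summing over j gives E[1_A 1_{Y=k} S] = P(A) with S = sum_j exp(F_j - F_k). As S is measurable
    with respect to the path, this forces the conditional probability of Y = k to be 1/S
    ([cond_prob_inverse_density]), which is the asserted quotient.

    The core identity is obtained by time discretization. For Euler chains it holds exactly: given
    the past, each Brownian increment is Gaussian, and an exponential tilt of a Gaussian is a
    translation ([normal_tilt]), that is, a change of drift ([euler_weight_integral],
    [euler_change_of_drift]).

    Three facts allow the step size to tend to 0. The Euler chain of the true label converges to
    [xi] uniformly on the grid ([euler_cvg]). The Ito integrals are L^2-limits of grid sums by the
    isometry ([grid_integral_cvg]), hence almost sure limits along one subsequence
    ([grid_integral_subsequence]). The discrete densities are bounded in L^2 uniformly in the step
    ([euler_log_ratio_square]), so that expectations converge ([limit_integral_square_bounded]). The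
    identity follows for products of continuous functions of finitely many values of the path
    ([likelihood_ratio_finite_dim]), then for cylinder events ([likelihood_ratio_indicator]), then
    for the whole path sigma-algebra by a pi-lambda argument ([integral_eq_sigma_algebra]).

    One measurability point remains: [J j] is only a version of a stochastic integral, a function on
    [Omega]. It is replaced by [path_log_likelihood], an upper limit of sums in the values of [xi]
    on grids, which is path measurable and agrees with F_j almost surely. *)

(** * Image measures and densities *)

Section image_measure.
Context d1 d2 (T1 : measurableType d1) (T2 : measurableType d2) (R : realType).
Variables (m : {measure set T1 -> \bar R}) (f : T1 -> T2).
Hypothesis mf : measurable_fun setT f.

Definition image_measure : {measure set T2 -> \bar R}.
Proof. by refine (pushforward m f : measure _ _). Defined.

Lemma image_measureE A : image_measure A = m (f @^-1` A).
Proof. by []. Qed.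

Lemma ge0_integral_image (g : T2 -> \bar R) :
  measurable_fun setT g -> (forall y, 0 <= g y)%E ->
  (\int[image_measure]_y g y = \int[m]_x g (f x))%E.
Proof.
move=> mg g0.
by rewrite [LHS](ge0_integral_pushforward mf) ?preimage_setT.
Qed.

Lemma integral_image (g : T2 -> \bar R) :
  measurable_fun setT g -> m.-integrable setT (g \o f) ->
  (\int[image_measure]_y g y = \int[m]_x g (f x))%E.
Proof.
move=> mg ig.
by rewrite [LHS](integral_pushforward mf) ?preimage_setT.
Qed.

End image_measure.

Section density.
Local Open Scope ereal_scope.

(** [p] has the same integrals over measurable sets as the Radon-Nikodym derivative of [nu], hence
    equals it almost everywhere, and the change of variables for the derivative carries over to
    [p]. *)
Lemma ge0_integral_density d (T : measurableType d) (R : realType)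
    (mu : {sigma_finite_measure set T -> \bar R})
    (nu : {finite_measure set T -> \bar R}) (p f : T -> \bar R) :
  mu.-integrable setT p ->
  (forall A, measurable A -> nu A = \int[mu]_(x in A) p x) ->
  measurable_fun setT f -> (forall x, 0 <= f x) ->
  \int[nu]_x f x = \int[mu]_x (f x * p x).
Proof.
move=> ip nuE mf f0.
have numu : nu `<< mu.
  apply/null_content_dominatesP => A mA A0.
  rewrite nuE//; apply: null_set_integral => //.
  exact: measurable_funTS (measurable_int _ ip).
rewrite -(Radon_Nikodym_SigmaFinite.change_of_variables numu)//.
have mg := Radon_Nikodym_SigmaFinite.f_integrable numu.
apply: ae_eq_integral => //.
- by apply: emeasurable_funM => //; exact: (measurable_int mu).
- by apply: emeasurable_funM => //; exact: (measurable_int mu).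
- apply: ae_eqe_mul2l => /=; apply: integral_ae_eq => //=.
    exact: measurable_int ip.
  move=> E _ mE; rewrite -nuE//.
  exact/esym/Radon_Nikodym_SigmaFinite.f_integral.
Qed.

End density.

(** * Gaussian integrals and the one-dimensional Cameron-Martin formula *)

Lemma sqr_le_expR (R : realType) (x : R) :
  x ^+ 2 <= 2 * (expR x + expR (- x)).
Proof.
have f2 : (2`!)%:R = 2 :> R by [].
have [x0|x0] := leP 0 x.
  have := expR_ge1Dxn 1 x0; have := expR_ge0 (- x); rewrite f2; lra.
have nx0 : 0 <= - x by rewrite oppr_ge0 ltW.
have := expR_ge1Dxn 1 nx0; have := expR_ge0 x; rewrite f2 sqrrN; lra.
Qed.

Section gaussian.
Context {R : realType}.
Local Notation mu := (@lebesgue_measure R).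
Local Open Scope ereal_scope.

(** The image of Lebesgue measure under a translation gives half-open intervals their length, and
    this characterizes Lebesgue measure. The scaling lemma below has the same proof, with the factor
    [a] put on the image measure. *)
Lemma ge0_integral_shift (a : R) (f : R -> \bar R) :
  measurable_fun setT f -> (forall x, 0 <= f x) ->
  \int[mu]_x f (x + a)%R = \int[mu]_x f x.
Proof.
move=> mf f0.
have ms : @measurable_fun _ _ (measurableTypeR R) (measurableTypeR R) setT
  (fun x : R => (x + a)%R) by exact: measurable_funD.
rewrite -(ge0_integral_image mu ms)//; apply: eq_measure_integral => A mA _.
apply/esym; apply: lebesgue_measure_unique mA => _ [[b c]] _ <-.
rewrite image_measureE.
rewrite (_ : _ @^-1` _ = `](b - a)%R, (c - a)%R]%classic); last first.
  by apply/seteqP; split => x /=; rewrite !in_itv/= ltrBlDr lerBrDr.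
rewrite [LHS]lebesgue_measure_itv [RHS]lebesgue_measure_itv/= !lte_fin ltrD2r.
by case: ifP => // _; rewrite -!EFinD; congr EFin; ring.
Qed.

Lemma ge0_integral_scale (a : R) (f : R -> \bar R) : (0 < a)%R ->
  measurable_fun setT f -> (forall x, 0 <= f x) ->
  \int[mu]_x f x = a%:E * \int[mu]_x f (a * x)%R.
Proof.
move=> a0 mf f0.
have ms : @measurable_fun _ _ (measurableTypeR R) (measurableTypeR R) setT
  (fun x : R => (a * x)%R) by exact: measurable_funM.
rewrite -[X in _ = _ * X](ge0_integral_image mu ms)//.
have <- : \int[mscale (NngNum (ltW a0)) (image_measure mu ms)]_x f x
    = a%:E * \int[image_measure mu ms]_x f x.
  by rewrite ge0_integral_mscale.
apply: eq_measure_integral => A mA _.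
apply: lebesgue_measure_unique mA => _ [[b c]] _ <-.
rewrite /= /mscale/= (image_measureE mu ms).
rewrite (_ : _ @^-1` _ = `](a^-1 * b)%R, (a^-1 * c)%R]%classic); last first.
  apply/seteqP; split => x /=; rewrite !in_itv/= ![(a^-1 * _)%R]mulrC.
    by rewrite ltr_pdivrMr// ler_pdivlMr// ![(x * a)%R]mulrC.
  by rewrite ltr_pdivrMr// ler_pdivlMr// ![(x * a)%R]mulrC.
rewrite [LHS]lebesgue_measure_itv [X in _ = _ * X]lebesgue_measure_itv/= !lte_fin ltr_pM2l ?invr_gt0//.
case: ifP => _; last by rewrite mule0.
by rewrite -!EFinD -EFinM -mulrBr mulrA divff ?mul1r// gt_eqF.
Qed.

Lemma ge0_integral_normal (s : R) (f : R -> \bar R) :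
  measurable_fun setT f -> (forall x, 0 <= f x) ->
  \int[normal_prob 0 s]_x f x = \int[mu]_x (f x * (normal_pdf 0 s x)%:E).
Proof.
move=> mf f0; apply: ge0_integral_density => //.
exact: integrable_normal_pdf.
Qed.

(* Cameron-Martin in dimension one: tilting a centred Gaussian of variance
   s^2 by exp(a z - a^2 s^2 / 2) translates it by a s^2. *)
Lemma normal_tilt (s a : R) (f : R -> \bar R) : (s != 0)%R ->
  measurable_fun setT f -> (forall x, 0 <= f x) ->
  \int[normal_prob 0 s]_z (f z * (expR (a * z - a ^+ 2 * s ^+ 2 / 2))%:E)
  = \int[normal_prob 0 s]_z f (z + a * s ^+ 2)%R.
Proof.
move=> s0 mf f0.
have me : measurable_fun setT (fun z : R => (expR (a * z - a ^+ 2 * s ^+ 2 / 2))%:E).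
  apply/measurable_EFinP; apply: measurableT_comp => //.
  by apply: measurable_funB => //; exact: measurable_funM.
have mp : measurable_fun setT (fun z : R => (normal_pdf 0 s z)%:E).
  by apply/measurable_EFinP; exact: measurable_normal_pdf.
rewrite !ge0_integral_normal//; last 3 first.
- by apply: measurableT_comp mf _; exact: measurable_funD.
- exact: emeasurable_funM.
- by move=> x; rewrite mule_ge0.
rewrite -[LHS](ge0_integral_shift (a * s ^+ 2)); last 2 first.
- by do 2 apply: emeasurable_funM => //.
- by move=> x; rewrite !mule_ge0// lee_fin normal_pdf_ge0.
apply: eq_integral => z _.
(* Completing the square: at the shifted point z + a s^2, the exponent of the density plus that of
   the tilt is -z^2 / (2 s^2). *)
rewrite -muleA -EFinM; congr (_ * EFin _).
rewrite normal_pdfE// mulrCA /normal_fun -expRD; congr (_ * expR _)%R.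
by field.
Qed.

Lemma ge0_integral_normalN (s : R) (f : R -> \bar R) : (s != 0)%R ->
  measurable_fun setT f -> (forall x, 0 <= f x) ->
  \int[normal_prob 0 s]_x f (- x)%R = \int[normal_prob 0 s]_x f x.
Proof.
move=> s0 mf f0.
have mN : @measurable_fun _ _ (measurableTypeR R) (measurableTypeR R) setT
  (fun x : R => (- x)%R) by exact: measurable_funN.
have mfN : measurable_fun setT (fun x : R => f (- x)%R) by exact: measurableT_comp.
have mp : measurable_fun setT (fun z : R => (normal_pdf 0 s z)%:E).
  by apply/measurable_EFinP; exact: measurable_normal_pdf.
rewrite !ge0_integral_normal//.
pose g x := f x * (normal_pdf 0 s x)%:E.
have mg : measurable_fun setT g by exact: emeasurable_funM.
have g0 x : 0 <= g x by rewrite mule_ge0// lee_fin normal_pdf_ge0.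
transitivity (\int[mu]_x g (- x)%R).
  apply: eq_integral => x _; congr (_ * _%:E).
  by rewrite !normal_pdfE// /normal_fun !subr0 sqrrN.
rewrite -(ge0_integral_image mu mN)//.
apply: eq_measure_integral => A mA _; exact: lebesgue_measureN.
Qed.

(** Kept as a symbolic constant: the isometry built on it serves to show that quantities tend to 0,
    where any finite factor is harmless. *)
Definition normal_variance1 : \bar R := \int[normal_prob 0 1]_x ((x ^+ 2)%:E : \bar R).

Lemma normal_variance (s : R) : (0 < s)%R ->
  \int[normal_prob 0 s]_x (x ^+ 2)%:E = (s ^+ 2)%:E * normal_variance1.
Proof.
move=> s0.
have msq : measurable_fun setT (fun z : R => (z ^+ 2)%:E).
  by apply/measurable_EFinP; exact: exprn_measurable.
have sq0 (x : R) : 0 <= (x ^+ 2)%:E by rewrite lee_fin sqr_ge0.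
have mp (t : R) : measurable_fun setT (fun z : R => (normal_pdf 0 t z)%:E).
  by apply/measurable_EFinP; exact: measurable_normal_pdf.
rewrite /normal_variance1 !ge0_integral_normal// (ge0_integral_scale s0); last 2 first.
- exact: emeasurable_funM.
- by move=> x; rewrite mule_ge0// lee_fin normal_pdf_ge0.
rewrite -!ge0_integralZl.
- apply: eq_integral => x _.
  rewrite -!EFinM; congr EFin.
  have -> : normal_pdf 0 s (s * x)%R = (s^-1 * normal_pdf 0 1 x)%R.
    rewrite !normal_pdfE ?gt_eqF// mulrA; congr (_ * expR _)%R.
      rewrite /normal_peak expr1n mul1r -mulrnAr sqrtrM ?sqr_ge0//.
      by rewrite sqrtr_sqr gtr0_norm// invfM.
    by rewrite !subr0; field; rewrite gt_eqF.
  by field; rewrite gt_eqF.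
- exact: measurableT.
- exact: (emeasurable_funM msq (mp 1)%R).
- by move=> x _; rewrite mule_ge0// lee_fin normal_pdf_ge0.
- by rewrite lee_fin sqr_ge0.
- exact: measurableT.
- apply: emeasurable_funM.
    by apply/measurable_EFinP/measurable_funX/measurable_funM.
  by apply: measurableT_comp (mp s) _; exact: measurable_funM.
- by move=> x _; rewrite mule_ge0// lee_fin ?normal_pdf_ge0// sqr_ge0.
- by rewrite lee_fin ltW.
Qed.

(** By [sqr_le_expR] the second moment is dominated by the exponential moments at 1 and -1, and the
    tilt formula evaluates each of these to exp(1/2). *)
Lemma normal_variance1_lty : normal_variance1 < +oo.
Proof.
pose e1 := (expR (2^-1))%:E : \bar R.
have me (a : R) : measurable_fun setT (fun z : R => (expR (a * z))%:E).
  by apply/measurable_EFinP/measurableT_comp => //; exact: measurable_funM.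
have int_e (a : R) : (a ^+ 2 = 1)%R ->
    \int[normal_prob 0 (1 : R)]_z (expR (a * z))%:E = e1.
  move=> a1.
  have e10 (x : R) : 0 <= cst e1 x by rewrite lee_fin expR_ge0.
  have <- : \int[normal_prob 0 (1 : R)]_z cst e1 z = e1.
    by rewrite integral_cst// -[RHS]mule1; congr (_ * _); exact: (@probability_setT _ _ _ (normal_prob 0 1)).
  (* The translate of a constant is the same constant, so tilting the constant exp(1/2) leaves its
     integral unchanged; for a^2 = 1 the tilted function is exp(a z). *)
  rewrite -[RHS](@normal_tilt 1 a (cst e1) (oner_neq0 _) (measurable_cst _) e10).
  apply: eq_integral => x _.
  by rewrite /= -EFinM -expRD a1 expr1n; congr (expR _)%:E; field.
have : \int[normal_prob 0 (1 : R)]_z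
    (2%:E * ((expR (1 * z))%:E + (expR (-1 * z))%:E)) < +oo.
  rewrite ge0_integralZl//; last 2 first.
    exact: (emeasurable_funD (me 1%R) (me (-1)%R)).
    by move=> x _; rewrite adde_ge0.
  rewrite ge0_integralD//; last 2 first.
    exact: (me 1%R).
    exact: (me (-1)%R).
  apply: (@le_lt_trans _ _ (2%:E * (e1 + e1))); last by rewrite -EFinD -EFinM ltry.
  by rewrite lee_pmul2l//; apply: leeD; rewrite le_eqVlt; apply/orP; left;
    apply/eqP; apply: int_e; rewrite ?expr1n// sqrrN expr1n.
apply: le_lt_trans; apply: ge0_le_integral => //.
- by move=> x _; rewrite lee_fin sqr_ge0.
- have m : measurable_fun setT (fun z : R => (z ^+ 2)%:E) by apply/measurable_EFinP; exact: exprn_measurable.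
  exact: m.
- exact: (emeasurable_funM (measurable_cst _) (emeasurable_funD (me 1%R) (me (-1)%R))).
- move=> x _; rewrite -EFinD -EFinM lee_fin mul1r mulN1r.
  exact: sqr_le_expR.
Qed.

End gaussian.

(** * Independence, filtrations and Brownian increments *)

Section freezing.
Context d (Omega : measurableType d) (R : realType) (P : probability Omega R).
Context d1 d2 (T : measurableType d1) (E : measurableType d2).
Variables (X : Omega -> T) (Z : Omega -> E) (Q : probability E R).
Hypotheses (mX : measurable_fun setT X) (mZ : measurable_fun setT Z).
Hypothesis indep : forall A B, measurable A -> measurable B ->
  P (X @^-1` A `&` Z @^-1` B) = (P (X @^-1` A) * Q B)%E.
Local Open Scope ereal_scope.

Let lawX : probability T R := distribution P (mfun_Sub (mem_set mX)).

Let mXZ : measurable_fun setT (fun w => (X w, Z w)).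
Proof. exact: measurable_fun_pair. Qed.

Let law_pair A : measurable A -> (lawX \x Q) A = image_measure P mXZ A.
Proof.
by apply: product_measure_unique => B C mB mC; rewrite image_measureE -indep.
Qed.

(** Independence says that the law of the pair agrees with a product measure on rectangles, hence
    everywhere; Tonelli's theorem then integrates out [Z] with [X] frozen. *)
Lemma ge0_integral_freeze (f : T * E -> \bar R) :
  measurable_fun setT f -> (forall p, 0 <= f p) ->
  \int[P]_w f (X w, Z w) = \int[P]_w \int[Q]_z f (X w, z).
Proof.
move=> mf f0; rewrite -(ge0_integral_image P mXZ)//.
rewrite (eq_measure_integral (lawX \x Q)); last by move=> A mA _; apply/esym; exact: law_pair.
rewrite fubini_tonelli1//.
rewrite [LHS](ge0_integral_image P mX)//.
  exact: measurable_fun_fubini_tonelli_F.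
by move=> x; apply: integral_ge0.
Qed.

Lemma integral_freeze (f : T * E -> \bar R) :
  measurable_fun setT f -> P.-integrable setT (fun w => f (X w, Z w)) ->
  \int[P]_w f (X w, Z w) = \int[P]_w \int[Q]_z f (X w, z).
Proof.
move=> mf fi.
have fi2 : (lawX \x Q).-integrable setT f.
  apply/integrableP; split => //.
  rewrite (eq_measure_integral (image_measure P mXZ)); last by move=> A mA _; exact: law_pair.
  rewrite ge0_integral_image//; last exact: measurableT_comp.
  by case/integrableP : fi.
rewrite -(integral_image (m := P) mXZ)//.
rewrite (eq_measure_integral (lawX \x Q)); last by move=> A mA _; apply/esym; exact: law_pair.
rewrite -integral12_prod_meas1//.
have mF := measurable_fubini_F fi2.
have iF := integrable_fubini_F fi2.
rewrite [LHS](integral_image (m := P) mX)//.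
apply/integrableP; split; first exact: measurableT_comp mF mX.
have /integrableP[_] := iF.
by rewrite [X in X < _ -> _](ge0_integral_image P mX)//; exact: measurableT_comp.
Qed.

End freezing.

Section filtration_lemmas.
Context {R : realType} {d : measure_display} {Omega : measurableType d}.
Variables (P : probability Omega R) (F : R -> set (set Omega)).
Hypothesis F_usual : usual_filtration P F.

(** [F t] being a sigma-algebra already, the type [g_sigma_algebraType (F t)] carries exactly the
    events of [F t], and [measurable_fun] on this type expresses adaptedness at time [t]. *)
Lemma filtrationE (t : R) : 0 <= t <= 1 -> <<s F t >> = F t.
Proof.
by move=> t01; apply: sigma_algebra_id; exact: filtration_sigma_algebra F_usual _ t01.
Qed.

Lemma measurable_wrtP (t : R) (f : Omega -> R) : 0 <= t <= 1 ->
  measurable_wrt (F t) f <->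
  measurable_fun [set: g_sigma_algebraType (F t)] f.
Proof.
move=> t01; split => [mf _ B mB|mf B mB].
  by rewrite setTI /measurable/= filtrationE//; exact: mf.
by rewrite -filtrationE// -[X in <<s _ >> X]setTI; exact: mf.
Qed.

Lemma measurable_filtration_le (s t : R) (f : Omega -> R) :
  0 <= s -> s <= t -> t <= 1 ->
  measurable_fun [set: g_sigma_algebraType (F s)] f ->
  measurable_fun [set: g_sigma_algebraType (F t)] f.
Proof.
move=> s0 st t1; have s01 : 0 <= s <= 1 by rewrite s0 (le_trans st).
have t01 : 0 <= t <= 1 by rewrite t1 (le_trans s0).
move/(measurable_wrtP _ s01) => mf; apply/(measurable_wrtP _ t01) => B mB.
exact: (filtration_nondecreasing F_usual s0 st t1) (mf _ mB).
Qed.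

Lemma measurable_filtration (t : R) (f : Omega -> R) : 0 <= t <= 1 ->
  measurable_fun [set: g_sigma_algebraType (F t)] f ->
  measurable_fun [set: Omega] f.
Proof.
move=> t01 /(measurable_wrtP _ t01) mf _ B mB; rewrite setTI.
exact: (filtration_measurable F_usual t01) (mf _ mB).
Qed.

Lemma filtration_id_measurable (t : R) : 0 <= t <= 1 ->
  measurable_fun [set: Omega] (id : Omega -> g_sigma_algebraType (F t)).
Proof.
move=> t01 _ B; rewrite /measurable/= filtrationE// => FB.
by rewrite setTI preimage_id; exact: (filtration_measurable F_usual t01).
Qed.

End filtration_lemmas.

Section brownian_freezing.
Context {R : realType} {d : measure_display} {Omega : measurableType d}.
Variables (P : probability Omega R) (F : R -> set (set Omega)).
Variable W : R -> Omega -> R.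
Hypotheses (F_usual : usual_filtration P F) (W_brownian : brownian_motion P F W).

Lemma measurable_brownian (t : R) : 0 <= t <= 1 ->
  measurable_fun [set: g_sigma_algebraType (F t)] (W t).
Proof.
move=> t01; apply/(measurable_wrtP F_usual _ t01).
exact: (bm_adapted W_brownian).
Qed.

Lemma brownian_increment_measurable (s t : R) : 0 <= s <= 1 -> 0 <= t <= 1 ->
  measurable_fun [set: Omega] (fun w => W t w - W s w).
Proof.
move=> s01 t01; apply: measurable_funB.
  exact: (measurable_filtration F_usual t01) (measurable_brownian t01).
exact: (measurable_filtration F_usual s01) (measurable_brownian s01).
Qed.

Section increment.
Variables (s t : R).
Hypotheses (s0 : 0 <= s) (st : s < t) (t1 : t <= 1).
Let s01 : 0 <= s <= 1. Proof. by rewrite s0 (le_trans (ltW st)). Qed.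
Let t01 : 0 <= t <= 1. Proof. by rewrite t1 (le_trans s0 (ltW st)). Qed.

Local Notation OmegaF := (g_sigma_algebraType (F s)).
Local Open Scope ereal_scope.

Let indep (A : set OmegaF) (B : set (measurableTypeR R)) :
  measurable A -> measurable B ->
  P ((id : Omega -> OmegaF) @^-1` A `&` (fun w => W t w - W s w)%R @^-1` B) =
  P ((id : Omega -> OmegaF) @^-1` A) * normal_prob 0 (Num.sqrt (t - s)) B.
Proof.
rewrite {1}/measurable/= (filtrationE F_usual s01) => FA mB.
rewrite (bm_independent_increments W_brownian)//.
by rewrite (bm_gaussian_increments W_brownian).
Qed.

Lemma ge0_brownian_freeze (f : OmegaF * measurableTypeR R -> \bar R) :
  measurable_fun setT f -> (forall p, 0 <= f p) ->
  \int[P]_w f (w, (W t w - W s w)%R) =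
  \int[P]_w \int[normal_prob 0 (Num.sqrt (t - s))]_z f (w, z).
Proof.
move=> mf f0; apply: (ge0_integral_freeze _ _ indep) => //.
  exact: (filtration_id_measurable F_usual s01).
exact: brownian_increment_measurable.
Qed.

Lemma brownian_freeze (f : OmegaF * measurableTypeR R -> \bar R) :
  measurable_fun setT f ->
  P.-integrable setT (fun w => f (w, (W t w - W s w)%R)) ->
  \int[P]_w f (w, (W t w - W s w)%R) =
  \int[P]_w \int[normal_prob 0 (Num.sqrt (t - s))]_z f (w, z).
Proof.
move=> mf fi; apply: (integral_freeze _ _ indep) => //.
  exact: (filtration_id_measurable F_usual s01).
exact: brownian_increment_measurable.
Qed.

End increment.

End brownian_freezing.

(** * Euler chains and the discrete Girsanov identity *)

Section euler.
Context {R : realType} {Omega : Type}.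
Variables (W : R -> Omega -> R) (x0 : R) (t : nat -> R).

(** Chains of different drifts are driven by the increments of the same [W], so that the chain of
    the true label can be compared with the solution path by path. *)
Fixpoint euler (c : nat -> R -> R) (i : nat) (w : Omega) : R :=
  if i is j.+1 then
    euler c j w + c j (euler c j w) * (t j.+1 - t j) + (W (t j.+1) w - W (t j) w)
  else x0.

(* [theta] is the change of drift; the exponentials are the conditional
   densities of the successive steps of the chain of drift [c + theta] with
   respect to those of the chain of drift [c]. *)
Definition euler_weight (c theta G : nat -> R -> R) (m : nat) (w : Omega) : R :=
  \prod_(i < m) (G i (euler c i w) *
    expR (theta i (euler c i w) * (W (t i.+1) w - W (t i) w)
          - (theta i (euler c i w)) ^+ 2 * (t i.+1 - t i) / 2)).

End euler.

Section discrete_girsanov.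
Context {R : realType} {d : measure_display} {Omega : measurableType d}.
Variables (P : probability Omega R) (F : R -> set (set Omega)).
Variables (W : R -> Omega -> R) (x0 : R) (t : nat -> R) (n : nat).
Hypotheses (F_usual : usual_filtration P F) (W_brownian : brownian_motion P F W).
Hypotheses (t0 : 0 <= t 0) (t1 : t n <= 1)
  (t_incr : forall i, (i < n)%N -> t i < t i.+1).

Let tmono i j : (i <= j)%N -> (j <= n)%N -> t i <= t j.
Proof.
move=> ij; elim: j ij => [|j ih]; first by rewrite leqn0 => /eqP ->.
rewrite leq_eqVlt => /predU1P[->//|]; rewrite ltnS => ij jn.
by rewrite (le_trans (ih ij (ltnW jn)))// ltW// t_incr.
Qed.

Let t01 i : (i <= n)%N -> 0 <= t i <= 1.
Proof. by move=> ?; rewrite (le_trans t0) ?tmono//= (le_trans _ t1)// tmono. Qed.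

Local Notation X := (euler W x0 t).
Local Notation weight := (euler_weight W x0 t).
Local Notation Om i := (g_sigma_algebraType (F (t i))).

Let lift i j (f : Omega -> R) : (i <= j)%N -> (j <= n)%N ->
  measurable_fun [set: Om i] f -> measurable_fun [set: Om j] f.
Proof.
move=> ij jn; apply: (measurable_filtration_le F_usual).
- by case/andP: (t01 (leq_trans ij jn)).
- exact: tmono.
- by case/andP: (t01 jn).
Qed.

Let mW i : (i <= n)%N -> measurable_fun [set: Om i] (W (t i)).
Proof. by move=> /t01; exact: (measurable_brownian F_usual W_brownian). Qed.

Lemma measurable_euler (c : nat -> R -> R) i :
  (forall i, measurable_fun setT (c i)) ->
  (i <= n)%N -> measurable_fun [set: Om i] (X c i).
Proof.
move=> mc; elim: i => [_|i ih lin]; first exact: measurable_cst.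
have mX := lift (leqnSn i) lin (ih (ltnW lin)).
apply: measurable_funD; last first.
  by apply: measurable_funB; [exact: mW|exact: lift (leqnSn i) lin (mW (ltnW lin))].
apply: measurable_funD => //; apply: measurable_funM => //.
exact: measurableT_comp (mc i) mX.
Qed.

Lemma measurable_euler_weight (c theta G : nat -> R -> R) m :
  (forall i, measurable_fun setT (c i)) ->
  (forall i, measurable_fun setT (theta i)) ->
  (forall i, measurable_fun setT (G i)) ->
  (m <= n)%N -> measurable_fun [set: Om m] (weight c theta G m).
Proof.
move=> mc mtheta mG mn; rewrite /weight.
apply: measurable_prod => -[i im] _ /=.
have lin : (i < n)%N := leq_trans im mn.
have mX := lift (ltnW im) mn (measurable_euler mc (ltnW lin)).
have mth : measurable_fun [set: Om m] (fun w => theta i (X c i w)).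
  exact: measurableT_comp (mtheta i) mX.
apply: measurable_funM; first exact: measurableT_comp (mG i) mX.
apply: measurableT_comp => //; apply: measurable_funB.
  apply: measurable_funM => //; apply: measurable_funB.
    exact: lift im mn (mW lin).
  exact: lift (ltnW im) mn (mW (ltnW lin)).
by apply: measurable_funM => //; apply: measurable_funM => //; exact: measurable_funX.
Qed.

Local Open Scope ereal_scope.

(** The transition operator of step [i] for the chain of drift [c + theta], multiplied by the
    observation factor [G i]. It depends on [c] and [theta] only through their sum. *)
Let step (i : nat) (c theta G : nat -> R -> R) (h : R -> \bar R) (x : R) : \bar R :=
  (G i x)%:E * \int[normal_prob 0 (Num.sqrt (t i.+1 - t i))]_z
    h (x + (c i x + theta i x) * (t i.+1 - t i) + z)%R.

Let measurable_step i c theta G h :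
  (forall i, measurable_fun setT (c i)) ->
  (forall i, measurable_fun setT (theta i)) ->
  (forall i, measurable_fun setT (G i)) ->
  measurable_fun setT h -> (forall x, 0 <= h x) ->
  measurable_fun setT (step i c theta G h).
Proof.
move=> mc mtheta mG mh h0; apply: emeasurable_funM.
  exact/measurable_EFinP.
pose f (p : R * measurableTypeR R) :=
  h (p.1 + (c i p.1 + theta i p.1) * (t i.+1 - t i) + p.2)%R.
apply: (@measurable_fun_fubini_tonelli_F _ _ _ _ _ _ f) => [|p]; last exact: h0.
apply: measurableT_comp => //.
have m1 : @measurable_fun _ _ (R * measurableTypeR R)%type R setT fst by exact: measurable_fst.
have m2 : @measurable_fun _ _ (R * measurableTypeR R)%type R setT snd by exact: measurable_snd.
apply: measurable_funD => //; apply: measurable_funD => //; apply: measurable_funM => //.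
by apply: measurable_funD => //; exact: measurableT_comp m1.
Qed.

(** Everything up to time [t m] is frozen. The exponential factor of the last step is then a tilt of
    the Gaussian increment, which translates it by [theta] times the step length and so turns the
    drift [c] into [c + theta]. *)
Lemma euler_step (A : set Omega) (c theta G : nat -> R -> R) (h : R -> \bar R) m :
  F (t 0) A ->
  (forall i, measurable_fun setT (c i)) ->
  (forall i, measurable_fun setT (theta i)) ->
  (forall i, measurable_fun setT (G i)) -> (forall i x, (0 <= G i x)%R) ->
  measurable_fun setT h -> (forall x, 0 <= h x) -> (m < n)%N ->
  \int[P]_w ((\1_A w * weight c theta G m.+1 w)%:E * h (X c m.+1 w)) =
  \int[P]_w ((\1_A w * weight c theta G m w)%:E * step m c theta G h (X c m w)).
Proof.
move=> FA mc mtheta mG G0 mh h0 mn.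
have [tm0 _] := andP (t01 (ltnW mn)); have [_ tm1] := andP (t01 mn).
have dt0 : (0 < t m.+1 - t m)%R by rewrite subr_gt0 t_incr.
have s2 : (Num.sqrt (t m.+1 - t m) ^+ 2 = t m.+1 - t m)%R by rewrite sqr_sqrtr// ltW.
pose U (w : Omega) := (\1_A w * weight c theta G m w)%R.
have U0 w : (0 <= U w)%R.
  by rewrite mulr_ge0// prodr_ge0// => i _; rewrite mulr_ge0// expR_ge0.
have mU : measurable_fun [set: Om m] U.
  apply: measurable_funM; last exact: measurable_euler_weight (ltnW mn).
  apply: lift (leq0n m) (ltnW mn) _; apply: measurable_indic.
  by rewrite /measurable/= (filtrationE F_usual (t01 (leq0n n))).
have mX : measurable_fun [set: Om m] (X c m) by exact: measurable_euler (ltnW mn).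
pose k (x z : R) : R := expR (theta m x * z - (theta m x) ^+ 2 * (t m.+1 - t m) / 2).
pose f (p : Om m * measurableTypeR R) : \bar R :=
  (U p.1 * G m (X c m p.1))%:E *
  (h (X c m p.1 + c m (X c m p.1) * (t m.+1 - t m) + p.2)%R * (k (X c m p.1) p.2)%:E).
have f0 p : 0 <= f p.
  by rewrite !mule_ge0// lee_fin ?expR_ge0// mulr_ge0.
have mf : measurable_fun setT f.
  have m1 : @measurable_fun _ _ (Om m * measurableTypeR R)%type (Om m) setT fst.
    exact: measurable_fst.
  have m2 : @measurable_fun _ _ (Om m * measurableTypeR R)%type R setT snd.
    exact: measurable_snd.
  have mX1 := measurableT_comp mX m1; have mU1 := measurableT_comp mU m1.
  have mth1 := measurableT_comp (mtheta m) mX1.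
  apply: emeasurable_funM.
    apply/measurable_EFinP; apply: measurable_funM => //.
    exact: measurableT_comp (mG m) mX1.
  apply: emeasurable_funM.
    apply: measurableT_comp => //; apply: measurable_funD => //.
    apply: measurable_funD => //; apply: measurable_funM => //.
    exact: measurableT_comp (mc m) mX1.
  apply/measurable_EFinP; apply: measurableT_comp => //; apply: measurable_funB.
    exact: measurable_funM.
  by apply: measurable_funM => //; apply: measurable_funM => //; exact: measurable_funX.
transitivity (\int[P]_w f (w, (W (t m.+1) w - W (t m) w)%R)).
  apply: eq_integral => w _; rewrite /f/= /weight big_ord_recr/= -/(weight _ _ _ _ _).
  by rewrite [h _ * _]muleC muleA -EFinM; congr (_%:E * _); rewrite /U /k !mulrA.
rewrite (ge0_brownian_freeze F_usual W_brownian)//; last exact: t_incr.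
apply: eq_integral => w _; rewrite /f/=.
set x := X c m w; set N := normal_prob _ _.
have mshift (a : R) : measurable_fun setT (fun z : R => h (a + z)%R).
  by apply: measurableT_comp => //; exact: measurable_funD.
rewrite -/(U w) /step.
rewrite ge0_integralZl//; last 3 first.
- have m2 : measurable_fun setT (fun z : R => h (x + c m x * (t m.+1 - t m) + z)%R * (k x z)%:E).
    apply: emeasurable_funM => //; apply/measurable_EFinP.
    by apply: measurableT_comp => //; apply: measurable_funB => //; exact: measurable_funM.
  exact: m2.
- by move=> z _; rewrite mule_ge0// lee_fin expR_ge0.
- by rewrite lee_fin mulr_ge0.
rewrite EFinM -muleA; congr (_ * (_ * _)).
have := @normal_tilt R (Num.sqrt (t m.+1 - t m)) (theta m x)
  (fun z => h (x + c m x * (t m.+1 - t m) + z)%R) _ (mshift _) (fun=> h0 _).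
rewrite s2 => -> //; last by rewrite gt_eqF// sqrtr_gt0.
apply: eq_integral => z _; congr h; ring.
Qed.

(** Peeling off the steps from the last one, both sides become the probability of the initial event
    times the same iterated transition operators, since these see only the total drift. The initial
    events may differ as long as they are equally likely: this is how two labels are compared. *)
Lemma euler_weight_integral (A A' : set Omega)
    (c theta c' theta' G : nat -> R -> R) (h : R -> \bar R) :
  F (t 0) A -> F (t 0) A' -> P A = P A' ->
  (forall i x, c i x + theta i x = c' i x + theta' i x)%R ->
  (forall i, measurable_fun setT (c i)) ->
  (forall i, measurable_fun setT (theta i)) ->
  (forall i, measurable_fun setT (c' i)) ->
  (forall i, measurable_fun setT (theta' i)) ->
  (forall i, measurable_fun setT (G i)) -> (forall i x, (0 <= G i x)%R) ->
  measurable_fun setT h -> (forall x, 0 <= h x) ->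
  \int[P]_w ((\1_A w * weight c theta G n w)%:E * h (X c n w)) =
  \int[P]_w ((\1_A' w * weight c' theta' G n w)%:E * h (X c' n w)).
Proof.
move=> FA FA' PAA' cc mc mth mc' mth' mG G0 mh h0.
have FM B : F (t 0) B -> measurable B.
  exact: (filtration_measurable F_usual (t01 (leq0n n))).
(* The test function is generalized because each peeled step replaces [h] by its image under the
   transition operator. *)
suff H m : (m <= n)%N -> forall h : R -> \bar R,
    measurable_fun setT h -> (forall x, 0 <= h x) ->
    \int[P]_w ((\1_A w * weight c theta G m w)%:E * h (X c m w)) =
    \int[P]_w ((\1_A' w * weight c' theta' G m w)%:E * h (X c' m w)) by exact: H.
elim: m => [_ {mh h0}h mh h0|m ih mn {mh h0}h mh h0].
  rewrite /euler_weight; under eq_integral do rewrite big_ord0 mulr1 /= muleC.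
  under [RHS]eq_integral do rewrite big_ord0 mulr1 /= muleC.
  rewrite !ge0_integralZl//; try by apply/measurable_EFinP/measurable_indic/FM.
  by rewrite !integral_indic ?setIT//; [congr (_ * _); exact: PAA'|exact: FM..].
rewrite (euler_step FA mc mth mG G0 mh h0 mn).
rewrite (euler_step FA' mc' mth' mG G0 mh h0 mn).
have ms := measurable_step m mc mth mG mh h0.
have s0 x : 0 <= step m c theta G h x.
  by rewrite mule_ge0 ?lee_fin//; exact: integral_ge0.
rewrite (ih (ltnW mn) _ ms s0).
apply: eq_integral => w _; congr (_ * _); rewrite /step; congr (_ * _).
by apply: eq_integral => z _; rewrite cc.
Qed.

End discrete_girsanov.

(** * Square integrability and the Ito isometry for elementary integrals *)

Section normal_mean.
Context {R : realType}.
Local Open Scope ereal_scope.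

Lemma normal_square_integrable (s : R) : (0 < s)%R ->
  (normal_prob 0 s).-integrable setT (fun z : measurableTypeR R => (z ^+ 2)%:E : \bar R).
Proof.
move=> s0; have m2 : measurable_fun setT (fun z : R => (z ^+ 2)%:E).
  by apply/measurable_EFinP; exact: exprn_measurable.
apply/integrableP; split; first exact: m2.
under eq_integral do rewrite gee0_abs ?lee_fin ?sqr_ge0//.
rewrite normal_variance// muleC lte_mul_pinfty//.
- by apply: integral_ge0 => x _; rewrite lee_fin sqr_ge0.
- rewrite ge0_fin_numE ?normal_variance1_lty//.
  by apply: integral_ge0 => x _; rewrite lee_fin sqr_ge0.
- by rewrite ltry.
Qed.

Lemma normal_id_integrable (s : R) : (0 < s)%R ->
  (normal_prob 0 s).-integrable setT (fun z : measurableTypeR R => (z : R)%:E : \bar R).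
Proof.
move=> s0; have m1 : measurable_fun setT (fun z : R => z%:E).
  exact: EFin_measurable.
apply: (@le_integrable _ _ _ _ _ _ _ (fun z : measurableTypeR R => (1 + z ^+ 2)%:E)).
- exact: measurableT.
- exact: m1.
- move=> z _; rewrite /= lee_fin [X in (_ <= X)%R]ger0_norm; last first.
    by rewrite addr_ge0// sqr_ge0.
  by rewrite -[(z ^+ 2)%R]real_normK ?num_real//; nra.
- under eq_fun do rewrite EFinD.
  apply: integrableD => //; last exact: normal_square_integrable.
  exact: finite_measure_integrable_cst.
Qed.

(** By symmetry the positive and negative parts of the identity have equal integrals, finite because
    the second moment is. *)
Lemma normal_mean0 (s : R) : (0 < s)%R ->
  \int[normal_prob 0 s]_z ((z : R)%:E : \bar R) = 0.
Proof.
move=> s0; rewrite integralE.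
have m1 : measurable_fun setT (fun z : R => z%:E).
  exact: EFin_measurable.
have mp := measurable_funepos m1.
have pn := @ge0_integral_normalN R s _ (lt0r_neq0 s0) mp (fun=> funepos_ge0 _ _).
rewrite -[X in X - _]pn.
rewrite [X in X - _](eq_integral (funeneg (fun z : measurableTypeR R => z%:E)))/=; last first.
  by move=> x _; rewrite funeposE funenegE EFinN.
rewrite subee//; apply: integrable_fin_num => //.
by apply: integrable_funeneg => //; exact: normal_id_integrable.
Qed.

End normal_mean.

Section square_integrable.
Context {R : realType} {d : measure_display} {Omega : measurableType d}.
Variable P : probability Omega R.

Definition square_integrable (f : Omega -> R) : Prop :=
  measurable_fun setT f /\ P.-integrable setT (fun w => (f w ^+ 2)%:E).

Lemma square_integrableM (f g : Omega -> R) :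
  square_integrable f -> square_integrable g ->
  P.-integrable setT (fun w => (f w * g w)%:E).
Proof.
move=> [mf f2] [mg g2].
apply: (le_integrable measurableT _ _ (integrableD _ f2 g2)) => //.
  by apply/measurable_EFinP; exact: measurable_funM.
move=> w _ /=; rewrite lee_fin [leRHS]ger0_norm ?addr_ge0 ?sqr_ge0//.
by rewrite ler_norml; apply/andP; split; nra.
Qed.

Lemma bounded_integrable (f : Omega -> R) (M : R) :
  measurable_fun setT f -> (forall w, `|f w| <= M) ->
  P.-integrable setT (fun w => (f w)%:E).
Proof.
move=> mf fM; apply: measurable_bounded_integrable => //.
- by apply: (@le_lt_trans _ _ 1%E); [exact: probability_le1|rewrite ltry].
- exists M; split; first exact: num_real.
  by move=> x Mx w _ /=; rewrite (le_trans (fM w))// ltW.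
Qed.

Lemma square_integrable_bounded (f : Omega -> R) (M : R) :
  measurable_fun setT f -> (forall w, `|f w| <= M) -> square_integrable f.
Proof.
move=> mf fM; split=> //; apply: (@bounded_integrable _ (M ^+ 2)).
  exact: measurable_funX.
by move=> w; rewrite normrX lerXn2r ?nnegrE//; exact: le_trans (fM w).
Qed.

Lemma square_integrableMb (f g : Omega -> R) (M : R) :
  measurable_fun setT f -> (forall w, `|f w| <= M) -> square_integrable g ->
  square_integrable (fun w => f w * g w).
Proof.
move=> mf fM [mg g2]; split; first exact: measurable_funM.
apply: (le_integrable measurableT _ _ (integrableZl _ (M ^+ 2) g2)) => //.
  by apply/measurable_EFinP; apply: measurable_funX; exact: measurable_funM.
move=> w _ /=; rewrite lee_fin; have M0 : 0 <= M by exact: le_trans (fM w).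
have nM (x y : R) : `|x ^+ 2 * y ^+ 2| = x ^+ 2 * y ^+ 2.
  by rewrite ger0_norm// mulr_ge0// sqr_ge0.
rewrite exprMn !nM.
by rewrite ler_wpM2r ?sqr_ge0// -[leLHS]real_normK ?num_real// lerXn2r ?nnegrE ?fM.
Qed.

End square_integrable.

Section ito_isometry.
Context {R : realType} {d : measure_display} {Omega : measurableType d}.
Variables (P : probability Omega R) (F : R -> set (set Omega)).
Variable W : R -> Omega -> R.
Hypotheses (F_usual : usual_filtration P F) (W_brownian : brownian_motion P F W).

Local Notation Om s := (g_sigma_algebraType (F s)).
Local Notation v := (fine (@normal_variance1 R)).
Local Open Scope ereal_scope.

Let v_fin : normal_variance1 = v%:E :> \bar R.
Proof.
rewrite fineK// ge0_fin_numE ?normal_variance1_lty//.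
by apply: integral_ge0 => x _; rewrite lee_fin sqr_ge0.
Qed.

Lemma brownian_increment_variance (s t : R) :
  (0 <= s)%R -> (s <= t)%R -> (t <= 1)%R ->
  \int[P]_w ((W t w - W s w) ^+ 2)%:E = (v * (t - s))%:E.
Proof.
move=> s0; rewrite le_eqVlt => /predU1P[<- _|st t1].
  rewrite subrr mulr0; under eq_integral do rewrite subrr expr0n/=.
  exact: integral0.
have ds0 : (0 < t - s)%R by rewrite subr_gt0.
pose f (p : Om s * measurableTypeR R) : \bar R := ((p.2 : R) ^+ 2)%:E.
have mf : measurable_fun setT f.
  have m2 : @measurable_fun _ _ (Om s * measurableTypeR R)%type R setT snd.
    exact: measurable_snd.
  by apply/measurable_EFinP; exact: measurable_funX.
rewrite -[LHS]/(\int[P]_w f (w, (W t w - W s w)%R)).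
rewrite (ge0_brownian_freeze F_usual W_brownian)//; last first.
  by move=> p; rewrite lee_fin sqr_ge0.
under eq_integral do rewrite /= normal_variance ?sqrtr_gt0// sqr_sqrtr ?ltW// v_fin.
rewrite integral_cst//= mulrC -[RHS]mule1; congr (_ * _).
exact: probability_setT.
Qed.

Lemma brownian_increment_square_integrable (s t : R) :
  (0 <= s)%R -> (s <= t)%R -> (t <= 1)%R ->
  square_integrable P (fun w => W t w - W s w)%R.
Proof.
move=> s0 st t1; have m : measurable_fun setT (fun w => W t w - W s w)%R.
  apply: (brownian_increment_measurable F_usual W_brownian).
    by rewrite s0 (le_trans st).
  by rewrite t1 (le_trans s0).
split=> //; apply/integrableP; split.
  by apply/measurable_EFinP; exact: measurable_funX.
under eq_integral do rewrite gee0_abs ?lee_fin ?sqr_ge0//.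
by rewrite brownian_increment_variance// ltry.
Qed.

(** With [U] frozen at time [s], the inner integral is [U] times the mean of a centred Gaussian. *)
Lemma brownian_orthogonal (s t : R) (U : Omega -> R) :
  (0 <= s)%R -> (s <= t)%R -> (t <= 1)%R ->
  measurable_fun [set: Om s] U -> square_integrable P U ->
  \int[P]_w (U w * (W t w - W s w))%:E = 0.
Proof.
move=> s0; rewrite le_eqVlt => /predU1P[<- _ _ _|st t1 mU U2].
  by under eq_integral do rewrite subrr mulr0; exact: integral0.
have s01 : (0 <= s <= 1)%R by rewrite s0 (le_trans (ltW st)).
have ds0 : (0 < t - s)%R by rewrite subr_gt0.
pose f (p : Om s * measurableTypeR R) : \bar R := (U p.1 * (p.2 : R))%:E.
have mf : measurable_fun setT f.
  have m1 : @measurable_fun _ _ (Om s * measurableTypeR R)%type (Om s) setT fst.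
    exact: measurable_fst.
  have m2 : @measurable_fun _ _ (Om s * measurableTypeR R)%type R setT snd.
    exact: measurable_snd.
  apply/measurable_EFinP; apply: measurable_funM => //; exact: measurableT_comp mU m1.
rewrite -[LHS]/(\int[P]_w f (w, (W t w - W s w)%R)).
rewrite (brownian_freeze F_usual W_brownian)//; last first.
  apply: square_integrableM => //.
  exact: brownian_increment_square_integrable (ltW st) _.
rewrite -[RHS](integral0 P setT); apply: eq_integral => w _; rewrite /f/=.
under eq_integral do rewrite EFinM.
rewrite integralZl//; last by apply: normal_id_integrable; rewrite sqrtr_gt0.
by rewrite normal_mean0 ?mule0// sqrtr_gt0.
Qed.

Lemma brownian_square_increment (s t : R) (U : Omega -> R) (M : R) :
  (0 <= s)%R -> (s <= t)%R -> (t <= 1)%R ->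
  measurable_fun [set: Om s] U -> (forall w, (`|U w| <= M)%R) ->
  \int[P]_w (U w * (W t w - W s w) ^+ 2)%:E =
  (v * (t - s))%:E * \int[P]_w (U w)%:E.
Proof.
move=> s0; rewrite le_eqVlt => /predU1P[<- _ _ _|st t1 mU UM].
  rewrite subrr mulr0 mul0e; under eq_integral do rewrite subrr expr0n/= mulr0.
  exact: integral0.
have s01 : (0 <= s <= 1)%R by rewrite s0 (le_trans (ltW st)).
have ds0 : (0 < t - s)%R by rewrite subr_gt0.
have mU' := measurable_filtration F_usual s01 mU.
have U2 := square_integrable_bounded P mU' UM.
have WW := brownian_increment_square_integrable s0 (ltW st) t1.
pose f (p : Om s * measurableTypeR R) : \bar R := (U p.1 * (p.2 : R) ^+ 2)%:E.
have mf : measurable_fun setT f.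
  have m1 : @measurable_fun _ _ (Om s * measurableTypeR R)%type (Om s) setT fst.
    exact: measurable_fst.
  have m2 : @measurable_fun _ _ (Om s * measurableTypeR R)%type R setT snd.
    exact: measurable_snd.
  apply/measurable_EFinP; apply: measurable_funM; first exact: measurableT_comp mU m1.
  exact: measurable_funX.
rewrite -[LHS]/(\int[P]_w f (w, (W t w - W s w)%R)).
rewrite (brownian_freeze F_usual W_brownian)//; last first.
  have := square_integrableM (square_integrableMb mU' UM WW) WW.
  by apply: eq_integrable => // w _; rewrite /f/= expr2 mulrA.
rewrite muleC -integralZr//; last first.
  exact: bounded_integrable mU' UM.
apply: eq_integral => w _; rewrite /f/=.
under eq_integral do rewrite EFinM.
rewrite integralZl//; last by apply: normal_square_integrable; rewrite sqrtr_gt0.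
rewrite normal_variance ?sqrtr_gt0// sqr_sqrtr ?ltW// v_fin -!EFinM.
by congr EFin; ring.
Qed.

(** The length of the intersection of []a, b]] and []a', b']]. *)
Definition overlap (a b a' b' : R) : R :=
  Num.max 0%R (Num.min b b' - Num.max a a')%R.

Lemma integral_overlap (a b a' b' : R) :
  (0 <= a)%R -> (b <= 1)%R -> 
  \int[lebesgue_measure]_(s in `[0%R, 1%R])
    ((\1_`]a, b] s * \1_`]a', b'] s)%:E) = (overlap a b a' b')%:E.
Proof.
move=> a0 b1.
rewrite (eq_integral (fun s : measurableTypeR R =>
  (\1_(`](Num.max a a'), (Num.min b b')]%classic) s)%:E)); last first.
  move=> s _; rewrite !indicE -natrM mulnb; congr (_%:R%:E).
  congr (nat_of_bool _); rewrite !mem_setE !in_itv/= gt_max le_min.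
  by case: (a < s)%R; case: (a' < s)%R; case: (s <= b)%R; case: (s <= b')%R.
rewrite integral_indic//= setIidl; last first.
  move=> s /=; rewrite !in_itv/= gt_max le_min => /andP[/andP[as_ _] /andP[sb _]].
  by rewrite (le_trans a0 (ltW as_)) (le_trans sb).
rewrite lebesgue_measure_itv/= lte_fin /overlap.
case: ltP => h; first by rewrite [Num.max 0%R _]max_r ?subr_ge0 ?(ltW h).
by rewrite [Num.max 0%R _]max_l// subr_le0.
Qed.

(** Two increments correlate only through the intersection of their intervals. Cutting at [a'] and
    at the smaller right end isolates the square of the common increment; every other product
    contains an increment posterior to all its remaining factors, and has mean 0. *)
Let pair_le (a b a' b' : R) (c c' : Omega -> R) (M M' : R) :
  (0 <= a)%R -> (a <= b)%R -> (b <= 1)%R -> (a <= a')%R -> (a' <= b')%R -> (b' <= 1)%R ->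
  measurable_fun [set: Om a] c -> (forall w, (`|c w| <= M)%R) ->
  measurable_fun [set: Om a'] c' -> (forall w, (`|c' w| <= M')%R) ->
  \int[P]_w ((c w * (W b w - W a w)) * (c' w * (W b' w - W a' w)))%:E =
  (v * overlap a b a' b')%:E * \int[P]_w (c w * c' w)%:E.
Proof.
move=> a0 ab b1 aa' ab' b1' mc cM mc' cM'.
have a0' := le_trans a0 aa'.
have a01 : (0 <= a <= 1)%R by rewrite a0 (le_trans ab).
have a01' : (0 <= a' <= 1)%R by rewrite a0' (le_trans ab').
have mca' := measurable_filtration_le F_usual a0 aa' (le_trans ab' b1') mc.
have mcT := measurable_filtration F_usual a01 mc.
have mcT' := measurable_filtration F_usual a01' mc'.
have sq s t s0 st t1 := @brownian_increment_square_integrable s t s0 st t1.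
have sqc s t s0 st t1 := square_integrableMb mcT cM (sq s t s0 st t1).
have sqc' s t s0 st t1 := square_integrableMb mcT' cM' (sq s t s0 st t1).
have mW t : (0 <= t)%R -> (t <= a')%R -> measurable_fun [set: Om a'] (W t).
  move=> t0 ta'; have a1' := le_trans ab' b1'.
  apply: (measurable_filtration_le F_usual t0 ta' a1').
  by apply: (measurable_brownian F_usual W_brownian); rewrite t0 (le_trans ta').
(* an increment over an interval lying before a' is orthogonal to the second factor *)
have before (t : R) : (a <= t)%R -> (t <= a')%R ->
    \int[P]_w ((c w * (W t w - W a w)) * (c' w * (W b' w - W a' w)))%:E = 0.
  move=> at_ ta'; have t1 := le_trans ta' (le_trans ab' b1').
  have m : measurable_fun [set: Om a'] (fun w => c' w * (c w * (W t w - W a w)))%R.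
    apply: measurable_funM => //; apply: measurable_funM => //.
    exact: measurable_funB (mW t (le_trans a0 at_) ta') (mW a a0 aa').
  rewrite -(@brownian_orthogonal a' b' _ a0' ab' b1' m); last first.
    exact: square_integrableMb mcT' cM' (sqc a t a0 at_ t1).
  by apply: eq_integral => w _; congr EFin; ring.
have [ba'|a'b] := leP b a'.
  rewrite before// /overlap max_l ?mulr0 ?mul0e// subr_le0.
  by rewrite ge_min !le_max ba' !orbT.
(* With [m] and [M1] the smaller and larger right ends, (W_b - W_a')(W_b' - W_a') = (W_m - W_a')^2 +
   (W_m - W_a')(W_M1 - W_m). In the last product [U] collects the factors known at time [m]. *)
pose m := Num.min b b'; pose M1 := Num.max b b'.
have a'm : (a' <= m)%R by rewrite le_min (ltW a'b).
have mM1 : (m <= M1)%R by rewrite ge_min le_max lexx.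
have M11 : (M1 <= 1)%R by rewrite ge_max b1.
have m1 : (m <= 1)%R := le_trans mM1 M11.
have m0 : (0 <= m)%R := le_trans a0' a'm.
pose U w := (c' w * (c w * (W m w - W a' w)))%R.
have mU : measurable_fun [set: Om m] U.
  have up s (f : Omega -> R) : (0 <= s)%R -> (s <= m)%R -> measurable_fun [set: Om s] f ->
      measurable_fun [set: Om m] f.
    by move=> s0 sm; exact: (measurable_filtration_le F_usual s0 sm m1).
  apply: measurable_funM; first exact: up a0' a'm mc'.
  apply: measurable_funM; first exact: up a0 (le_trans aa' a'm) mc.
  apply: measurable_funB.
    by apply: (measurable_brownian F_usual W_brownian); rewrite m0.
  exact: up a0' a'm (measurable_brownian F_usual W_brownian a01').
have U2 : square_integrable P U.
  exact: square_integrableMb mcT' cM' (sqc a' m a0' a'm m1).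
have mcc : measurable_fun [set: Om a'] (fun w => c w * c' w)%R.
  exact: measurable_funM.
have ccM w : (`|c w * c' w| <= M * M')%R.
  by rewrite normrM ler_pM.
rewrite (eq_integral (fun w => ((c w * (W a' w - W a w)) * (c' w * (W b' w - W a' w)))%:E +
  ((c w * c' w * (W m w - W a' w) ^+ 2)%:E + (U w * (W M1 w - W m w))%:E))); last first.
  move=> w _; rewrite -!EFinD; congr EFin; rewrite /U /m /M1.
  by case: (leP b b') => _; ring.
have i1 : P.-integrable setT (fun w => (U w * (W M1 w - W m w))%:E).
  exact: square_integrableM U2 (sq m M1 m0 mM1 M11).
have i2 : P.-integrable setT (fun w => (c w * c' w * (W m w - W a' w) ^+ 2)%:E).
  have := square_integrableM (sqc a' m a0' a'm m1) (sqc' a' m a0' a'm m1).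
  by apply: eq_integrable => // w _; congr EFin; ring.
have i3 : P.-integrable setT
    (fun w => ((c w * (W a' w - W a w)) * (c' w * (W b' w - W a' w)))%:E).
  exact: square_integrableM (sqc a a' a0 aa' (le_trans ab' b1')) (sqc' a' b' a0' ab' b1').
rewrite integralD//; last exact: integrableD.
rewrite integralD// before// add0e (brownian_orthogonal m0 mM1 M11 mU U2) adde0.
rewrite (brownian_square_increment a0' a'm m1 mcc ccM).
by rewrite /overlap (max_r aa') [Num.max 0%R _]max_r// subr_ge0.
Qed.

Lemma overlapC (a b a' b' : R) : overlap a b a' b' = overlap a' b' a b.
Proof. by rewrite /overlap (minC b) (maxC a). Qed.

Section elementary_integrals.
Variables (I : finType) (a b : I -> R) (c : I -> Omega -> R) (M : I -> R).
Hypotheses (a0 : forall i, (0 <= a i)%R) (ab : forall i, (a i <= b i)%R)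
  (b1 : forall i, (b i <= 1)%R)
  (mc : forall i, measurable_fun [set: Om (a i)] (c i))
  (cM : forall i w, (`|c i w| <= M i)%R).

Let mcT i : measurable_fun [set: Omega] (c i).
Proof.
by apply: (measurable_filtration F_usual _ (@mc i)); rewrite a0 (le_trans (ab i)).
Qed.

Let pair i j :
  \int[P]_w ((c i w * (W (b i) w - W (a i) w)) * (c j w * (W (b j) w - W (a j) w)))%:E =
  (v * overlap (a i) (b i) (a j) (b j))%:E * \int[P]_w (c i w * c j w)%:E.
Proof.
have [aij|/ltW aji] := leP (a i) (a j); first exact: pair_le.
rewrite overlapC; under eq_integral do rewrite mulrC.
by rewrite (pair_le (M := M j) (M' := M i))//; under eq_integral do rewrite mulrC.
Qed.

(** Both squares expand into double sums, matched term by term through the overlaps. The intervals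
    form an arbitrary finite family, possibly overlapping, so that simple processes over different
    partitions can be subtracted without passing to a common refinement. *)
Lemma elementary_isometry :
  \int[P]_w ((\sum_i c i w * (W (b i) w - W (a i) w)) ^+ 2)%:E =
  v%:E * \int[P]_w \int[lebesgue_measure]_(s in `[0%R, 1%R])
    ((\sum_i c i w * \1_`]a i, b i] s) ^+ 2)%:E.
Proof.
have lhs w : ((\sum_i c i w * (W (b i) w - W (a i) w)) ^+ 2)%:E =
  \sum_i \sum_j ((c i w * (W (b i) w - W (a i) w)) * (c j w * (W (b j) w - W (a j) w)))%:E.
  rewrite expr2 mulr_suml -sumEFin; apply: eq_bigr => i _.
  by rewrite mulr_sumr -sumEFin.
under eq_integral do rewrite lhs.
have sqi i := square_integrableMb (mcT i) (cM i)
  (brownian_increment_square_integrable (a0 i) (ab i) (b1 i)).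
rewrite integral_sum//; last first.
  by move=> i; apply: integrable_sum => // j _; exact: square_integrableM.
under eq_bigr => i _.
  rewrite integral_sum//; last by move=> j; exact: square_integrableM.
  under eq_bigr do rewrite pair.
  over.
have cc2 i j : P.-integrable setT (fun w => (c i w * c j w)%:E).
  by apply: (@bounded_integrable _ _ _ _ _ (M i * M j)%R) => [|w];
    [exact: measurable_funM|rewrite normrM ler_pM].
pose r i j := fine (\int[P]_w (c i w * c j w)%:E).
have rE i j : \int[P]_w (c i w * c j w)%:E = (r i j)%:E.
  by rewrite fineK//; exact: integrable_fin_num.
have inner w : \int[lebesgue_measure]_(s in `[0%R, 1%R])
    ((\sum_i c i w * \1_`]a i, b i] s) ^+ 2)%:E =
  \sum_i \sum_j (overlap (a i) (b i) (a j) (b j))%:E * (c i w * c j w)%:E.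
  have ii i j : lebesgue_measure.-integrable `[0%R, 1%R] (fun s : measurableTypeR R =>
      ((\1_(`]a i, b i]%classic) s : R) * \1_(`]a j, b j]%classic) s)%:E).
    apply: measurable_bounded_integrable => //.
    - by rewrite [X in X < _]lebesgue_measure_itv/= lte_fin ltr01 oppr0 adde0 ltry.
    - by apply: measurable_funM; apply: measurable_funTS; exact: measurable_indic.
    - exists 1%R; split => // x x1 s _ /=; rewrite (le_trans _ (ltW x1))//.
      by rewrite normrM !indicE !normr_nat -natrM lern1 mulnb leq_b1.
  under eq_integral => s _.
    rewrite expr2 mulr_suml -sumEFin.
    under eq_bigr => i _.
      rewrite mulr_sumr -sumEFin.
      under eq_bigr => j _ do rewrite mulrACA mulrC EFinM muleC.
      over.
    over.
  rewrite integral_sum//; last first.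
    by move=> i; apply: integrable_sum => // j _; exact: integrableZl.
  apply: eq_bigr => i _; rewrite integral_sum//; last first.
    by move=> j; exact: integrableZl.
  by apply: eq_bigr => j _; rewrite integralZl// integral_overlap// muleC.
have -> : \int[P]_w \int[lebesgue_measure]_(s in `[0%R, 1%R])
    ((\sum_i c i w * \1_`]a i, b i] s) ^+ 2)%:E =
    (\sum_i \sum_j overlap (a i) (b i) (a j) (b j) * r i j)%:E.
  under eq_integral do rewrite inner.
  rewrite integral_sum//; last first.
    by move=> i; apply: integrable_sum => // j _; exact: integrableZl.
  rewrite -sumEFin; apply: eq_bigr => i _.
  rewrite integral_sum//; last by move=> j; exact: integrableZl.
  by rewrite -sumEFin; apply: eq_bigr => j _; rewrite integralZl// rE.
under eq_bigr => i _.
  under eq_bigr do rewrite rE -EFinM.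
  rewrite sumEFin.
  over.
rewrite sumEFin -EFinM mulr_sumr; congr EFin; apply: eq_bigr => i _.
by rewrite mulr_sumr; apply: eq_bigr => j _; rewrite mulrA.
Qed.

End elementary_integrals.

End ito_isometry.

(** * Integrals over time and the probability space *)

Section time_integral.
Context {R : realType} {d : measure_display} {Omega : measurableType d}.
Variable P : probability Omega R.
Local Notation lam := (@lebesgue_measure R).
Local Open Scope ereal_scope.

Definition jointly_measurable (K : R -> Omega -> R) : Prop :=
  measurable_fun [set p : measurableTypeR R * Omega | (0 <= p.1 <= 1)%R]
    (fun p => K p.1 p.2).

Let slab : set (measurableTypeR R * Omega) := [set p | (0 <= p.1 <= 1)%R].

Let slabE : slab = `[0%R, 1%R]%classic `*` setT.
Proof. by apply/seteqP; split=> p /=; rewrite in_itv/=; tauto. Qed.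

Let mslab : measurable slab.
Proof. by rewrite slabE; apply: measurableX. Qed.

Lemma jointly_measurable_section K w : jointly_measurable K ->
  measurable_fun (`[0%R, 1%R]%classic : set (measurableTypeR R)) (K ^~ w).
Proof.
move=> mK.
have mp : measurable_fun (`[0%R, 1%R]%classic : set (measurableTypeR R))
    (fun s : measurableTypeR R => (s, w) : measurableTypeR R * Omega).
  by apply: measurable_funTS; exact: pair2_measurable.
apply: (measurable_comp mslab _ mK mp) => p [s].
by rewrite /= in_itv/= => s01 <-.
Qed.

Lemma measurable_time_integral K : jointly_measurable K ->
  (forall s w, 0 <= K s w)%R ->
  measurable_fun [set: Omega] (fun w => \int[lam]_(s in `[0%R, 1%R]) (K s w)%:E).
Proof.
move=> mK K0.
pose f := (fun p : measurableTypeR R * Omega => (K p.1 p.2)%:E) \_ slab.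
have mf : measurable_fun setT f.
  by apply/(measurable_restrictT _ mslab)/measurable_EFinP.
have f0 p : 0 <= f p by rewrite /f patchE; case: ifP => // _; rewrite lee_fin.
apply: eq_measurable_fun (measurable_fun_fubini_tonelli_G (m1 := lam) _ mf f0).
move=> w _; rewrite /fubini_G [RHS]integral_mkcond; apply: eq_integral => s _.
rewrite /f !patchE; congr (if _ then _ else _).
Qed.

Definition time_integral (K : R -> Omega -> R) : \bar R :=
  \int[P]_w \int[lam]_(s in `[0%R, 1%R]) (K s w)%:E.

Lemma jointly_measurableD K1 K2 : jointly_measurable K1 -> jointly_measurable K2 ->
  jointly_measurable (fun s w => K1 s w + K2 s w)%R.
Proof. by move=> m1 m2; exact: measurable_funD. Qed.

Lemma jointly_measurableB K1 K2 : jointly_measurable K1 -> jointly_measurable K2 ->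
  jointly_measurable (fun s w => K1 s w - K2 s w)%R.
Proof. by move=> m1 m2; exact: measurable_funB. Qed.

Lemma jointly_measurableX K n : jointly_measurable K ->
  jointly_measurable (fun s w => K s w ^+ n)%R.
Proof. by move=> m1; exact: measurable_funX. Qed.

Lemma le_time_integral K1 K2 : jointly_measurable K1 -> jointly_measurable K2 ->
  (forall s w, 0 <= K1 s w)%R -> (forall s w, K1 s w <= K2 s w)%R ->
  time_integral K1 <= time_integral K2.
Proof.
move=> m1 m2 K0 K12; have K20 s w : (0 <= K2 s w)%R := le_trans (K0 s w) (K12 s w).
apply: ge0_le_integral => //.
- by move=> w _; apply: integral_ge0 => s _; rewrite lee_fin.
- exact: measurable_time_integral.
- exact: measurable_time_integral.
move=> w _; apply: ge0_le_integral => //.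
- by move=> s _; rewrite lee_fin.
- by apply/measurable_EFinP; exact: jointly_measurable_section.
- by apply/measurable_EFinP; exact: jointly_measurable_section.
- by move=> s _; rewrite lee_fin.
Qed.

Lemma time_integralD K1 K2 : jointly_measurable K1 -> jointly_measurable K2 ->
  (forall s w, 0 <= K1 s w)%R -> (forall s w, 0 <= K2 s w)%R ->
  time_integral (fun s w => K1 s w + K2 s w)%R =
  time_integral K1 + time_integral K2.
Proof.
move=> m1 m2 K10 K20; rewrite /time_integral -ge0_integralD//; last 4 first.
- by move=> w _; apply: integral_ge0 => s _; rewrite lee_fin.
- exact: measurable_time_integral.
- by move=> w _; apply: integral_ge0 => s _; rewrite lee_fin.
- exact: measurable_time_integral.
apply: eq_integral => w _; rewrite -ge0_integralD//.
- by move=> s _; rewrite lee_fin.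
- by apply/measurable_EFinP; exact: jointly_measurable_section.
- by move=> s _; rewrite lee_fin.
- by apply/measurable_EFinP; exact: jointly_measurable_section.
Qed.

(** This is (u - v)^2 <= 2 u^2 + 2 v^2, with the factor 2 written as a repeated summand so that
    limits at 0 follow from [cvge0D] alone. *)
Lemma time_integral_quadratic_triangle K1 K2 K3 :
  jointly_measurable K1 -> jointly_measurable K2 -> jointly_measurable K3 ->
  time_integral (fun s w => (K1 s w - K2 s w) ^+ 2)%R <=
  (time_integral (fun s w => (K1 s w - K3 s w) ^+ 2)%R +
   time_integral (fun s w => (K1 s w - K3 s w) ^+ 2)%R) +
  (time_integral (fun s w => (K2 s w - K3 s w) ^+ 2)%R +
   time_integral (fun s w => (K2 s w - K3 s w) ^+ 2)%R).
Proof.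
move=> m1 m2 m3.
have m13 := jointly_measurableX 2 (jointly_measurableB m1 m3).
have m23 := jointly_measurableX 2 (jointly_measurableB m2 m3).
have q0 (K : R -> Omega -> R) s w : (0 <= K s w ^+ 2)%R by exact: sqr_ge0.
rewrite -!time_integralD//; try by [exact: jointly_measurableD | move=> s w; rewrite addr_ge0 ?sqr_ge0 | move=> s w; exact: sqr_ge0].
apply: le_time_integral.
- by apply: jointly_measurableX; exact: jointly_measurableB.
- by apply: jointly_measurableD; exact: jointly_measurableD.
- by move=> s w; exact: sqr_ge0.
- by move=> s w; have := sqr_ge0 (K1 s w - K3 s w + (K2 s w - K3 s w)); nra.
Qed.

(** Dominated convergence in time for almost every [w], then in [w]. Convergence is asked only on
    []0, 1]]: grid step functions vanish at time 0, which is a null set. *)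
Lemma time_integral_cvg0 (K : nat -> R -> Omega -> R) (M : R) :
  (forall n, jointly_measurable (K n)) ->
  (forall n s w, (0 <= K n s w <= M)%R) ->
  {ae P, forall w, forall s, (0 < s <= 1)%R -> K n s w @[n --> \oo] --> (0%R : R)} ->
  time_integral (K n) @[n --> \oo] --> 0.
Proof.
move=> mK KM Kcvg.
have K0 n s w : (0 <= K n s w)%R by case/andP: (KM n s w).
have mI n := measurable_time_integral (mK n) (K0 n).
have lam01 : lam `[0%R, 1%R]%classic = 1%E.
  by rewrite lebesgue_measure_itv/= lte_fin ltr01 oppr0 adde0.
have IM n w : \int[lam]_(s in `[0%R, 1%R]) (K n s w)%:E <= M%:E.
  apply: (@le_trans _ _ (\int[lam]_(s in `[0%R, 1%R]) M%:E)).
    apply: ge0_le_integral => //.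
    - by move=> s _; rewrite lee_fin.
    - by apply/measurable_EFinP; exact: jointly_measurable_section.
    - by move=> s _; rewrite lee_fin; case/andP: (KM n s w).
  by rewrite integral_cst//= lam01 mule1.
have iM : lam.-integrable `]0%R, 1%R] (EFin \o cst M).
  apply: measurable_bounded_integrable => //.
    by rewrite [X in X < _]lebesgue_measure_itv/= lte_fin ltr01 oppr0 adde0 ltry.
  by exists `|M|%R; split; [exact: num_real|move=> x Mx w _ /=; exact: ltW].
have := @dominated_convergence _ _ _ P setT measurableT
  (fun n w => \int[lam]_(s in `[0%R, 1%R]) (K n s w)%:E) (cst 0) (cst M%:E) mI
  (measurable_cst _).
case.
- apply: filterS Kcvg => w Kw _ /=.
  rewrite (_ : (fun n => _) = (fun n => \int[lam]_(s in `]0%R, 1%R]) (K n s w)%:E)); last first.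
    apply/funext => n; rewrite -integral_itv_obnd_cbnd//.
    apply/measurable_EFinP; apply: measurable_funS (jointly_measurable_section w (mK n)) => //.
    by move=> s /=; rewrite !in_itv/= => /andP[/ltW -> ->].
  rewrite -[X in _ --> X](integral0 lam `]0%R, 1%R]%classic).
  have mKw n : measurable_fun (`]0%R, 1%R]%classic : set (measurableTypeR R)) (fun s => (K n s w)%:E).
    apply/measurable_EFinP; apply: measurable_funS (jointly_measurable_section w (mK n)) => //.
    by move=> s /=; rewrite !in_itv/= => /andP[/ltW -> ->].
  apply: (@dominated_cvg _ _ _ lam `]0%R, 1%R]%classic _ _ (cst 0) (cst M%:E)) => //.
  + by move=> s /=; rewrite in_itv/= => s01; apply: cvg_EFin; [exact: nearW|exact: Kw].
  + move=> n s _; rewrite /= lee_fin ger0_norm//.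
    by case/andP: (KM n s w).
- exact: finite_measure_integrable_cst.
- apply: aeW => w n _; rewrite gee0_abs//.
  by apply: integral_ge0 => s _; rewrite lee_fin.
- move=> _ _ /=; rewrite integral0.
  by apply.
Qed.

End time_integral.

Lemma cvge0D (R : realType) (f g : nat -> \bar R) :
  f n @[n --> \oo] --> 0%E -> g n @[n --> \oo] --> 0%E ->
  (f n + g n)%E @[n --> \oo] --> 0%E.
Proof. by move=> f0 g0; rewrite -[X in _ --> X]adde0; apply: cvgeD. Qed.

(** * The uniform grid, and Ito integrals as limits of grid sums *)

Section grid.
Context {R : realType}.
Local Notation lam := (@lebesgue_measure R).

Definition grid (n i : nat) : R := i%:R / n.+1%:R.

Definition grid_step (n : nat) (u : nat -> R) (s : R) : R :=
  \sum_(i < n.+1) u i * \1_(`]grid n i, grid n i.+1]) s.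

Lemma grid0 n : grid n 0 = 0. Proof. by rewrite /grid mul0r. Qed.

Lemma gridn n : grid n n.+1 = 1. Proof. by rewrite /grid divff// pnatr_eq0. Qed.

Lemma grid_lt n i : grid n i < grid n i.+1.
Proof. by rewrite /grid ltr_pM2r ?invr_gt0 ?ltr0n// ltr_nat. Qed.

Lemma grid_le n i j : (i <= j)%N -> grid n i <= grid n j.
Proof. by move=> ij; rewrite /grid ler_pM2r ?invr_gt0 ?ltr0n// ler_nat. Qed.

Lemma grid_ge0 n i : 0 <= grid n i. Proof. by rewrite /grid divr_ge0. Qed.

Lemma grid_le1 n i : (i <= n.+1)%N -> grid n i <= 1.
Proof. by move=> /(grid_le n); rewrite gridn. Qed.

Lemma gridB n i : grid n i.+1 - grid n i = n.+1%:R^-1.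
Proof. by rewrite /grid -mulrBl -natrB// subSnn mul1r. Qed.

Lemma grid_cell (n : nat) (s : R) : 0 < s -> s <= 1 ->
  exists i : nat, [/\ (i < n.+1)%N, grid n i < s <= grid n i.+1 &
    forall u, grid_step n u s = u i].
Proof.
move=> s0 s1; have ex : exists i, s <= grid n i.+1 by exists n; rewrite gridn.
case: (ex_minnP ex) => i si imin.
have lin : (i < n.+1)%N by rewrite ltnS; apply: imin; rewrite gridn.
have is_ : grid n i < s.
  clear lin.
  case: i si imin => [|j] _ jmin; first by rewrite grid0.
  rewrite ltNge; apply/negP => sj; have := jmin _ sj; lia.
exists i; split=> //; first by rewrite is_.
move=> u; rewrite /grid_step (bigD1 (Ordinal lin))//= big1 ?addr0.
  by rewrite indicE mem_set ?mulr1//= in_itv/= is_.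
move=> j ji; rewrite indicE memNset ?mulr0//= in_itv/= => /andP[js sj].
have [jli|ilj] := ltnP j i.
  by move: (le_lt_trans (le_trans sj (grid_le n jli)) is_); rewrite ltxx.
have ij : (i < j)%N by rewrite ltn_neqAle ilj andbT eq_sym; exact: ji.
by move: (lt_le_trans js (le_trans si (grid_le n ij))); rewrite ltxx.
Qed.

Lemma grid_step_outside n u s : ~~ (0 < s <= 1) -> grid_step n u s = 0.
Proof.
move=> s01; rewrite /grid_step big1// => i _.
rewrite indicE memNset ?mulr0//= in_itv/= => /andP[is_ si]; move/negP: s01; apply.
by rewrite (le_lt_trans (grid_ge0 n i))// (le_trans si)// grid_le1.
Qed.

Lemma grid_step_bounded n u M s : 0 <= M ->
  (forall i, (i < n.+1)%N -> `|u i| <= M) -> `|grid_step n u s| <= M.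
Proof.
move=> M0 uM; have [/andP[s0 s1]|s01] := boolP (0 < s <= 1).
  by have [i [lin _ ->]] := grid_cell n s0 s1; exact: uM.
by rewrite grid_step_outside// normr0.
Qed.

Lemma measurable_grid_step n u : measurable_fun setT (grid_step n u).
Proof.
apply: measurable_sum => i; exact: measurable_funM.
Qed.

End grid.

Section ito_approximation.
Context {R : realType} {d : measure_display} {Omega : measurableType d}.
Variables (P : probability Omega R) (F : R -> set (set Omega)).
Variable W : R -> Omega -> R.
Hypotheses (F_usual : usual_filtration P F) (W_brownian : brownian_motion P F W).
Local Open Scope ereal_scope.

Lemma sp_time_itv (S : @simple_process R d Omega) i : simple_process_wf F S ->
  (i <= sp_size S)%N -> (0 <= sp_time S i <= 1)%R.
Proof.
move=> wf iS; apply/andP; split.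
  elim: i iS => [_|i ih iS]; first exact: sp_time_ge0 wf.
  exact: le_trans (ih (ltnW iS)) (sp_time_nondecreasing wf iS).
apply: le_trans (sp_time_le1 wf).
suff H k : (i + k <= sp_size S)%N -> (sp_time S i <= sp_time S (i + k))%R.
  by have := H (sp_size S - i)%N; rewrite subnKC//; apply.
elim: k => [|k ih]; rewrite ?addn0// addnS => kS.
exact: le_trans (ih (ltnW kS)) (sp_time_nondecreasing wf kS).
Qed.

Lemma jointly_measurable_simple (S : @simple_process R d Omega) :
  simple_process_wf F S -> jointly_measurable (simple_value S).
Proof.
move=> wf; apply: measurable_funTS; apply: measurable_sum => i.
have iS := ltn_ord i.
apply: measurable_funM.
  apply: measurableT_comp measurable_snd.
  apply: (measurable_filtration F_usual (sp_time_itv wf (ltnW iS))).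
  apply/(measurable_wrtP F_usual _ (sp_time_itv wf (ltnW iS))).
  by move=> B mB; exact: (sp_coef_measurable wf iS).
have mi : measurable_fun [set: measurableTypeR R]
    (\1_(`]sp_time S i, sp_time S i.+1]%classic) : measurableTypeR R -> R).
  exact: measurable_indic.
exact: measurableT_comp mi measurable_fst.
Qed.

Definition grid_integral (n : nat) (u : nat -> Omega -> R) (w : Omega) : R :=
  (\sum_(i < n.+1) u i w * (W (grid n i.+1) w - W (grid n i) w))%R.

Definition grid_adapted (n : nat) (u : nat -> Omega -> R) : Prop :=
  forall i, (i < n.+1)%N -> measurable_fun [set: g_sigma_algebraType (F (grid n i))] (u i).

Lemma jointly_measurable_grid n u : grid_adapted n u ->
  jointly_measurable (fun s w => grid_step n (u ^~ w) s).
Proof.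
move=> mu; apply: measurable_funTS; apply: measurable_sum => i.
have iS := ltn_ord i.
have i01 : (0 <= (grid n i : R) <= 1)%R by rewrite grid_ge0 grid_le1// ltnW.
apply: measurable_funM.
  apply: measurableT_comp measurable_snd.
  exact: (measurable_filtration F_usual i01 (mu _ iS)).
have mi : measurable_fun [set: measurableTypeR R]
    (\1_(`]grid n i, grid n i.+1]%classic) : measurableTypeR R -> R).
  exact: measurable_indic.
exact: measurableT_comp mi measurable_fst.
Qed.

Lemma measurable_grid_integral n u : grid_adapted n u ->
  measurable_fun setT (grid_integral n u).
Proof.
move=> mu; apply: measurable_sum => i; have iS := ltn_ord i.
have i01 : (0 <= (grid n i : R) <= 1)%R by rewrite grid_ge0 grid_le1// ltnW.
apply: measurable_funM; first exact: (measurable_filtration F_usual i01 (mu _ iS)).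
apply: (brownian_increment_measurable F_usual W_brownian) => //.
by rewrite grid_ge0 grid_le1.
Qed.

Lemma measurable_simple_integral (S : @simple_process R d Omega) :
  simple_process_wf F S -> measurable_fun setT (simple_integral W S).
Proof.
move=> wf; apply: measurable_sum => i; have iS := ltn_ord i.
have i01 := sp_time_itv wf (ltnW iS); have i01' := sp_time_itv wf iS.
apply: measurable_funM; last exact: (brownian_increment_measurable F_usual W_brownian).
apply: (measurable_filtration F_usual i01).
by apply/(measurable_wrtP F_usual _ i01); move=> B mB; exact: (sp_coef_measurable wf iS).
Qed.

(** The difference of the two integrals is one elementary integral, indexed by the disjoint union of
    both index sets, with the coefficients of [S] negated. *)
Lemma grid_simple_isometry n (u : nat -> Omega -> R) (M : R)
    (S : @simple_process R d Omega) :
  grid_adapted n u -> (forall i w, (i < n.+1)%N -> `|u i w| <= M)%R ->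
  simple_process_wf F S ->
  \int[P]_w ((grid_integral n u w - simple_integral W S w) ^+ 2)%:E =
  (fine (@normal_variance1 R))%:E * time_integral P
    (fun s w => (grid_step n (u ^~ w) s - simple_value S s w) ^+ 2)%R.
Proof.
move=> mu uM wf; pose I : finType := ('I_n.+1 + 'I_(sp_size S))%type.
pose a (x : I) : R := match x with inl i => grid n i | inr j => sp_time S j end.
pose b (x : I) : R := match x with inl i => grid n i.+1 | inr j => sp_time S j.+1 end.
pose c (x : I) (w : Omega) : R :=
  match x with inl i => u i w | inr j => (- sp_coef S j w)%R end.
have /boolp.choice[B cB] : forall x : I, exists B : R, forall w, (`|c x w| <= B)%R.
  case=> [i|j]; first by exists M => w; exact: uM.
  have [B SB] := sp_coef_bounded wf (ltn_ord j).
  by exists B => w; rewrite /c normrN.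
have a0 x : (0 <= a x)%R.
  by case: x => [i|j]; [exact: grid_ge0|by case/andP: (sp_time_itv wf (ltnW (ltn_ord j)))].
have ab x : (a x <= b x)%R.
  by case: x => [i|j]; [exact/ltW/grid_lt|exact: (sp_time_nondecreasing wf (ltn_ord j))].
have b1 x : (b x <= 1)%R.
  by case: x => [i|j]; [exact: grid_le1|by case/andP: (sp_time_itv wf (ltn_ord j))].
have mc x : measurable_fun [set: g_sigma_algebraType (F (a x))] (c x).
  case: x => [i|j]; first exact: mu.
  apply: measurable_funN; apply/(measurable_wrtP F_usual).
    exact: sp_time_itv wf (ltnW (ltn_ord j)).
  by move=> D mD; exact: (sp_coef_measurable wf (ltn_ord j)).
have := elementary_isometry F_usual W_brownian a0 ab b1 mc cB.
under eq_integral => w _.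
  rewrite big_sumType/= (_ : (_ + _)%R = grid_integral n u w - simple_integral W S w)%R; last first.
    by congr (_ + _)%R; rewrite /simple_integral -sumrN; apply: eq_bigr => i _; rewrite mulNr.
  over.
move=> ->; congr (_ * _); apply: eq_integral => w _; apply: eq_integral => s _.
rewrite big_sumType/=; congr ((_ + _) ^+ 2)%:E.
by rewrite /simple_value -sumrN; apply: eq_bigr => i _; rewrite mulNr.
Qed.

Let quadratic_triangle (f g h : Omega -> R) :
  measurable_fun setT f -> measurable_fun setT g -> measurable_fun setT h ->
  \int[P]_w ((f w - g w) ^+ 2)%:E <=
  (\int[P]_w ((f w - h w) ^+ 2)%:E + \int[P]_w ((f w - h w) ^+ 2)%:E) +
  (\int[P]_w ((h w - g w) ^+ 2)%:E + \int[P]_w ((h w - g w) ^+ 2)%:E).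
Proof.
move=> mf mg mh.
have m (a b : Omega -> R) : measurable_fun setT a -> measurable_fun setT b ->
    measurable_fun setT (fun w => ((a w - b w) ^+ 2)%:E).
  by move=> ma mb; apply/measurable_EFinP/measurable_funX/measurable_funB.
have p (a b : Omega -> R) w : 0 <= ((a w - b w) ^+ 2)%:E by rewrite lee_fin sqr_ge0.
rewrite -!ge0_integralD//; try by [exact: m|apply: emeasurable_funD; exact: m|move=> w _; rewrite adde_ge0].
apply: ge0_le_integral => //.
- exact: m.
- by apply: emeasurable_funD; apply: emeasurable_funD; exact: m.
- move=> w _; rewrite -!EFinD lee_fin.
  by have := sqr_ge0 (f w - h w - (h w - g w)); nra.
Qed.

(** The simple processes provided by the definition of the Ito integral are arbitrary. They and the
    grid processes both converge to [H] in L^2(ds x P), the latter by bounded convergence, so the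
    isometry makes their integrals asymptotically equal. *)
Lemma grid_integral_cvg (u : nat -> nat -> Omega -> R) (H : R -> Omega -> R)
    (I : Omega -> R) (M : R) :
  is_ito_integral P F W H I ->
  (forall n, grid_adapted n (u n)) ->
  (forall n i w, (i < n.+1)%N -> `|u n i w| <= M)%R ->
  (forall s w, `|H s w| <= M)%R ->
  {ae P, forall w, forall s, (0 < s <= 1)%R ->
    grid_step n (u n ^~ w) s @[n --> \oo] --> H s w} ->
  \int[P]_w ((grid_integral n (u n) w - I w) ^+ 2)%:E @[n --> \oo] --> 0.
Proof.
move=> [[mH _ _] mI [S [wf SH SI]]] mu uM HM uH.
set v := fine (@normal_variance1 R).
have v0 : (0 <= v)%R.
  by apply: fine_ge0; apply: integral_ge0 => x _; rewrite lee_fin sqr_ge0.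
have jH : jointly_measurable H by [].
have jS n := jointly_measurable_simple (wf n).
have jD n := jointly_measurable_grid (mu n).
have M0 : (0 <= M)%R := le_trans (normr_ge0 _) (HM 0%R point).
have DH : time_integral P (fun s w => (grid_step n (u n ^~ w) s - H s w) ^+ 2)%R
    @[n --> \oo] --> 0.
  apply: (@time_integral_cvg0 _ _ _ P _ ((M + M) ^+ 2)%R).
  - by move=> n; apply: jointly_measurableX; exact: jointly_measurableB.
  - move=> n s w; rewrite sqr_ge0/= -[leLHS]real_normK ?num_real// lerXn2r ?nnegrE ?addr_ge0//.
    rewrite (le_trans (ler_normB _ _))// lerD//.
    by apply: grid_step_bounded => // i; exact: uM.
  - apply: filterS uH => w uHw s s01.
    have h : (grid_step n (u n ^~ w) s - H s w)%R @[n --> \oo] --> (0%R : R).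
      rewrite -[X in _ --> X](subrr (H s w)).
      by apply: cvgB; [exact: uHw|exact: cvg_cst].
    by rewrite -[X in _ --> X](mulr0 0%R); exact: (cvgM h h).
pose A n := time_integral P (fun s w => (grid_step n (u n ^~ w) s - H s w) ^+ 2)%R.
pose B n := time_integral P (fun s w => (simple_value (S n) s w - H s w) ^+ 2)%R.
pose C n := \int[P]_w ((simple_integral W (S n) w - I w) ^+ 2)%:E.
pose E n := v%:E * ((A n + A n) + (B n + B n)).
have C0 : C n @[n --> \oo] --> 0 by exact: SI.
have E0 : E n @[n --> \oo] --> 0.
  rewrite -[X in _ --> X](mule0 v%:E); apply: cvgeZl => //.
  exact: (cvge0D (cvge0D DH DH) (cvge0D SH SH)).
apply: (@squeeze_cvge _ _ _ _ (cst 0) _ (fun n => (E n + E n) + (C n + C n))).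
- apply: nearW => n /=; apply/andP; split.
    by apply: integral_ge0 => w _; rewrite lee_fin sqr_ge0.
  have := quadratic_triangle (measurable_grid_integral (mu n)) mI (measurable_simple_integral (wf n)).
  move/le_trans; apply; apply: leeD => //.
  rewrite (grid_simple_isometry (mu n) (uM n) (wf n)) -/v.
  have := time_integral_quadratic_triangle P (jD n) (jS n) jH.
  rewrite -/(A n) -/(B n) => le.
  by apply: leeD; rewrite /E lee_wpmul2l ?lee_fin.
- exact: cvg_cst.
- exact: (cvge0D (cvge0D E0 E0) (cvge0D C0 C0)).
Qed.

End ito_approximation.

(** * Continuous functions on the unit interval and Riemann sums *)

Section continuity_on_01.
Context {R : realType}.
Local Notation lam := (@lebesgue_measure R).

(** Continuity is stated through sequences because, for the drift, it comes out of dominated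
    convergence. *)
Definition seq_continuous01 (f : R -> R) : Prop :=
  forall (s_ : nat -> R) (s : R), (forall n, 0 <= s_ n <= 1) -> 0 <= s <= 1 ->
    s_ n @[n --> \oo] --> s -> f (s_ n) @[n --> \oo] --> f s.

Lemma within_seq_continuous01 (f : R -> R) :
  {within `[0, 1], continuous f} -> seq_continuous01 f.
Proof.
move=> fc s_ s s01n s01 ss.
have /subspace_continuousP/(_ s) := fc; rewrite /= in_itv => /(_ s01) fcs.
apply: cvg_comp fcs => U /=; rewrite /within/= => nU.
have [N _ HN] := ss _ nU; exists N => // n Nn; apply: (HN n Nn).
by rewrite in_itv/=.
Qed.

(** Otherwise there are pairs at distance at most 1/(n+1) whose images stay more than [e] apart; by
    Bolzano-Weierstrass a subsequence of both coordinates tends to one point, contradicting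
    continuity there. *)
Lemma uniform_continuous01 (f : R -> R) : seq_continuous01 f ->
  forall e : R, 0 < e -> exists2 dl : R, 0 < dl &
    forall s t, 0 <= s <= 1 -> 0 <= t <= 1 -> `|s - t| <= dl -> `|f s - f t| <= e.
Proof.
move=> fc e e0; apply: contrapT => /forall2NP H.
have ex n : exists p : R * R, [/\ 0 <= p.1 <= 1, 0 <= p.2 <= 1,
    `|p.1 - p.2| <= n.+1%:R^-1 & e < `|f p.1 - f p.2| ].
  have [/negP|] := H (n.+1%:R^-1); first by rewrite invr_gt0 ltr0n.
  move=> /existsNP[s /existsNP[t]].
  move=> /not_implyP[s01 /not_implyP[t01 /not_implyP[st /negP]]].
  by rewrite -ltNge => fst; exists (s, t).
have [p pP] := boolp.choice ex.
have bnd : bounded_fun (fun n => (p n).1).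
  exists 1; split; first exact: num_real.
  move=> x x1 n _ /=; have [/andP[p0 p1] _ _ _] := pP n.
  by rewrite ger0_norm// (le_trans p1)// ltW.
have [g gi /cvg_ex[/= s gs]] := bolzano_weierstrass bnd.
have ng n : (n <= g n)%N.
  by elim: n => [//|n ih]; rewrite (leq_ltn_trans ih)// (leqW_mono gi).
have pg01 n : 0 <= (p (g n)).1 <= 1 by have [] := pP (g n).
have s01 : 0 <= s <= 1.
  apply/andP; split.
    by apply: (@cvgr_to_ge _ _ _ _ _ _ _ gs); apply: nearW => n; case/andP: (pg01 n).
  by apply: (@cvgr_to_le _ _ _ _ _ _ _ gs); apply: nearW => n; case/andP: (pg01 n).
have gh : n.+1%:R^-1 @[n --> \oo] --> (0 : R) by exact: cvg_harmonic.
have gsub : (p (g n)).1 - (p (g n)).2 @[n --> \oo] --> (0 : R).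
  apply/cvgrPdist_le => dl dl0; move/cvgrPdist_le : gh => /(_ _ dl0).
  apply: filterS => n; rewrite !sub0r !normrN => h.
  have [_ _ le _] := pP (g n); rewrite (le_trans le)// (le_trans _ h)//.
  rewrite ger0_norm ?invr_ge0// lef_pV2 ?posrE ?ltr0n// ler_nat ltnS.
  exact: ng.
have gs2 : (p (g n)).2 @[n --> \oo] --> s.
  rewrite -[X in _ --> X]subr0.
  rewrite (_ : (fun n => _) = (fun n => (p (g n)).1 - ((p (g n)).1 - (p (g n)).2))).
    exact: cvgB.
  by apply/funext => n; rewrite opprB addrC subrK.
have : f (p (g n)).1 - f (p (g n)).2 @[n --> \oo] --> (0 : R).
  rewrite -[X in _ --> X](subrr (f s)); apply: cvgB; apply: fc => //.
  by move=> n; have [] := pP (g n).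
move/cvgrPdist_lt => /(_ _ e0) [n0 _ /(_ n0 (leqnn _))].
have [_ _ _ lt] := pP (g n0); rewrite sub0r normrN => /(lt_trans lt).
by rewrite ltxx.
Qed.

Lemma grid_cell_cvg (s : R) (j : nat -> nat) :
  (forall n, grid n (j n) < s <= grid n (j n).+1) ->
  grid n (j n) @[n --> \oo] --> s.
Proof.
move=> js; apply: (@squeeze_cvgr _ _ _ _ (fun n => s - n.+1%:R^-1) (cst s)).
- apply: nearW => n; have /andP[h1 h2] := js n; rewrite (ltW h1) andbT.
  by rewrite -(gridB n (j n)); lra.
- rewrite -[X in _ --> X]subr0; apply: cvgB; first exact: cvg_cst.
  exact: cvg_harmonic.
- exact: cvg_cst.
Qed.

(* The steps need only be uniformly close to the values of [f] at the grid
   points. *)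
Lemma grid_step_cvg (f : R -> R) (u : nat -> nat -> R) (s : R) :
  seq_continuous01 f -> 0 < s <= 1 ->
  (forall e : R, 0 < e -> \forall n \near \oo, forall i, (i < n.+1)%N ->
     `|f (grid n i) - u n i| <= e) ->
  grid_step n (u n) s @[n --> \oo] --> f s.
Proof.
move=> fc /andP[s0 s1] fu.
have ex n : exists i, [/\ (i < n.+1)%N, grid n i < s <= grid n i.+1 &
    grid_step n (u n) s = u n i].
  by have [i [? ? ?]] := grid_cell n s0 s1; exists i.
have [j jP] := boolp.choice ex.
have jc : f (grid n (j n)) @[n --> \oo] --> f s.
  apply: fc; [|by rewrite ltW|].
    by move=> n; have [jn _ _] := jP n; rewrite grid_ge0 grid_le1// ltnW.
  by apply: grid_cell_cvg => n; have [] := jP n.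
rewrite -[X in _ --> X]subr0.
rewrite (_ : (fun n => _) = (fun n => f (grid n (j n)) - (f (grid n (j n)) - u n (j n)))); last first.
  by apply/funext => n; rewrite opprB addrC subrK; have [] := jP n.
apply: cvgB => //; apply/cvgrPdist_le => e e0.
apply: filterS (fu _ e0) => n h; rewrite sub0r normrN; apply: h.
by have [] := jP n.
Qed.

Lemma grid_values_cvg (f : R -> R) (s : R) :
  seq_continuous01 f -> 0 < s <= 1 ->
  grid_step n (fun i => f (grid n i)) s @[n --> \oo] --> f s.
Proof.
move=> fc s01; apply: (@grid_step_cvg f (fun n i => f (grid n i))) => // e e0.
by apply: nearW => n i _; rewrite subrr normr0 ltW.
Qed.

Lemma seq_continuous01_measurable (f : R -> R) : seq_continuous01 f ->
  measurable_fun (`[0, 1]%classic : set R) f.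
Proof.
move=> fc; apply/measurable_fun_itv_obnd_cbndP.
apply: (@measurable_fun_cvg _ _ _ _ (fun n => grid_step n (fun i => f (grid n i)))).
  by move=> n; apply: measurable_funTS; exact: measurable_grid_step.
by move=> s /=; rewrite in_itv/= => s01; exact: grid_values_cvg.
Qed.

Lemma bounded_integrable01 (D : set R) (f : R -> R) (M : R) :
  measurable D -> D `<=` `[0, 1] -> measurable_fun D f -> (forall s, `|f s| <= M) ->
  lam.-integrable D (EFin \o f).
Proof.
move=> mD D01 mf fM; apply: measurable_bounded_integrable => //.
- apply: (@le_lt_trans _ _ (lam `[0, 1]%classic)).
    by apply: le_measure; rewrite ?inE.
  by rewrite [X in (X < _)%E]lebesgue_measure_itv/= lte_fin ltr01 -EFinD ltry.
- by exists M; split; [exact: num_real|move=> x Mx s _; rewrite /= (le_trans (fM s))// ltW].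
Qed.

Lemma Rintegral_sum (D : set R) (I : Type) (r : seq I) (f : I -> R -> R) :
  measurable D -> (forall i, lam.-integrable D (EFin \o f i)) ->
  \int[lam]_(s in D) (\sum_(i <- r) f i s) = \sum_(i <- r) \int[lam]_(s in D) f i s.
Proof.
move=> mD fi; elim: r => [|i r ih].
  under eq_Rintegral do rewrite big_nil.
  by rewrite big_nil Rintegral_cst// mul0r.
under eq_Rintegral do rewrite big_cons.
rewrite big_cons -ih RintegralD//.
rewrite (_ : EFin \o _ = (fun s => \sum_(j <- r) (f j s)%:E)%E).
  by apply: integrable_sum => // j _; exact: fi.
by apply/funext => s; rewrite /= sumEFin.
Qed.

Lemma Rintegral_grid_step n (u : nat -> R) (g : R -> R) (M : R) :
  measurable_fun (`[0, 1]%classic : set R) g -> (forall s, `|g s| <= M) ->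
  \int[lam]_(s in `[0, 1]) (grid_step n u s * g s) =
  \sum_(i < n.+1) u i * \int[lam]_(s in `]grid n i, grid n i.+1]) g s.
Proof.
move=> mg gM; pose C (i : 'I_n.+1) : set R := `]grid n i, grid n i.+1]%classic.
have C01 i : C i `<=` `[0, 1].
  move=> s; rewrite /C/= !in_itv/= => /andP[is_ si].
  apply/andP; split; first exact: le_trans (grid_ge0 n i) (ltW is_).
  exact: le_trans si (grid_le1 (ltn_ord i)).
have iC i : lam.-integrable (C i) (EFin \o g).
  apply: (@bounded_integrable01 _ _ M).
  - exact: measurable_itv.
  - exact: C01.
  - exact: (measurable_funS (measurable_itv _) (@C01 i) mg).
  - exact: gM.
have iC01 i : lam.-integrable `[0, 1] (EFin \o (g \_ (C i))).
  rewrite -restrict_EFin; apply/integrable_restrict; [exact: measurable_itv..|].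
  by rewrite setIC setIidl//; exact: C01.
transitivity (\int[lam]_(s in `[0, 1]) \sum_(i < n.+1) u i * (g \_ (C i)) s).
  apply: eq_Rintegral => s _; rewrite /grid_step mulr_suml; apply: eq_bigr => i _.
  rewrite -mulrA patchE indicE; congr (_ * _).
  by case: ifP => _; rewrite ?mul1r ?mul0r.
rewrite Rintegral_sum//; last first.
  have mI : measurable (`[0, 1]%classic : set (measurableTypeR R)) by exact: measurable_itv.
  by move=> i; exact: (integrableZl mI (u i) (iC01 i)).
apply: eq_bigr => i _; rewrite RintegralZl//; congr (_ * _).
by rewrite -Rintegral_mkcondr setIC setIidl//; exact: C01.
Qed.

(** The weights are integrals of [g] over the cells because the drift part of an increment of the
    solution has this form. The sum is the integral of a grid step function times [g], and dominated
    convergence applies. *)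
Lemma grid_riemann_cvg (u : nat -> nat -> R) (h g : R -> R) (M M' : R) :
  measurable_fun (`[0, 1]%classic : set R) g -> (forall s, `|g s| <= M) ->
  (forall n i, (i < n.+1)%N -> `|u n i| <= M') -> 0 <= M' ->
  (forall s, 0 < s <= 1 -> grid_step n (u n) s @[n --> \oo] --> h s) ->
  \sum_(i < n.+1) u n i * \int[lam]_(s in `]grid n i, grid n i.+1]) g s
    @[n --> \oo] --> \int[lam]_(s in `[0, 1]) (h s * g s).
Proof.
move=> mg gM uM M'0 uh.
have M0 : 0 <= M := le_trans (normr_ge0 _) (gM 0).
have sub : `]0%R, 1%R] `<=` (`[0%R, 1%R] : set R).
  by move=> s /=; rewrite !in_itv/= => /andP[/ltW -> ->].
have mg' : measurable_fun (`]0, 1]%classic : set R) g by exact: measurable_funS mg.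
have mD n : measurable_fun (`]0, 1]%classic : set R) (fun s => grid_step n (u n) s * g s).
  by apply: measurable_funM => //; apply: measurable_funTS; exact: measurable_grid_step.
have DM n s : `|grid_step n (u n) s * g s| <= M' * M.
  by rewrite normrM ler_pM//; apply: grid_step_bounded => // i; exact: uM.
have Dh s : 0 < s <= 1 -> grid_step n (u n) s * g s @[n --> \oo] --> h s * g s.
  by move=> s01; apply: cvgM; [exact: uh|exact: cvg_cst].
have mh : measurable_fun (`]0, 1]%classic : set R) (fun s => h s * g s).
  apply: (@measurable_fun_cvg _ _ _ _ (fun n s => grid_step n (u n) s * g s)) => //.
have hM s : 0 < s <= 1 -> `|h s * g s| <= M' * M.
  by move=> s01; apply: (cvgr_to_le (cvg_norm (Dh _ s01))); exact: nearW.
have ih : lam.-integrable `]0, 1] (EFin \o (fun s => h s * g s)).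
  apply: measurable_bounded_integrable => //.
    by rewrite [X in (X < _)%E]lebesgue_measure_itv/= lte_fin ltr01 -EFinD ltry.
  exists (M' * M); split; first exact: num_real.
  by move=> x Mx s s01; rewrite /= (le_trans (hM s _) (ltW Mx))//; move: s01; rewrite /= in_itv.
have iD n : lam.-integrable `]0, 1] (EFin \o (fun s => grid_step n (u n) s * g s)).
  exact: bounded_integrable01 (DM n).
rewrite -Rintegral_itv_obnd_cbnd//.
under eq_fun do rewrite -(Rintegral_grid_step _ _ mg gM) -Rintegral_itv_obnd_cbnd//.
apply: fine_cvg; rewrite fineK; last exact: integrable_fin_num.
apply: (@dominated_cvg _ _ _ lam `]0%R, 1%R]%classic _ _ _ (cst (M' * M)%:E)) => //.
- have mDe n : measurable_fun (`]0, 1]%classic : set R)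
    (fun s => (grid_step n (u n) s * g s)%:E) by apply/measurable_EFinP; exact: mD.
  exact: mDe.
- move=> s sI; have s01 : 0 < s <= 1 by move: sI; rewrite /= in_itv.
  by apply: cvg_EFin; [exact: nearW|exact: Dh].
- have cM (s : R) : `|cst (M' * M) s| <= M' * M by rewrite ger0_norm// mulr_ge0.
  exact: bounded_integrable01 cM.
- by move=> n s _; rewrite lee_fin.
Qed.

End continuity_on_01.

(** * Pathwise convergence of the Euler scheme *)

Section euler_convergence.
Context {R : realType} {Omega : Type}.
Variables (W : R -> Omega -> R) (x0 : R) (w : Omega) (b : R -> R -> R) (x : R -> R).
Variables (L M : R).
Local Notation lam := (@lebesgue_measure R).
Local Notation f := (fun s => b s (x s)).
Hypotheses (L0 : 0 <= L)
  (b_lip : forall s y z, `|b s y - b s z| <= L * `|y - z|)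
  (b_bnd : forall s y, `|b s y| <= M)
  (f_cont : seq_continuous01 f)
  (x_start : x 0 = x0)
  (x_eq : forall t, 0 <= t <= 1 ->
    x t = x0 + (\int[lam]_(s in `[0, t]) f s) + W t w).

Local Notation X n i := (euler W x0 (grid n) (fun k => b (grid n k)) i w).

Lemma Rintegral_cell n i (g : R -> R) : (i < n.+1)%N ->
  measurable_fun (`[0, 1]%classic : set R) g -> (forall s, `|g s| <= M) ->
  (\int[lam]_(s in `[0, grid n i.+1]) g s) - \int[lam]_(s in `[0, grid n i]) g s =
  \int[lam]_(s in `]grid n i, grid n i.+1]) g s.
Proof.
move=> iN mg gM; rewrite (@Rintegral_itvB _ g (BLeft 0) (BRight (grid n i.+1)))//.
- have sub : `[0, grid n i.+1] `<=` (`[0, 1] : set R).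
    move=> s /=; rewrite !in_itv/= => /andP[-> si].
    exact: le_trans si (grid_le1 iN).
  apply: (bounded_integrable01 _ sub _ gM) => //.
  exact: (measurable_funS (measurable_itv _) sub mg).
- by rewrite bnd_simp grid_ge0.
- by rewrite bnd_simp ltW// grid_lt.
Qed.

(** The noise is additive and cancels in the difference. Over one cell there remain the drift
    evaluated at the wrong point, controlled by the Lipschitz constant, and the oscillation of the
    exact drift inside the cell, at most [dl]. *)
Lemma euler_increment n i (dl : R) : (i < n.+1)%N -> 0 <= dl ->
  (forall s, grid n i < s <= grid n i.+1 -> `|f s - f (grid n i)| <= dl) ->
  `|x (grid n i.+1) - X n i.+1| <=
  `|x (grid n i) - X n i| * (1 + L / n.+1%:R) + dl / n.+1%:R.
Proof.
move=> iN dl0 fdl.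
have mf := seq_continuous01_measurable f_cont.
have N0 : 0 < n.+1%:R^-1 :> R by rewrite invr_gt0 ltr0n.
have sub : `]grid n i, grid n i.+1] `<=` (`[0, 1] : set R).
  move=> s /=; rewrite !in_itv/= => /andP[is_ si].
  apply/andP; split; first exact: le_trans (grid_ge0 n i) (ltW is_).
  exact: le_trans si (grid_le1 iN).
have mcell : measurable (`]grid n i, grid n i.+1]%classic : set R) by exact: measurable_itv.
have ifc : lam.-integrable `]grid n i, grid n i.+1] (EFin \o f).
  apply: (bounded_integrable01 mcell sub (measurable_funS (measurable_itv _) sub mf)) => s.
  exact: b_bnd.
have icc (c : R) : lam.-integrable `]grid n i, grid n i.+1] (EFin \o cst c).
  by apply: (bounded_integrable01 mcell sub (M := `|c|)).
have lamcell : fine (lam `]grid n i, grid n i.+1]%classic) = n.+1%:R^-1.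
  by rewrite lebesgue_measure_itv/= lte_fin grid_lt -EFinD/= gridB.
have iB : lam.-integrable `]grid n i, grid n i.+1] (EFin \o (fun s => f s - f (grid n i))).
  apply: (bounded_integrable01 (M := M + M) mcell sub) => [|s].
    by apply: measurable_funB => //; exact: (measurable_funS (measurable_itv _) sub mf).
  by rewrite (le_trans (ler_normB _ _))// lerD.
have E : `|(\int[lam]_(s in `]grid n i, grid n i.+1]) f s) - f (grid n i) / n.+1%:R| <= dl / n.+1%:R.
  have -> : f (grid n i) / n.+1%:R = \int[lam]_(s in `]grid n i, grid n i.+1]) cst (f (grid n i)) s.
    by rewrite Rintegral_cst// lamcell.
  rewrite -RintegralB//.
  apply: le_trans (le_normr_Rintegral _ _) _ => //.
  have -> : dl / n.+1%:R = \int[lam]_(s in `]grid n i, grid n i.+1]) cst dl s.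
    by rewrite Rintegral_cst// lamcell.
  apply: le_Rintegral => //.
    exact: integrable_norm iB.
have i01 : 0 <= (grid n i : R) <= 1 by rewrite grid_ge0 grid_le1// ltnW.
have i01' : 0 <= (grid n i.+1 : R) <= 1 by rewrite grid_ge0 grid_le1.
have fM s : `|f s| <= M by exact: b_bnd.
have C := Rintegral_cell iN mf fM.
have D : `|f (grid n i) - b (grid n i) (X n i)| <= L * `|x (grid n i) - X n i| by exact: b_lip.
have -> : x (grid n i.+1) - X n i.+1 =
  (x (grid n i) - X n i) + (f (grid n i) - b (grid n i) (X n i)) / n.+1%:R +
  ((\int[lam]_(s in `]grid n i, grid n i.+1]) f s) - f (grid n i) / n.+1%:R).
  rewrite -C /= gridB (x_eq i01) (x_eq i01'); ring.
rewrite (le_trans (ler_normD _ _))// lerD// mulrDr mulr1.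
rewrite (le_trans (ler_normD _ _))// lerD// normrM [`|n.+1%:R^-1|]gtr0_norm// mulrA.
by rewrite ler_pM2r// [leRHS]mulrC.
Qed.

Lemma euler_cvg (e : R) : 0 < e -> \forall n \near \oo, forall i, (i <= n.+1)%N ->
  `|x (grid n i) - X n i| <= e.
Proof.
(* The accumulated error will be amplified by at most [expR L], which this choice compensates. *)
move=> e0; pose dl := e / expR L.
have dl0 : 0 < dl by rewrite divr_gt0// expR_gt0.
have [r r0 fr] := uniform_continuous01 f_cont dl0.
have h : n.+1%:R^-1 @[n --> \oo] --> (0 : R) by exact: cvg_harmonic.
move/cvgrPdist_le : h => /(_ _ r0); apply: filterS => n; rewrite sub0r normrN => nr.
have N0 : 0 < n.+1%:R^-1 :> R by rewrite invr_gt0 ltr0n.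
move: nr; rewrite gtr0_norm// => nr.
have a1 : 1 <= 1 + L / n.+1%:R by rewrite lerDl mulr_ge0// ltW.
(* Discrete Gronwall inequality: the local errors dl/(n+1) add up, each amplified by powers of 1 +
   L/(n+1). *)
have bound i : (i <= n.+1)%N ->
    `|x (grid n i) - X n i| <= (i%:R / n.+1%:R) * dl * (1 + L / n.+1%:R) ^+ i.
  elim: i => [_|i ih iN]; first by rewrite grid0 x_start subrr normr0 mul0r !mul0r.
  have inc := @euler_increment n i dl iN (ltW dl0).
  apply: le_trans (inc _) _.
    move=> s /andP[is_ si]; apply: fr.
    - rewrite (le_trans (grid_ge0 n i) (ltW is_))/=.
      exact: le_trans si (grid_le1 iN).
    - by rewrite grid_ge0 grid_le1// ltnW.
    - rewrite gtr0_norm ?subr_gt0//; apply: le_trans nr.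
      by rewrite -(gridB n i) lerB.
  have a1i : 1 <= (1 + L / n.+1%:R) ^+ i.+1 by exact: exprn_ege1.
  apply: (@le_trans _ _ (i%:R / n.+1%:R * dl * (1 + L / n.+1%:R) ^+ i.+1 +
      (dl / n.+1%:R) * (1 + L / n.+1%:R) ^+ i.+1)).
    apply: lerD; last by rewrite ler_peMr// divr_ge0// ltW.
    rewrite exprSr mulrA ler_wpM2r//; last exact: ih (ltnW iN).
    exact: le_trans a1.
  by rewrite -[i.+1%:R]natr1 le_eqVlt; apply/orP; left; apply/eqP; ring.
move=> i iN; apply: le_trans (bound i iN) _.
have iN1 : 0 <= (i%:R / n.+1%:R : R) <= 1 by rewrite -/(grid n i) grid_ge0 grid_le1.
have {iN1}[i0 i1] := andP iN1.
have ex : (1 + L / n.+1%:R) ^+ i <= expR L.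
  apply: (@le_trans _ _ (expR (L / n.+1%:R) ^+ i)).
    by rewrite lerXn2r ?nnegrE ?expR_ge0 ?expR_ge1Dx// (le_trans _ a1).
  rewrite -expRM_natl ler_expR mulrCA ler_piMr//.
apply: (@le_trans _ _ (1 * dl * expR L)).
  apply: ler_pM => //.
  - by rewrite mulr_ge0// ltW.
  - by rewrite exprn_ge0// (le_trans _ a1).
  - by rewrite ler_wpM2r// ltW.
by rewrite mul1r /dl divfK// gt_eqF// expR_gt0.
Qed.

End euler_convergence.

(** * Regularity of the mean-field drift *)

Lemma ge0_integral_mrestr d (T : measurableType d) (R : realType)
    (m : {measure set T -> \bar R}) (D : set T) (mD : measurable D)
    (f : T -> \bar R) :
  measurable_fun setT f -> (forall x, 0 <= f x)%E ->
  (\int[mrestr m mD]_x f x = \int[m]_(x in D) f x)%E.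
Proof.
move=> mf f0.
rewrite (@ge0_negligible_integral _ _ _ (mrestr m mD) setT (~` D))//; last 2 first.
- exact: measurableC.
- by rewrite /= /mrestr setICl measure0.
rewrite setTD setCK; apply: eq_measure_integral => A mA AD.
by rewrite /= /mrestr setIidl.
Qed.

Lemma Rintegral_cst_probability d (T : measurableType d) (R : realType)
    (m : probability T R) (c : R) : \int[m]_x cst c x = c.
Proof.
rewrite Rintegral_cst// -[RHS]mulr1; congr (_ * _).
exact: (congr1 fine (probability_setT m)).
Qed.

(** Dividing by L + 1 instead of L covers the case L = 0. *)
Lemma lipschitz_small (R : realType) (L r e : R) : 0 <= L -> r <= e / (L + 1) ->
  0 < e -> L * r <= e.
Proof.
move=> L0 + e0; rewrite ler_pdivlMr ?ltr_wpDl// => re.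
have [r0|/ltW r0] := leP 0 r; first by nra.
by rewrite (le_trans _ (ltW e0))// mulr_ge0_le0.
Qed.

Section drift.
Context {R : realType} {d : measure_display} {Omega : measurableType d}.
Variables (P : probability Omega R) (K : nat) (b : 'I_K -> R -> R -> R) (L M : R).
Variables (Y : Omega -> 'I_K) (xi : R -> Omega -> R)
  (mu : 'I_K -> R -> probability (measurableTypeR R) R).
Hypotheses (b_bnd : forall k x y, `|b k x y| <= M)
  (L0 : 0 <= L)
  (b_lip : forall k x1 y1 x2 y2,
      `|b k x1 y1 - b k x2 y2| <= L * (`|x1 - x2| + `|y1 - y2|))
  (Y_uniform : uniform_label P Y)
  (xi_cont : continuous_process xi)
  (mxi : forall t, 0 <= t <= 1 -> measurable_fun [set: Omega] (xi t))
  (xi_mu : conditional_marginals P Y xi mu).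

Local Notation beta k s x := (mean_drift (b k) x (mu k s)).

Let b_cont k x : continuous (b k x).
Proof.
move=> y; apply/cvgrPdist_le => e e0.
have eL : 0 < e / (L + 1) by rewrite divr_gt0// ltr_wpDl.
apply: filterS (@cvgr_dist_le _ _ _ (nbhs y) _ id y (@cvg_id _ _) _ eL) => z /= yz.
rewrite (le_trans (b_lip _ _ _ _ _))// subrr normr0 add0r.
exact: lipschitz_small.
Qed.

Let mb k x : measurable_fun setT (b k x).
Proof. exact: continuous_measurable_fun. Qed.

Let ib k x (m : probability (measurableTypeR R) R) :
  m.-integrable setT (fun z : measurableTypeR R => (b k x z)%:E).
Proof. by apply: bounded_integrable; [exact: mb|exact: b_bnd]. Qed.

Lemma mean_drift_bounded k s x : `|beta k s x| <= M.
Proof.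
rewrite /mean_drift (le_trans (le_normr_Rintegral _ _))//; first exact: ib.
have -> : M = \int[mu k s]_z cst M z.
  by rewrite Rintegral_cst_probability.
apply: le_Rintegral => //.
- exact: integrable_norm (ib _ _ _).
- exact: finite_measure_integrable_cst.
Qed.

Lemma mean_drift_lipschitz k s x y : `|beta k s x - beta k s y| <= L * `|x - y|.
Proof.
rewrite /mean_drift -RintegralB//; try exact: ib.
have iB : (mu k s).-integrable setT (EFin \o (fun z : measurableTypeR R => b k x z - b k y z)).
  by rewrite (_ : EFin \o _ = (fun z => (b k x z)%:E - (b k y z)%:E)%E)//; apply: integrableB => //; exact: ib.
rewrite (le_trans (le_normr_Rintegral _ _))//.
have -> : L * `|x - y| = \int[mu k s]_z cst (L * `|x - y|) z.
  by rewrite Rintegral_cst_probability.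
apply: le_Rintegral => //.
- exact: integrable_norm iB.
- exact: finite_measure_integrable_cst.
by move=> z _; rewrite (le_trans (b_lip _ _ _ _ _))// subrr normr0 addr0.
Qed.

Let mYk k : measurable (Y @^-1` [set k]). Proof. by have [] := Y_uniform k. Qed.

(** Since Y = k has probability 1/K, [mu k t] is K times the image under [xi t] of [P] restricted to
    Y = k. The time dependence thus moves from the measure to the integrand. *)
Let ge0_integral_marginal k t (f : R -> R) : 0 <= t <= 1 ->
  measurable_fun setT f -> (forall z, 0 <= f z) ->
  (\int[mu k t]_z (f z)%:E =
   K%:R%:E * \int[P]_(w in Y @^-1` [set k]) (f (xi t w))%:E)%E.
Proof.
move=> t01 mf f0.
have mx : @measurable_fun _ _ Omega (measurableTypeR R) setT (xi t) by exact: mxi.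
have mfe : measurable_fun setT (fun z : measurableTypeR R => (f z)%:E).
  by apply/measurable_EFinP; exact: mf.
rewrite (eq_measure_integral
  (mscale (NngNum (ler0n R K)) (image_measure (mrestr P (mYk k)) mx))); last first.
  move=> A mA _; apply: etrans (xi_mu k t01 mA) _; rewrite /= /mscale/=.
  have [_ ->] := Y_uniform k.
  have K0 : (0 < K)%N := leq_ltn_trans (leq0n _) (ltn_ord k).
  by rewrite inver invr_eq0 pnatr_eq0 gtn_eqF// invrK muleC.
rewrite ge0_integral_mscale//; last by move=> z _; rewrite lee_fin.
rewrite ge0_integral_image//.
rewrite ge0_integral_mrestr//.
all: try by move=> w; rewrite lee_fin.
by apply: measurableT_comp mfe _; exact: mx.
Qed.

(** Written as an expectation over paths, the drift is continuous in time by dominated convergence,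
    because the paths are continuous and [b k x] is bounded and continuous. *)
Lemma mean_drift_cvg k x (s_ : nat -> R) (s : R) : (forall n, 0 <= s_ n <= 1) -> 0 <= s <= 1 ->
  s_ n @[n --> \oo] --> s -> beta k (s_ n) x @[n --> \oo] --> beta k s x.
Proof.
move=> s01n s01 ss.
(* Adding [M] makes the integrand nonnegative; the constant is subtracted again after integration
   against a probability. *)
pose f z := b k x z + M.
have f0 z : 0 <= f z by have := b_bnd k x z; rewrite ler_norml /f; lra.
have fM z : f z <= M + M by have := b_bnd k x z; rewrite ler_norml /f; lra.
have mf : measurable_fun setT f by exact: measurable_funD.
pose E t := (K%:R%:E * \int[P]_(w in Y @^-1` [set k]) (f (xi t w))%:E)%E.
have betaE t : 0 <= t <= 1 -> beta k t x = fine (E t) - M.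
  move=> t01; rewrite /E -ge0_integral_marginal//.
  rewrite -[fine _]/(\int[mu k t]_z f z) /f RintegralD//; [|exact: ib|exact: finite_measure_integrable_cst].
  by rewrite (Rintegral_cst_probability (mu k t)) addrK.
rewrite betaE//; under eq_fun do rewrite betaE//.
apply: cvgB; last exact: cvg_cst.
have iE t : 0 <= t <= 1 -> P.-integrable (Y @^-1` [set k]) (fun w => (f (xi t w))%:E).
  move=> t01; apply: integrableS (@bounded_integrable _ _ _ P _ (M + M) _ _) => //.
    by apply: measurableT_comp mf _; exact: mxi.
  by move=> w; rewrite ger0_norm.
apply: fine_cvg; rewrite fineK; last first.
  by rewrite /E fin_numM//; exact: integrable_fin_num (iE _ s01).
apply: cvgeZl => //.
apply: (@dominated_cvg _ _ _ P (Y @^-1` [set k]) _ _ _ (cst (M + M)%:E)) => //.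
- by move=> n; apply: measurable_int (iE _ (s01n n)).
- move=> w _; apply: cvg_EFin; first exact: nearW.
  apply: cvgD; last exact: cvg_cst.
  apply: (@cvg_comp _ _ _ (fun n => xi (s_ n) w) (b k x)); last exact: b_cont.
  have xw : {within `[0, 1], continuous (xi ^~ w)} by exact: xi_cont.
  exact: (within_seq_continuous01 xw s01n s01 ss).
- exact: finite_measure_integrable_cst.
- by move=> n w _; rewrite /= lee_fin ger0_norm.
Qed.

(** The variation splits into that of the law at a fixed point and that of the point, the latter
    controlled by [L] uniformly in time. *)
Lemma mean_drift_seq_continuous k (g : R -> R) : seq_continuous01 g ->
  seq_continuous01 (fun s => beta k s (g s)).
Proof.
move=> gc s_ s s01n s01 ss.
have h1 : beta k (s_ n) (g s) @[n --> \oo] --> beta k s (g s) by exact: mean_drift_cvg.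
have h2 : beta k (s_ n) (g (s_ n)) - beta k (s_ n) (g s) @[n --> \oo] --> (0 : R).
  apply: norm_cvg0; apply: (@squeeze_cvgr _ _ _ _ (cst 0) (fun n => L * `|g (s_ n) - g s|)).
  - by apply: nearW => n; rewrite normr_ge0 mean_drift_lipschitz.
  - exact: cvg_cst.
  - rewrite -[X in _ --> X](mulr0 L); apply: cvgM; first exact: cvg_cst.
    have hg : g (s_ n) - g s @[n --> \oo] --> (0 : R).
      rewrite -[X in _ --> X](subrr (g s)).
      by apply: cvgB; [exact: gc|exact: cvg_cst].
    by rewrite -[X in _ --> X](normr0 R); exact: (cvg_norm hg).
rewrite -[X in _ --> X]add0r.
by rewrite (_ : (fun n => _) = (fun n => (beta k (s_ n) (g (s_ n)) - beta k (s_ n) (g s)) + beta k (s_ n) (g s)));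
  [exact: cvgD|apply/funext => n; rewrite subrK].
Qed.

Lemma measurable_mean_drift k s : measurable_fun setT (fun x => beta k s x).
Proof.
apply: continuous_measurable_fun => y; apply/cvgrPdist_le => e e0.
have eL : 0 < e / (L + 1) by rewrite divr_gt0// ltr_wpDl.
apply: filterS (@cvgr_dist_le _ _ _ (nbhs y) _ id y (@cvg_id _ _) _ eL) => z /= yz.
rewrite (le_trans (mean_drift_lipschitz _ _ _ _))//.
exact: lipschitz_small.
Qed.

End drift.

(** * Limit theorems for expectations and convergence along grids *)

Lemma min_lipschitz (R : realDomainType) (x y z : R) :
  `|Num.min x z - Num.min y z| <= `|x - y|.
Proof.
wlog xy : x y / x <= y => [H|].
  by have [/H//|/ltW/H] := leP x y; rewrite distrC [leRHS]distrC.
rewrite distrC [leRHS]distrC ger0_norm ?subr_ge0 ?le_min ?ge_min ?xy ?lexx ?orbT//.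
rewrite ger0_norm ?subr_ge0//.
by case: (leP y z) => yz; case: (leP x z) => xz; lra.
Qed.

Section limit_theorems.
Context d (Omega : measurableType d) (R : realType) (P : probability Omega R).
Local Open Scope ereal_scope.

(** Indices are chosen so that the expectations are at most 2^-(n+1). The sum of the functions then
    has finite expectation, so it is finite almost everywhere and its terms tend to 0. *)
Lemma ae_cvg0_subsequence (f : nat -> Omega -> R) :
  (forall n, measurable_fun setT (f n)) -> (forall n w, 0 <= f n w)%R ->
  \int[P]_w (f n w)%:E @[n --> \oo] --> 0 ->
  exists2 phi : nat -> nat, (forall n, (n <= phi n)%N) &
    {ae P, forall w, f (phi n) w @[n --> \oo] --> (0%R : R)}.
Proof.
move=> mf f0 fc.
have ex n : exists m, (n <= m)%N /\ \int[P]_w (f m w)%:E <= (1 / (2 ^ n.+1)%:R)%:E.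
  have e0 : (0 < 1 / (2 ^ n.+1)%:R :> R)%R by rewrite divr_gt0// ltr0n expn_gt0.
  have [ffin /cvgrPdist_le/(_ _ e0) fe] := (fine_cvgP _ _).1 fc.
  have [N _ HN] : \forall m \near \oo, \int[P]_w (f m w)%:E <= (1 / (2 ^ n.+1)%:R)%:E.
    apply: filterS2 ffin fe => m mfin; rewrite sub0r normrN /= => h.
    by rewrite -(fineK mfin) lee_fin (le_trans _ h)// ler_norm.
  by exists (maxn n N); split; [exact: leq_maxl|apply: HN; exact: leq_maxr].
have [phi phiP] := boolp.choice ex.
exists phi; first by move=> n; have [] := phiP n.
have mfe n : measurable_fun setT (fun w => (f (phi n) w)%:E) by apply/measurable_EFinP.
have fe0 n w : 0 <= (f (phi n) w)%:E by rewrite lee_fin.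
have sum_lty : \int[P]_w \sum_(0 <= n <oo) (f (phi n) w)%:E < +oo.
  rewrite integral_nneseries//.
  have := epsilon_trick0 xpredT (ler01 : (0 <= 1 :> R)%R).
  move=> h; apply: (@le_lt_trans _ _ 1%:E); last by rewrite ltry.
  apply: le_trans h; apply: lee_nneseries => n _; first by move=> _; exact: integral_ge0.
  by have [] := phiP n.
have mS : measurable_fun setT (fun w => \sum_(0 <= n <oo) (f (phi n) w)%:E).
  exact: ge0_emeasurable_sum.
have S0 w : 0 <= \sum_(0 <= n <oo) (f (phi n) w)%:E by exact: nneseries_ge0.
have iS : P.-integrable setT (fun w => \sum_(0 <= n <oo) (f (phi n) w)%:E).
  apply/integrableP; split => //.
  by under eq_integral do rewrite gee0_abs//.
apply: filterS (integrable_ae measurableT iS) => w /(_ I) Sfin.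
apply: (@cvg_series_cvg_0 _ R^o); apply: nnseries_is_cvg => //.
by rewrite -ge0_fin_numE.
Qed.

(** A uniform bound on second moments gives uniform integrability through x <= min(x, N) + x^2 / N.
    Truncated expectations converge by domination, and [N] is then sent to infinity. *)
Lemma limit_integral_square_bounded (f : nat -> Omega -> R) (g : Omega -> R)
    (C : R) (r : \bar R) :
  (forall n, measurable_fun setT (f n)) -> (forall n w, 0 <= f n w)%R ->
  measurable_fun setT g -> (forall w, 0 <= g w)%R ->
  {ae P, forall w, f n w @[n --> \oo] --> g w} ->
  (forall n, \int[P]_w ((f n w) ^+ 2)%:E <= C%:E) ->
  \int[P]_w (f n w)%:E @[n --> \oo] --> r ->
  \int[P]_w (g w)%:E = r.
Proof.
move=> mf f0 mg g0 fg fC fr.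
have cut_measurable (h : Omega -> R) N : measurable_fun setT h ->
    measurable_fun setT (fun w => (Num.min (h w) N%:R)%:E).
  by move=> mh; apply/measurable_EFinP; exact: measurable_minr.
have cut0 (h : Omega -> R) (N : nat) w : (0 <= h w)%R -> 0 <= (Num.min (h w) N%:R)%:E.
  by move=> h0; rewrite lee_fin le_min h0/=.
pose c N := \int[P]_w (Num.min (g w) N%:R)%:E.
have cutg (N : nat) : \int[P]_w (Num.min (f n w) N%:R)%:E @[n --> \oo] --> c N.
  have := @dominated_convergence _ _ _ P setT measurableT
    (fun n w => (Num.min (f n w) N%:R)%:E) (fun w => (Num.min (g w) N%:R)%:E)
    (cst N%:R%:E) (fun n => cut_measurable _ N (mf n)) (cut_measurable _ N mg).
  case=> //.
  - apply: filterS fg => w fgw _; apply: cvg_EFin; first exact: nearW.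
    apply/cvgrPdist_le => e e0; move/cvgrPdist_le : fgw => /(_ _ e0).
    apply: filterS => n; apply: le_trans.
    exact: min_lipschitz.
  - exact: finite_measure_integrable_cst.
  - apply: aeW => w n _; rewrite gee0_abs ?cut0// lee_fin ge_min lexx orbT//.
have lec N : c N <= r.
  apply: (lee_cvg_to (cutg N) fr); apply: nearW => n.
  apply: ge0_le_integral => //.
  - by move=> w _; exact: cut0.
  - exact: cut_measurable.
  - exact/measurable_EFinP.
  - by move=> w _; rewrite lee_fin ge_min lexx.
have lecC (N : nat) : (0 < N)%N -> r <= c N + (C / N%:R)%:E.
  move=> N0; have Np : (0 < N%:R :> R)%R by rewrite ltr0n.
  apply: (lee_cvg_to fr (cvgeD _ (cutg N) (cvg_cst (C / N%:R)%:E))).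
    by rewrite fin_num_adde_defl.
  apply: nearW => n /=.
  apply: (@le_trans _ _ (\int[P]_w ((Num.min (f n w) N%:R)%:E + (N%:R^-1)%:E * ((f n w) ^+ 2)%:E))).
    apply: ge0_le_integral => //.
    - by move=> w _; rewrite lee_fin.
    - exact/measurable_EFinP.
    - apply: emeasurable_funD; first exact: cut_measurable.
      by apply: emeasurable_funM => //; apply/measurable_EFinP; exact: measurable_funX.
    - move=> w _; rewrite -EFinM -EFinD lee_fin.
      have [fN|/ltW fN] := leP (f n w) N%:R.
        by rewrite lerDl mulr_ge0// ?invr_ge0 ?sqr_ge0// ltW.
      rewrite (le_trans _ (_ : N%:R^-1 * f n w ^+ 2 <= _)%R)//; last by rewrite lerDr ltW.
      by rewrite mulrC ler_pdivlMr// expr2 ler_wpM2l.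
  have msq : measurable_fun setT (fun w => ((f n w) ^+ 2)%:E).
    by apply/measurable_EFinP; exact: measurable_funX.
  have N0' : 0 <= (N%:R^-1 : R)%:E by rewrite lee_fin invr_ge0 ltW.
  have sq0 w : 0 <= ((f n w) ^+ 2)%:E by rewrite lee_fin sqr_ge0.
  rewrite ge0_integralD//; try by [move=> w _; exact: cut0|move=> w _; exact: mule_ge0
    |exact: cut_measurable|exact: emeasurable_funM].
  by apply: leeD => //; rewrite ge0_integralZl// mulrC EFinM lee_wpmul2l.
have cg : c N @[N --> \oo] --> \int[P]_w (g w)%:E.
  have := @cvg_monotone_convergence _ _ _ P setT measurableT
    (fun N w => (Num.min (g w) N%:R)%:E) (fun N => cut_measurable _ N mg).
  rewrite (_ : \int[P]_w (g w)%:E = \int[P]_w limn (fun N => (Num.min (g w) N%:R)%:E)).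
    apply => [N w _|w _ N N' NN']; first exact: cut0.
    by rewrite lee_fin le_min ge_min lexx/= ge_min ler_nat NN' orbT.
  apply: eq_integral => w _; apply/esym/cvg_lim => //.
  apply: cvg_EFin; first exact: nearW.
  apply: cvg_near_cst; near=> N; rewrite /= min_l//; near: N.
  exact: nbhs_infty_ger.
apply/eqP; rewrite eq_le; apply/andP; split.
  by apply: (cvge_to_le cg); exact: nearW.
have : c N.+1 + (C / N.+1%:R)%:E @[N --> \oo] --> \int[P]_w (g w)%:E + 0.
  apply: cvgeD.
  - by rewrite fin_num_adde_defl.
  - by rewrite (cvg_shiftS c).
  - apply: cvg_EFin; first exact: nearW.
    rewrite -[X in _ --> X](mulr0 C); apply: cvgM; first exact: cvg_cst.
    exact: cvg_harmonic.
rewrite adde0 => h; apply: (cvge_to_ge h); apply: nearW => N; exact: lecC.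
Unshelve. all: by end_near. Qed.

End limit_theorems.

Lemma cvg_sqr0 (R : realType) (a : nat -> R) (l : R) :
  (a n - l) ^+ 2 @[n --> \oo] --> (0 : R) -> a n @[n --> \oo] --> l.
Proof.
move=> h; apply/cvgrPdist_le => e e0.
have e2 : 0 < e ^+ 2 by rewrite exprn_gt0.
move/cvgrPdist_le : h => /(_ _ e2); apply: filterS => n.
by rewrite sub0r normrN normrX ler_pXn2r ?nnegrE ?normr_ge0 ?(ltW e0)// distrC.
Qed.

Lemma cvg_comp_ge (R : realType) (a : nat -> R) (l : R) (phi : nat -> nat) :
  (forall n, (n <= phi n)%N) -> a n @[n --> \oo] --> l -> a (phi n) @[n --> \oo] --> l.
Proof.
move=> phin al; apply/cvgrPdist_le => e e0; move/cvgrPdist_le : al => /(_ _ e0) [N _ HN].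
by exists N => // n /= Nn; apply: HN; exact: leq_trans (phin n).
Qed.

Lemma grid_sum_cvg (R : realType) (u : nat -> nat -> R) (h : R -> R) (M : R) :
  (forall n i, (i < n.+1)%N -> `|u n i| <= M) -> 0 <= M ->
  (forall s, 0 < s <= 1 -> grid_step n (u n) s @[n --> \oo] --> h s) ->
  \sum_(i < n.+1) u n i * (grid n i.+1 - grid n i)
    @[n --> \oo] --> \int[lebesgue_measure]_(s in `[0%R, 1%R]) h s.
Proof.
move=> uM M0 uh.
have := @grid_riemann_cvg R u h (cst 1) 1 M (measurable_cst _) _ uM M0 uh.
rewrite (_ : \int[_]_(_ in _) (h _ * _) = \int[lebesgue_measure]_(s in `[0%R, 1%R]) h s); last first.
  by apply: eq_Rintegral => s _; rewrite mulr1.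
move=> H; have {H} := H _; rewrite (_ : (fun n => _) = (fun n => \sum_(i < n.+1) u n i * (grid n i.+1 - grid n i))).
  by apply => s; rewrite normr1.
apply/funext => n; apply: eq_bigr => i _; congr (_ * _).
have lamcell : fine (lebesgue_measure `]grid n i, (grid n i.+1 : R)]%classic) = grid n i.+1 - grid n i.
  by rewrite lebesgue_measure_itv/= lte_fin grid_lt -EFinD.
by rewrite Rintegral_cst// lamcell mul1r.
Qed.

Lemma grid_step_sqr_cvg (R : realType) (u : nat -> nat -> R) (s l : R) : 0 < s <= 1 ->
  grid_step n (u n) s @[n --> \oo] --> l ->
  grid_step n (fun i => u n i ^+ 2) s @[n --> \oo] --> l ^+ 2.
Proof.
move=> /andP[s0 s1] ul.
have -> : (fun n => grid_step n (fun i => u n i ^+ 2) s) =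
    (fun n => grid_step n (u n) s * grid_step n (u n) s).
  by apply/funext => n; have [i [_ _ E]] := grid_cell n s0 s1; rewrite !E expr2.
by rewrite expr2; exact: (cvgM ul ul).
Qed.

Lemma grid_stepB_cvg (R : realType) (u v : nat -> nat -> R) (s l m : R) :
  grid_step n (u n) s @[n --> \oo] --> l -> grid_step n (v n) s @[n --> \oo] --> m ->
  grid_step n (fun i => u n i - v n i) s @[n --> \oo] --> l - m.
Proof.
move=> ul vm.
have -> : (fun n => grid_step n (fun i => u n i - v n i) s) =
    (fun n => grid_step n (u n) s - grid_step n (v n) s).
  apply/funext => n; rewrite /grid_step -sumrB; apply: eq_bigr => i _.
  by rewrite mulrBl.
exact: (cvgB ul vm).
Qed.

Definition grid_floor {R : realType} (n : nat) (t : R) : nat := Num.truncn (t * n.+1%:R).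

Lemma grid_floor_le (R : realType) n (t : R) : 0 <= t <= 1 -> (grid_floor n t <= n.+1)%N.
Proof.
move=> /andP[t0 t1]; rewrite truncn_le_nat (@le_lt_trans _ _ n.+1%:R) ?ltr_nat//.
by rewrite ler_piMl.
Qed.

Lemma grid_floor_cvg (R : realType) (t : R) : 0 <= t <= 1 ->
  grid n (grid_floor n t) @[n --> \oo] --> t.
Proof.
move=> /andP[t0 t1].
have hB : t - n.+1%:R^-1 @[n --> \oo] --> t.
  rewrite -[X in _ --> X]subr0; apply: cvgB; first exact: cvg_cst.
  exact: cvg_harmonic.
apply: (squeeze_cvgr _ hB (cvg_cst t)); apply: nearW => n.
have n0 : 0 < n.+1%:R :> R by [].
have /andP[lo hi] := truncn_itv (mulr_ge0 t0 (ltW n0)).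
rewrite /grid ler_pdivrMr// lo andbT lerBlDr -[X in _ + X]mul1r -mulrDl.
by rewrite ler_pdivlMr// natr1 ltW.
Qed.

Lemma prodr_le1 (R : numDomainType) (I : Type) (r : seq I) (Q : pred I) (f : I -> R) :
  (forall i, Q i -> 0 <= f i <= 1) -> \prod_(i <- r | Q i) f i <= 1.
Proof.
by move=> f01; rewrite -[leRHS](@big1_eq R 1 *%R I r Q); exact: ler_prod.
Qed.

Lemma prod_cvg (R : realType) (T : finType) (f : T -> nat -> R) (l : T -> R) :
  (forall p, f p n @[n --> \oo] --> l p) ->
  \prod_p f p n @[n --> \oo] --> \prod_p l p.
Proof.
move=> fl; elim: (index_enum T) => [|p s ih].
  by under eq_fun do rewrite big_nil; rewrite big_nil; exact: cvg_cst.
under eq_fun do rewrite big_cons; rewrite big_cons; exact: (cvgM (fl p) ih).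
Qed.

(** * The sigma-algebra generated by the path and its cylinders *)

Section path_space.
Context {R : realType} {d : measure_display} {Omega : measurableType d}.
Variable xi : R -> Omega -> R.

(** The path sigma-algebra is placed on [Omega] itself: measurability from this type means being a
    measurable function of [xi] on [0, 1]. *)
Definition path_space := g_sigma_algebraType
  (\bigcup_(t in `[0%R, 1%R]) preimage_set_system setT (xi t) measurable).

Lemma measurable_path_space t : 0 <= t <= 1 -> measurable_fun [set: path_space] (xi t).
Proof.
move=> t01 _ B mB; apply: sub_sigma_algebra; exists t; first by rewrite /= in_itv.
by exists B.
Qed.

Hypothesis mxi : forall t, 0 <= t <= 1 -> measurable_fun [set: Omega] (xi t).

Lemma sigma_process_measurable : sigma_process xi `<=` measurable.
Proof.
apply: smallest_sub; first exact: sigma_algebra_measurable.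
move=> _ [t t01 [B mB <-]]; apply: mxi => //.
Qed.

Lemma path_space_measurable (f : Omega -> R) :
  measurable_fun [set: path_space] f -> measurable_fun [set: Omega] f.
Proof. by move=> mf _ B mB; apply: sigma_process_measurable; exact: mf. Qed.

End path_space.

Section path_cylinders.
Context {R : realType} {d : measure_display} {Omega : measurableType d}.
Variable xi : R -> Omega -> R.

(** Only half-lines are used as constraints: their indicators are limits of continuous functions,
    and they generate the Borel sets. An arbitrary finite index type makes closure under
    intersection a disjoint sum. *)
Definition cylinder (A : set Omega) : Prop :=
  exists (T : finType) (t a : T -> R),
    (forall p, 0 <= t p <= 1) /\ A = [set w | forall p, xi (t p) w <= a p].

Lemma cylinder_setT : cylinder setT.
Proof.
exists void, (fun=> 0), (fun=> 0); split=> //.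
by apply/seteqP; split=> // w _ [].
Qed.

Lemma cylinder_setI : setI_closed cylinder.
Proof.
move=> _ _ [T [t [a [t01 ->]]]] [T' [t' [a' [t01' ->]]]].
exists (T + T')%type, (fun p => match p with inl i => t i | inr i => t' i end),
  (fun p => match p with inl i => a i | inr i => a' i end); split; first by case.
apply/seteqP; split=> w; first by move=> [h h'] [].
by move=> h; split=> p; [exact: (h (inl p))|exact: (h (inr p))].
Qed.

Lemma sigma_process_cylinder : sigma_process xi `<=` <<s cylinder >>.
Proof.
apply: smallest_sub; first exact: smallest_sigma_algebra.
move=> _ [t t01 [B mB <-]].
suff : measurable_fun [set: g_sigma_algebraType cylinder] (xi t) by apply.
apply: (measurability _ (RGenOInfty.measurableE R)) => // _ [_ [x ->] <-].
rewrite setTI (_ : _ @^-1` _ = ~` [set w | xi t w <= x]); last first.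
  by apply/seteqP; split=> w /=; rewrite in_itv/= andbT ltNge => /negP.
apply: measurableC; apply: sub_sigma_algebra.
exists unit, (fun=> t), (fun=> x); split; first by move: t01; rewrite /= in_itv.
by apply/seteqP; split=> w //= /(_ tt).
Qed.

Hypothesis mxi : forall t, 0 <= t <= 1 -> measurable_fun [set: Omega] (xi t).

Lemma cylinder_measurable : cylinder `<=` measurable.
Proof.
move=> _ [T [t [a [t01 ->]]]].
rewrite (_ : mkset _ = \bigcap_(p in [set: T]) (xi (t p) @^-1` `]-oo, a p])).
  apply: fin_bigcap_measurable => [|p _]; first exact: finite_finset.
  by rewrite -[X in measurable X]setTI; exact: mxi.
by apply/seteqP; split=> w Aw p => [_|]; have := Aw p; rewrite /= in_itv/=; [|apply].
Qed.

End path_cylinders.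

(** * Identification of conditional probabilities *)

Lemma ge0_integral_indic_setI d (T : measurableType d) (R : realType) (P : {measure set T -> \bar R})
    (A : set T) (f : T -> R) : measurable A -> 
  (\int[P]_w (\1_A w * f w)%:E = \int[P]_(w in A) (f w)%:E)%E.
Proof.
move=> mA; rewrite [RHS]integral_mkcond; apply: eq_integral => w _.
by rewrite epatch_indic/= -EFinM mulrC.
Qed.

Section generated_sigma_algebra.
Context d (T : measurableType d) (R : realType) (P : probability T R).
Local Open Scope ereal_scope.

(** Both sides are finite measures in [A] that agree on a pi-system containing the whole space, so
    Dynkin's lemma applies; equality on the whole space is what handles complements. *)
Lemma integral_eq_sigma_algebra (C : set (set T)) (E : set T) (h : T -> R) :
  C `<=` measurable -> setI_closed C -> C setT -> measurable E ->
  measurable_fun setT h -> (forall w, 0 <= h w)%R ->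
  (forall A, C A -> \int[P]_(w in A) (h w)%:E = P (A `&` E)) ->
  forall A, <<s C >> A -> \int[P]_(w in A) (h w)%:E = P (A `&` E).
Proof.
move=> CM CI CT mE mh h0 hC.
have sub : <<s C >> `<=` measurable.
  by apply: smallest_sub => //; exact: sigma_algebra_measurable.
have mhE A : measurable_fun A (fun w => (h w)%:E).
  by apply/measurable_EFinP; exact: measurable_funTS.
have hE0 w : 0 <= (h w)%:E by rewrite lee_fin.
apply: (@dynkin_induction _ (g_sigma_algebraType C) C) => //.
- exact: hC.
- move=> A /sub mA hA.
  have mAC : d.-measurable (~` A) by exact: measurableC.
  have := hC _ CT; rewrite -[X in \int[P]_(w in X) _](setvU A) setUC ge0_integral_setU//; last first.
    by apply/disj_set2P; rewrite setICr.
  rewrite hA setTI => Heq.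
  have : P (A `&` E) + P (~` A `&` E) = P E.
    rewrite -measureU//; try exact: measurableI.
      by rewrite -setIUl setUCr setTI.
    by rewrite setIACA setICr set0I.
  have Pf : P (A `&` E) \is a fin_num by apply: fin_num_measure; exact: measurableI.
  rewrite -{}Heq => /(congr1 (fun x => x - P (A `&` E))).
  by rewrite ![P (A `&` E) + _]addeC !addeK.
- move=> A mA tA hA.
  have mA' i : d.-measurable (A i) by apply: sub; exact: mA.
  rewrite ge0_integral_bigcup//.
  rewrite setI_bigcupl measure_bigcup//.
  + by rewrite [RHS]eseries_mkcond; apply: eq_eseriesr => i _; rewrite mem_set//= hA.
  + by move=> i _; exact: measurableI.
  + exact: trivIset_setIr.
Qed.

(* The level sets separating [p] from [S^-1] are null. *)
Lemma cond_prob_inverse_density (G : set (set T)) (E : set T) (p S : T -> R) :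
  sigma_algebra setT G -> G `<=` measurable -> measurable E ->
  is_cond_prob P G E p ->
  measurable_wrt G S -> (forall w, 0 < S w)%R ->
  (forall A, G A -> \int[P]_(w in A) (\1_E w * S w)%:E = P A) ->
  {ae P, forall w, p w = (S w)^-1}%R.
Proof.
move=> sG GM mE [mp ip hp] mS S0 hS.
have mT (f : T -> R) : measurable_wrt G f -> measurable_fun setT f.
  by move=> mf _ B mB; rewrite setTI; apply: GM; exact: mf.
have GI A B : G A -> G B -> G (A `&` B).
  move=> GA GB.
  have GG : (<<s G >> = G) by exact: sigma_algebra_id.
  by rewrite -GG in GA GB *; exact: (@measurableI _ (g_sigma_algebraType G)).
have Pfin A : G A -> P A \is a fin_num by move=> /GM; exact: fin_num_measure.
have mind A : measurable_fun A (fun w => (\1_E w)%:E : \bar R).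
  by apply/measurable_EFinP; exact/measurable_funTS/measurable_indic.
have mindS A : measurable_fun A (fun w => (\1_E w * S w)%:E).
  apply/measurable_EFinP; apply/measurable_funTS/measurable_funM => //; last exact: mT.
have ind0 w : (0 <= \1_E w :> R)%R by rewrite indicE.
have PAE A : measurable A -> P (A `&` E) = \int[P]_(w in A) (\1_E w)%:E.
  by move=> mA; rewrite integral_indic// [E `&` A]setIC.
have Ggt f (r : R) : measurable_wrt G f -> G [set w | r < f w]%R.
  move=> mf; rewrite (_ : [set _ | _] = f @^-1` `]r, +oo[%classic); first exact: mf.
  by apply/seteqP; split=> w /=; rewrite in_itv/= andbT.
have Glt f (r : R) : measurable_wrt G f -> G [set w | f w < r]%R.
  move=> mf; rewrite (_ : [set _ | _] = f @^-1` `]-oo, r[%classic); first exact: mf.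
  by apply/seteqP; split=> w /=; rewrite in_itv/=.
have ae0 A : measurable A -> P A = 0 -> {ae P, forall w, ~ A w}.
  by move=> mA PA; exists A; split=> // w /contrapT.
(* On the event A where p > r and 1/S < s, one has r P(A) <= P(A, E) from the conditional
   probability, and P(A, E) <= s P(A) because S > 1/s there. As s < r, this forces P(A) = 0. The
   fact [dn] is the same with the inequalities reversed. *)
have up (r s : R) : (0 < s)%R -> (s < r)%R -> {ae P, forall w, ~ ([set w | r < p w]%R `&` [set w | (S w)^-1 < s]%R) w}.
  move=> s0 sr; set A := _ `&` _.
  have GA : G A.
    apply: GI; first exact: Ggt.
    rewrite (_ : [set _ | _] = [set w | s^-1 < S w]%R); first exact: Ggt.
    by apply/seteqP; split=> w /=; rewrite invf_plt ?posrE.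
  have mA := GM _ GA; apply: (ae0 _ mA).
  have h1 : r%:E * P A <= \int[P]_(w in A) (p w)%:E.
    rewrite -integral_cst//; apply: le_integral => //.
    - exact: finite_measure_integrable_cst.
    - exact: integrableS ip.
    - by move=> w /set_mem[/ltW].
  have h2 : (s^-1)%:E * P (A `&` E) <= P A.
    rewrite -[leRHS]hS// PAE// -ge0_integralZl//; last by rewrite lee_fin invr_ge0 ltW.
    apply: ge0_le_integral => //.
    - by move=> w _; rewrite -EFinM lee_fin mulr_ge0// invr_ge0 ltW.
    - by apply: emeasurable_funM => //.
    - by move=> w [_ /= Ss]; rewrite -EFinM lee_fin mulrC ler_wpM2l// -[leRHS]invrK lef_pV2 ?posrE ?invr_gt0// ltW.
  move: h1; rewrite hp// => h1.
  have Pf := Pfin _ GA; have Pf' : P (A `&` E) \is a fin_num by apply: fin_num_measure; exact: measurableI.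
  have PA0 : 0 <= P A by [].
  move: h1 h2 PA0; rewrite -(fineK Pf) -(fineK Pf') -!EFinM !lee_fin => h1 h2 PA0.
  congr (_%:E); apply/eqP; rewrite eq_le PA0 andbT leNgt; apply/negP => PA.
  have : (fine (P (A `&` E)) <= s * fine (P A))%R by rewrite -ler_pdivrMl.
  move/(le_trans h1); rewrite ler_pM2r//; apply/negP; rewrite -ltNge//.
have dn (r s : R) : (0 < s)%R -> (r < s)%R -> {ae P, forall w, ~ ([set w | p w < r]%R `&` [set w | s < (S w)^-1]%R) w}.
  move=> s0 rs; set A := _ `&` _.
  have GA : G A.
    apply: GI; first exact: Glt.
    rewrite (_ : [set _ | _] = [set w | S w < s^-1]%R); first exact: Glt.
    by apply/seteqP; split=> w /=; rewrite invf_pgt ?posrE.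
  have mA := GM _ GA; apply: (ae0 _ mA).
  have h1 : \int[P]_(w in A) (p w)%:E <= r%:E * P A.
    rewrite -integral_cst//; apply: le_integral => //.
    - exact: integrableS ip.
    - exact: finite_measure_integrable_cst.
    - by move=> w /set_mem[/ltW].
  have h2 : P A <= (s^-1)%:E * P (A `&` E).
    rewrite -[leLHS]hS// PAE// -ge0_integralZl//; last by rewrite lee_fin invr_ge0 ltW.
    apply: ge0_le_integral => //.
    - by move=> w _; rewrite lee_fin mulr_ge0// ltW.
    - by apply: emeasurable_funM => //.
    - by move=> w [_ /= Ss]; rewrite -EFinM lee_fin mulrC ler_wpM2r// -[leLHS]invrK lef_pV2 ?posrE ?invr_gt0// ltW.
  move: h1; rewrite hp// => h1.
  have Pf := Pfin _ GA; have Pf' : P (A `&` E) \is a fin_num by apply: fin_num_measure; exact: measurableI.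
  have PA0 : 0 <= P A by [].
  move: h1 h2 PA0; rewrite -(fineK Pf) -(fineK Pf') -!EFinM !lee_fin => h1 h2 PA0.
  congr (_%:E); apply/eqP; rewrite eq_le PA0 andbT leNgt; apply/negP => PA.
  have : (s * fine (P A) <= fine (P (A `&` E)))%R by rewrite -ler_pdivlMl.
  move=> /le_trans /(_ h1); rewrite ler_pM2r//; apply/negP; rewrite -ltNge//.
(* If p and 1/S differ at [w], two rationals separate them; countably many pairs of rationals leave
   a single null set to discard. *)
pose Q (rs : rat * rat) w := (0 < ratr rs.2 :> R ->
    (ratr rs.2 < ratr rs.1 :> R -> ~ (ratr rs.1 < p w /\ (S w)^-1 < ratr rs.2)) /\
    (ratr rs.1 < ratr rs.2 :> R -> ~ (p w < ratr rs.1 /\ ratr rs.2 < (S w)^-1)))%R.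
have null rs : {ae P, forall w, Q rs w}.
  rewrite /Q; have [s0|/negP s0] := boolP (0 < ratr rs.2 :> R)%R; last exact: aeW.
  have [sr|rs'|rs'] := ltgtP (ratr rs.2 : R) (ratr rs.1).
  - by apply: filterS (up _ _ s0 sr) => w Aw _; split.
  - by apply: filterS (dn _ _ s0 rs') => w Aw _; split.
  - exact: aeW.
have all : {ae P, forall w, forall n, if unpickle n is Some rs then Q rs w else True}.
  apply/ae_foralln => n; case: (unpickle n) => [rs|]; [exact: null|exact: aeW].
apply: filterS all => w hw.
have h rs : Q rs w by have := hw (pickle rs); rewrite pickleK.
have Sp : (0 < (S w)^-1)%R by rewrite invr_gt0.
apply/eqP; rewrite eq_le; apply/andP; split; rewrite leNgt; apply/negP => lt.
  have [r /[!in_itv]/andP[Sr rp]] := rat_in_itvoo lt.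
  have [s /[!in_itv]/andP[Ss sr]] := rat_in_itvoo Sr.
  by have [H _] := h (r, s) (lt_trans Sp Ss); exact: (H sr).
(* A version [p] may be negative at [w], while the separating level [s] has to be positive; hence
   the maximum with 0. *)
have lt' : (Num.max 0 (p w) < (S w)^-1)%R by rewrite gt_max Sp lt.
have [s /[!in_itv]/=/andP[]] := rat_in_itvoo lt'; rewrite gt_max => /andP[s0 ps] sS.
have [r /[!in_itv]/andP[pr rs]] := rat_in_itvoo ps.
by have [_ H] := h (r, s) s0; exact: (H rs).
Qed.
End generated_sigma_algebra.

(** * Discretized likelihoods of the McKean-Vlasov solution *)

Section euler_approximation.
Context {R : realType} {d : measure_display} {Omega : measurableType d}.
Variables (P : probability Omega R) (F : R -> set (set Omega)).
Variables (K : nat) (x0 : R) (b : 'I_K -> R -> R -> R) (L M : R).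
Variables (Y : Omega -> 'I_K) (W xi : R -> Omega -> R).
Variable mu : 'I_K -> R -> probability (measurableTypeR R) R.
Hypotheses (b_bnd : forall k x y, `|b k x y| <= M) (L0 : 0 <= L)
    (b_lip : forall k x1 y1 x2 y2,
      `|b k x1 y1 - b k x2 y2| <= L * (`|x1 - x2| + `|y1 - y2|))
    (F_usual : usual_filtration P F)
    (Y_uniform : uniform_label P Y)
    (Y_F0 : forall k, F 0 (Y @^-1` [set k]))
    (W_brownian : brownian_motion P F W)
    (xi_solution : mckean_vlasov_solution P F x0 b Y W xi mu).

Local Notation beta k s x := (mean_drift (b k) x (mu k s)).
Local Notation H := (drift_along b xi mu).

Definition euler_drift (n : nat) (k : 'I_K) (i : nat) (y : R) : R := beta k (grid n i) y.

(** The drift uses the flow [mu] of the exact solution, so given the label this is the Euler scheme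
    of an ordinary equation with time-dependent drift. *)
Definition euler_path (n : nat) (k : 'I_K) : nat -> Omega -> R :=
  euler W x0 (grid n) (euler_drift n k).

(** Two discretizations of the drift of label [j] are kept. This one, along the Euler chain of the
    true label, enters the discrete densities; [drift_on_grid], along [xi] itself, yields functions
    of the path. *)
Definition drift_on_euler (n : nat) (j : 'I_K) (i : nat) (w : Omega) : R :=
  euler_drift n j i (euler_path n (Y w) i w).

Definition drift_on_grid (n : nat) (j : 'I_K) (i : nat) (w : Omega) : R :=
  H j (grid n i) w.

Definition good_path (w : Omega) : Prop := W 0 w = 0 /\
  forall t : R, 0 <= t <= 1 ->
    xi t w = x0 + \int[lebesgue_measure]_(s in `[0%R, t]) H (Y w) s w + W t w.

Lemma good_path_ae : {ae P, forall w, good_path w}.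
Proof.
by apply: filterS2 (bm_start W_brownian) (mv_equation xi_solution) => w; split.
Qed.

Let mxi_F t : 0 <= t <= 1 -> measurable_fun [set: g_sigma_algebraType (F t)] (xi t).
Proof.
move=> t01; apply/(measurable_wrtP F_usual _ t01) => B mB.
by apply: (mv_adapted xi_solution).
Qed.

Lemma measurable_solution t : 0 <= t <= 1 -> measurable_fun [set: Omega] (xi t).
Proof. by move=> t01; exact: (measurable_filtration F_usual t01 (mxi_F t01)). Qed.

Let xi_cont : continuous_process xi. Proof. exact: mv_continuous xi_solution. Qed.

Let xi_mu : conditional_marginals P Y xi mu. Proof. exact: mv_marginals xi_solution. Qed.

Let xi_seq w : seq_continuous01 (xi ^~ w).
Proof. by apply: within_seq_continuous01; exact: xi_cont. Qed.

Let beta_bnd k s x : `|beta k s x| <= M.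
Proof. exact: (@mean_drift_bounded _ _ b L M mu b_bnd L0 b_lip). Qed.

Let beta_lip k s x y : `|beta k s x - beta k s y| <= L * `|x - y|.
Proof. exact: (@mean_drift_lipschitz _ _ b L M mu b_bnd L0 b_lip). Qed.

Lemma drift_along_bounded j s w : `|H j s w| <= M.
Proof. exact: beta_bnd. Qed.

Lemma drift_along_continuous j w : seq_continuous01 (fun s => H j s w).
Proof.
exact: (mean_drift_seq_continuous b_bnd L0 b_lip Y_uniform xi_cont measurable_solution xi_mu).
Qed.

Lemma measurable_euler_drift n k i : measurable_fun setT (euler_drift n k i).
Proof. exact: (@measurable_mean_drift _ _ b L M mu b_bnd L0 b_lip). Qed.

Lemma drift_on_grid_cvg w j s : 0 < s <= 1 ->
  grid_step n (drift_on_grid n j ^~ w) s @[n --> \oo] --> H j s w.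
Proof. exact: (@grid_values_cvg _ (fun s => H j s w) s (@drift_along_continuous j w)). Qed.

Lemma euler_path_cvg w : good_path w -> forall e : R, 0 < e ->
  \forall n \near \oo, forall i, (i <= n.+1)%N ->
    `|xi (grid n i) w - euler_path n (Y w) i w| <= e.
Proof.
move=> [W0 eq] e e0.
apply: (@euler_cvg _ _ W x0 w (fun s y => beta (Y w) s y) (xi ^~ w) L M) => //.
- exact: drift_along_continuous.
- rewrite eq; last by rewrite lexx ler01.
  have -> : `[0%R, 0%R]%classic = [set (0 : R)] by exact: set_itv1.
  by rewrite Rintegral_set1 W0 !addr0.
Qed.

Lemma drift_on_euler_cvg w j s : good_path w -> 0 < s <= 1 ->
  grid_step n (drift_on_euler n j ^~ w) s @[n --> \oo] --> H j s w.
Proof.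
move=> gw s01; apply: (@grid_step_cvg _ (fun s => H j s w) _ s (@drift_along_continuous j w) s01) => e e0.
have eL : 0 < e / (L + 1) by rewrite divr_gt0// ltr_wpDl.
apply: filterS (euler_path_cvg gw eL) => n hn i iN.
rewrite /drift_on_euler /euler_drift (le_trans (beta_lip _ _ _ _))//.
by apply: lipschitz_small => //; apply: hn; exact: ltnW.
Qed.

Lemma measurable_label (t : R) (f : 'I_K -> Omega -> R) : 0 <= t <= 1 ->
  (forall k, measurable_fun [set: g_sigma_algebraType (F t)] (f k)) ->
  measurable_fun [set: g_sigma_algebraType (F t)] (fun w => f (Y w) w).
Proof.
move=> t01 mf; have [t0 t1] := andP t01.
rewrite (_ : (fun w => _) = (fun w => \sum_k \1_(Y @^-1` [set k]) w * f k w)).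
  apply: measurable_sum => k; apply: measurable_funM => //.
  apply: measurable_indic; rewrite /measurable/= (filtrationE F_usual t01).
  exact: (filtration_nondecreasing F_usual (lexx 0) t0 t1).
apply/funext => w; rewrite (bigD1 (Y w))//= big1 ?addr0.
  by rewrite indicE mem_set ?mul1r.
by move=> k kY; rewrite indicE memNset ?mul0r//= => Yk; rewrite Yk eqxx in kY.
Qed.

Let grid01 n i : (i <= n.+1)%N -> 0 <= (grid n i : R) <= 1.
Proof. by move=> ?; rewrite grid_ge0 grid_le1. Qed.

Lemma measurable_euler_path n k i : (i <= n.+1)%N ->
  measurable_fun [set: g_sigma_algebraType (F (grid n i))] (euler_path n k i).
Proof.
move=> iN; apply: (measurable_euler x0 (n := n.+1) F_usual W_brownian) => //.
- by rewrite grid0.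
- by rewrite gridn.
- by move=> m _; exact: grid_lt.
- by move=> m; exact: measurable_euler_drift.
Qed.

Lemma drift_on_euler_adapted n j : grid_adapted F n (drift_on_euler n j).
Proof.
move=> i iN; apply: (measurable_label (f := fun k w => euler_drift n j i (euler_path n k i w))).
  exact: grid01 (ltnW iN).
move=> k; apply: measurableT_comp (measurable_euler_drift _ _ _) _.
exact: measurable_euler_path (ltnW iN).
Qed.

Lemma drift_on_grid_adapted n j : grid_adapted F n (drift_on_grid n j).
Proof.
move=> i iN; apply: measurableT_comp (measurable_euler_drift n j i) _.
exact: mxi_F (grid01 (ltnW iN)).
Qed.

Lemma drift_on_euler_bounded n j i w : `|drift_on_euler n j i w| <= M.
Proof. exact: beta_bnd. Qed.

Variable I : 'I_K -> Omega -> R.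
Hypothesis I_ito : forall k, is_ito_integral P F W (H k) (I k).

(** The squared errors of both discretizations are summed over all labels, so a single subsequence
    serves for everything. *)
Lemma grid_integral_subsequence : exists2 phi : nat -> nat,
  (forall n, (n <= phi n)%N) &
  {ae P, forall w, forall j,
    grid_integral W (phi n) (drift_on_euler (phi n) j) w @[n --> \oo] --> I j w /\
    grid_integral W (phi n) (drift_on_grid (phi n) j) w @[n --> \oo] --> I j w}.
Proof.
pose ea n j w := (grid_integral W n (drift_on_euler n j) w - I j w) ^+ 2.
pose eb n j w := (grid_integral W n (drift_on_grid n j) w - I j w) ^+ 2.
have mI j : measurable_fun setT (I j) by case: (I_ito j).
have mea n j : measurable_fun setT (ea n j).
  apply: measurable_funX; apply: measurable_funB => //.
  exact: (measurable_grid_integral F_usual W_brownian (@drift_on_euler_adapted n j)).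
have meb n j : measurable_fun setT (eb n j).
  apply: measurable_funX; apply: measurable_funB => //.
  exact: (measurable_grid_integral F_usual W_brownian (@drift_on_grid_adapted n j)).
have [|n w||phi phin phiae] := @ae_cvg0_subsequence _ _ _ P (fun n w => \sum_j (ea n j w + eb n j w)).
- by move=> n; apply: measurable_sum => j; exact: measurable_funD.
- by apply: sumr_ge0 => j _; rewrite addr_ge0 ?sqr_ge0.
- rewrite (_ : (fun n => _) = (fun n => \sum_j (\int[P]_w (ea n j w)%:E + \int[P]_w (eb n j w)%:E)%E)%E); last first.
    apply/funext => n; under eq_integral do rewrite -sumEFin.
    rewrite ge0_integral_sum//; last 2 first.
    - by move=> j; apply/measurable_EFinP; exact: measurable_funD.
    - by move=> j w _; rewrite lee_fin addr_ge0 ?sqr_ge0.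
    apply: eq_bigr => j _; under eq_integral do rewrite EFinD.
    by rewrite ge0_integralD//; try by [move=> w _; rewrite lee_fin sqr_ge0|apply/measurable_EFinP].
  pose e j n := (\int[P]_w (ea n j w)%:E + \int[P]_w (eb n j w)%:E)%E.
  have e0 j : e j n @[n --> \oo] --> 0%E.
    rewrite -[X in _ --> X]adde0; apply: cvgeD => //.
    - apply: (grid_integral_cvg F_usual W_brownian (I_ito j) (u := fun n => drift_on_euler n j) (M := M)).
      + by move=> n; exact: drift_on_euler_adapted.
      + by move=> n i w _; exact: drift_on_euler_bounded.
      + exact: drift_along_bounded.
      + by apply: filterS good_path_ae => w gw s s01; exact: drift_on_euler_cvg.
    - apply: (grid_integral_cvg F_usual W_brownian (I_ito j) (u := fun n => drift_on_grid n j) (M := M)).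
      + by move=> n; exact: drift_on_grid_adapted.
      + by move=> n i w _; exact: drift_along_bounded.
      + exact: drift_along_bounded.
      + by apply: aeW => w s s01; exact: drift_on_grid_cvg.
  have := @cvg_nnesum nat \oo _ R 'I_K (index_enum _) e (fun=> 0%E) xpredT.
  rewrite big1// => h; apply: h => j _ //; apply: nearW => n.
  by rewrite adde_ge0//; apply: integral_ge0 => w _; rewrite lee_fin sqr_ge0.
exists phi => //; apply: filterS phiae => w sum0 j.
have q n : ea n j w + eb n j w <= \sum_j (ea n j w + eb n j w).
  by rewrite (bigD1 j)//= lerDl sumr_ge0// => i _; rewrite addr_ge0 ?sqr_ge0.
split; apply: cvg_sqr0.
- apply: (squeeze_cvgr _ (cvg_cst 0) sum0); apply: nearW => n; rewrite sqr_ge0/=.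
  by apply: le_trans (q _); rewrite lerDl sqr_ge0.
- apply: (squeeze_cvgr _ (cvg_cst 0) sum0); apply: nearW => n; rewrite sqr_ge0/=.
  by apply: le_trans (q _); rewrite lerDr sqr_ge0.
Qed.

Let M0 : 0 <= M.
Proof. exact: le_trans (normr_ge0 _) (drift_along_bounded (Y point) 0 point). Qed.

(** The logarithm of the density of the chain of label [j] with respect to that of label [k],
    evaluated along the latter. *)
Definition euler_log_ratio n (k j : 'I_K) (w : Omega) : R :=
  let theta i := euler_drift n j i (euler_path n k i w) - euler_drift n k i (euler_path n k i w) in
  \sum_(i < n.+1) (theta i * (W (grid n i.+1) w - W (grid n i) w)
                   - theta i ^+ 2 * (grid n i.+1 - grid n i) / 2).

Variable phi : nat -> nat.
Hypothesis phin : forall n, (n <= phi n)%N.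

Definition good_point (w : Omega) : Prop := good_path w /\ forall j,
    grid_integral W (phi n) (drift_on_euler (phi n) j) w @[n --> \oo] --> I j w /\
    grid_integral W (phi n) (drift_on_grid (phi n) j) w @[n --> \oo] --> I j w.

Let B (f : R -> R) := \int[lebesgue_measure]_(s in `[0%R, 1%R]) f s.

(** The reference chain is that of the true label [Y w], the one that follows [xi]; along it the
    discretized drifts of all labels converge. *)
Lemma euler_log_ratio_cvg w j : good_point w ->
  euler_log_ratio (phi n) (Y w) j w @[n --> \oo] -->
  I j w - I (Y w) w - 2^-1 * B (fun s => (H j s w - H (Y w) s w) ^+ 2).
Proof.
move=> [gw gI].
pose q n := \sum_(i < n.+1) (drift_on_euler n j i w - drift_on_euler n (Y w) i w) ^+ 2
                             * (grid n i.+1 - grid n i).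
have -> : (fun n => euler_log_ratio (phi n) (Y w) j w) = (fun n =>
    (grid_integral W (phi n) (drift_on_euler (phi n) j) w
     - grid_integral W (phi n) (drift_on_euler (phi n) (Y w)) w) - 2^-1 * q (phi n)).
  apply/funext => n; rewrite /euler_log_ratio /grid_integral /q mulr_sumr -!sumrB.
  by apply: eq_bigr => i _; rewrite /drift_on_euler; ring.
apply: cvgB; first by apply: cvgB; [case: (gI j)|case: (gI (Y w))].
apply: cvgM; first exact: cvg_cst.
apply: (cvg_comp_ge phin); rewrite /q.
apply: (@grid_sum_cvg _ (fun n i => (drift_on_euler n j i w - drift_on_euler n (Y w) i w) ^+ 2)
  _ ((M + M) ^+ 2)).
- move=> n i _; rewrite normrX lerXn2r ?nnegrE ?addr_ge0//.
  by rewrite (le_trans (ler_normB _ _))// lerD// drift_on_euler_bounded.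
- exact: sqr_ge0.
- move=> s s01; apply: grid_step_sqr_cvg => //.
  by apply: grid_stepB_cvg; exact: drift_on_euler_cvg.
Qed.

Variable J : 'I_K -> Omega -> R.

Definition ito_identity (w : Omega) : Prop :=
  forall j, J j w = B (fun s => H j s w * H (Y w) s w) + I j w.

Local Notation LL j w := (log_likelihood b xi mu j (J j) w).

Let H_int i j w : lebesgue_measure.-integrable `[0%R, 1%R] (EFin \o (fun s => H i s w * H j s w)).
Proof.
apply: (bounded_integrable01 (M := M * M)) => //.
  by apply: measurable_funM; apply: seq_continuous01_measurable; exact: drift_along_continuous.
by move=> s; rewrite normrM ler_pM// drift_along_bounded.
Qed.

(** Substituting d xi = H_Y dt + dW in both terms, the drift contributions H_j H_Y - H_j^2/2 -
    H_Y^2/2 combine into -(H_j - H_Y)^2/2, which is the Girsanov exponent. *)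
Lemma log_likelihoodB w j : ito_identity w ->
  LL j w - LL (Y w) w =
  I j w - I (Y w) w - 2^-1 * B (fun s => (H j s w - H (Y w) s w) ^+ 2).
Proof.
move=> Jw; rewrite /log_likelihood !Jw.
have sq i : \int[lebesgue_measure]_(s in `[0%R, 1%R]) H i s w ^+ 2 = B (fun s => H i s w * H i s w).
  by apply: eq_Rintegral => s _; rewrite expr2.
rewrite !sq /B.
have -> : \int[lebesgue_measure]_(s in `[0%R, 1%R]) (H j s w - H (Y w) s w) ^+ 2 =
    B (fun s => H j s w * H j s w) - B (fun s => H j s w * H (Y w) s w)
    - (B (fun s => H j s w * H (Y w) s w) - B (fun s => H (Y w) s w * H (Y w) s w)).
  have i1 := H_int j j w; have i2 := H_int j (Y w) w; have i3 := H_int (Y w) (Y w) w.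
  have ib (a c : R -> R) : lebesgue_measure.-integrable `[0%R, 1%R] (EFin \o a) ->
      lebesgue_measure.-integrable `[0%R, 1%R] (EFin \o c) ->
      lebesgue_measure.-integrable `[0%R, 1%R] (EFin \o (fun s : R => a s - c s)).
    have m01 : measurable (`[0%R, 1%R]%classic : set (measurableTypeR R)) by exact: measurable_itv.
    by move=> ia ic; have := integrableB m01 ia ic; apply: eq_integrable.
  rewrite /B -!RintegralB//; try exact: ib.
  by apply: eq_Rintegral => s _; ring.
by rewrite /B; field.
Qed.

Definition grid_log_likelihood n (j : 'I_K) (w : Omega) : R :=
  \sum_(i < n.+1) (drift_on_grid n j i w * (xi (grid n i.+1) w - xi (grid n i) w)
                   - drift_on_grid n j i w ^+ 2 * (grid n i.+1 - grid n i) / 2).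

(** On a good path, an increment of [xi] is the integral of the true drift over the cell plus a
    Brownian increment; the two parts converge to the two terms of [J j]. *)
Lemma grid_log_likelihood_cvg w j : good_point w -> ito_identity w ->
  grid_log_likelihood (phi n) j w @[n --> \oo] --> LL j w.
Proof.
move=> [gw gI] Jw.
pose r n := \sum_(i < n.+1) drift_on_grid n j i w *
  \int[lebesgue_measure]_(s in `]grid n i, grid n i.+1]) H (Y w) s w.
pose q n := \sum_(i < n.+1) drift_on_grid n j i w ^+ 2 * (grid n i.+1 - grid n i).
have mH i : measurable_fun (`[0%R, 1%R]%classic : set R) (fun s => H i s w).
  by apply: seq_continuous01_measurable; exact: drift_along_continuous.
have -> : (fun n => grid_log_likelihood (phi n) j w) = (fun n =>
    (r (phi n) + grid_integral W (phi n) (drift_on_grid (phi n) j) w) - 2^-1 * q (phi n)).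
  apply/funext => n; rewrite /grid_log_likelihood /grid_integral /q /r mulr_sumr -big_split -sumrB/=.
  apply: eq_bigr => i _.
  have HM s : `|H (Y w) s w| <= M by exact: drift_along_bounded.
  rewrite -(Rintegral_cell (ltn_ord i) (mH (Y w)) HM).
  have [_ eq] := gw.
  by rewrite (eq _ (grid01 (ltn_ord i))) (eq _ (grid01 (ltnW (ltn_ord i)))); field.
rewrite /log_likelihood Jw; apply: cvgB; first apply: cvgD.
- apply: (cvg_comp_ge phin); rewrite /r.
  apply: (@grid_riemann_cvg _ (fun n i => drift_on_grid n j i w) (fun s => H j s w)
    (fun s => H (Y w) s w) M M) => //.
  + by move=> s; exact: drift_along_bounded.
  + by move=> n i _; exact: drift_along_bounded.
  + by move=> s s01; exact: drift_on_grid_cvg.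
- by case: (gI j).
apply: cvgM; first exact: cvg_cst.
apply: (cvg_comp_ge phin); rewrite /q.
apply: (@grid_sum_cvg _ (fun n i => drift_on_grid n j i w ^+ 2) _ (M ^+ 2)).
- by move=> n i _; rewrite normrX lerXn2r ?nnegrE//; exact: drift_along_bounded.
- exact: sqr_ge0.
- by move=> s s01; apply: grid_step_sqr_cvg => //; exact: drift_on_grid_cvg.
Qed.

Lemma measurable_euler_log_ratio n k j : measurable_fun setT (euler_log_ratio n k j).
Proof.
have mW i : (i <= n.+1)%N -> measurable_fun setT (W (grid n i)).
  move=> iN; apply: (measurable_filtration F_usual (grid01 iN)).
  exact: (measurable_brownian F_usual W_brownian (grid01 iN)).
apply: measurable_sum => -[i iN] /=.
have mX : measurable_fun setT (euler_path n k i).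
  exact: (measurable_filtration F_usual (grid01 (ltnW iN)) (@measurable_euler_path n k i (ltnW iN))).
have mth : measurable_fun setT
    (fun w => euler_drift n j i (euler_path n k i w) - euler_drift n k i (euler_path n k i w)).
  by apply: measurable_funB; exact: measurableT_comp (measurable_euler_drift _ _ _) mX.
apply: measurable_funB.
  apply: measurable_funM => //; apply: measurable_funB; first exact: mW.
  exact: mW (ltnW iN).
by apply: measurable_funM => //; apply: measurable_funM => //; exact: measurable_funX.
Qed.

(** * Likelihood ratios on finite-dimensional and cylinder events *)

Section finite_dimensional.
Variables (T : finType) (tt : T -> R) (g : T -> R -> R).
Hypotheses (tt01 : forall p, 0 <= tt p <= 1)
  (mg : forall p, measurable_fun setT (g p)) (g0 : forall p x, 0 <= g p x).

(** This is [euler_weight_integral] with [theta] the difference of the two drifts on one side and no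
    tilt on the other. *)
Lemma euler_change_of_drift n k j :
  (\int[P]_w (\1_(Y @^-1` [set k]) w *
     \prod_p g p (euler_path n k (grid_floor n (tt p)) w) * expR (euler_log_ratio n k j w))%:E =
   \int[P]_w (\1_(Y @^-1` [set j]) w *
     \prod_p g p (euler_path n j (grid_floor n (tt p)) w))%:E)%E.
Proof.
(* The factors are grouped by the grid index of their observation time. Index [n.+1], reached at
   time 1, is the end of the last step, so its group serves as the terminal test function. *)
pose G i y := \prod_(p | grid_floor n (tt p) == i) g p y.
have G0 i x : 0 <= G i x by exact: prodr_ge0.
have mG i : measurable_fun setT (G i).
  rewrite /G; under eq_fun do rewrite -big_filter.
  by apply: measurable_prod => p _; exact: mg.
have GE (X : nat -> R) : (\prod_(i < n.+1) G i (X i)) * G n.+1 (X n.+1) =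
    \prod_p g p (X (grid_floor n (tt p))).
  rewrite -(big_ord_recr n.+1 (fun i => G i (X i)))/= /G.
  rewrite (exchange_big_dep xpredT)//=; apply: eq_bigr => p _.
  have fp : (grid_floor n (tt p) < n.+2)%N by rewrite ltnS grid_floor_le.
  rewrite (big_pred1 (Ordinal fp))//.
pose theta i y := euler_drift n j i y - euler_drift n k i y.
have mE (l : 'I_K) i := measurable_euler_drift n l i.
have FY l : F (grid n 0) (Y @^-1` [set l]) by rewrite grid0.
have PY l l' : P (Y @^-1` [set l]) = P (Y @^-1` [set l']).
  by rewrite (Y_uniform l).2 (Y_uniform l').2.
have g00 : 0 <= (grid n 0 : R) by rewrite grid0.
have gn1 : (grid n n.+1 : R) <= 1 by rewrite gridn.
have cc i x : euler_drift n k i x + theta i x = euler_drift n j i x + cst 0 x.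
  by rewrite /theta addr0 addrC subrK.
have mth i : measurable_fun setT (theta i) by apply: measurable_funB.
have mh : measurable_fun setT (fun y => (G n.+1 y)%:E) by exact/measurable_EFinP.
have h0 x : (0 <= (G n.+1 x)%:E)%E by rewrite lee_fin.
have H := @euler_weight_integral _ _ _ P F W x0 (grid n) n.+1 F_usual W_brownian g00 gn1
  (fun m _ => grid_lt n m) _ _ (euler_drift n k) theta (euler_drift n j) (fun _ => cst 0) G
  (fun y => (G n.+1 y)%:E) (FY k) (FY j) (PY k j) cc (mE k) mth (mE j)
  (fun _ => measurable_cst _) mG G0 mh h0.
transitivity (\int[P]_w ((\1_(Y @^-1` [set k]) w *
  euler_weight W x0 (grid n) (euler_drift n k) theta G n.+1 w)%:E *
  (G n.+1 (euler W x0 (grid n) (euler_drift n k) n.+1 w))%:E))%E.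
  apply: eq_integral => w _; rewrite -EFinM; congr (_%:E).
  rewrite /euler_weight big_split/= -expR_sum -[RHS]mulrA -[LHS]mulrA; congr (_ * _).
  by rewrite -(GE (fun i => euler_path n k i w)) mulrAC.
rewrite H; apply: eq_integral => w _; rewrite -EFinM; congr (_%:E).
rewrite /euler_weight big_split/= -[LHS]mulrA; congr (_ * _).
rewrite [X in _ * X * _]big1 ?mulr1; last first.
  by move=> i _; rewrite mul0r expr0n/= mul0r mul0r subrr expR0.
by rewrite -(GE (fun i => euler_path n j i w)).
Qed.

End finite_dimensional.

(** Squaring exp(theta dW - theta^2 dt / 2) gives the density factor of the doubled tilt [2 theta]
    times exp(theta^2 dt). The doubled weight has total mass P(Y = k) <= 1, and the remaining
    factors multiply to at most exp(4 M^2) because |theta| <= 2 M and the steps add up to 1. *)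
Lemma euler_log_ratio_square n k j :
  (\int[P]_w ((\1_(Y @^-1` [set k]) w * expR (euler_log_ratio n k j w)) ^+ 2)%:E
   <= (expR (4 * M ^+ 2))%:E)%E.
Proof.
pose theta i y := 2 * (euler_drift n j i y - euler_drift n k i y).
have mE (l : 'I_K) i := measurable_euler_drift n l i.
have FY : F (grid n 0) (Y @^-1` [set k]) by rewrite grid0.
have g00 : 0 <= (grid n 0 : R) by rewrite grid0.
have gn1 : (grid n n.+1 : R) <= 1 by rewrite gridn.
have mth i : measurable_fun setT (theta i) by apply: measurable_funM => //; exact: measurable_funB.
pose c2 i y := euler_drift n k i y + theta i y.
have cc i x : euler_drift n k i x + theta i x = c2 i x + cst 0 x.
  by rewrite addr0.
have := @euler_weight_integral _ _ _ P F W x0 (grid n) n.+1 F_usual W_brownian g00 gn1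
  (fun m _ => grid_lt n m) _ _ (euler_drift n k) theta c2
  (fun _ => cst 0) (fun _ => cst 1) (cst 1%E) FY FY erefl cc (mE k) mth
  (fun i => measurable_funD (mE k i) (mth i)) (fun _ => measurable_cst _) (fun _ => measurable_cst _)
  (fun _ _ => ler01) (measurable_cst _) (fun _ => lee01).
have mY : measurable (Y @^-1` [set k]) by case: (Y_uniform k).
set wt := euler_weight _ _ _ _ _ _ _.
have -> : (\int[P]_w ((\1_(Y @^-1` [set k]) w * euler_weight W x0 (grid n)
    c2 (fun=> cst 0) (fun=> cst 1) n.+1 w)%:E * cst 1 (euler W x0 (grid n) c2 n.+1 w)))%E =
    P (Y @^-1` [set k]).
  rewrite -[in RHS](setIT (Y @^-1` [set k])) -integral_indic//.
  apply: eq_integral => w _; rewrite /euler_weight big1 ?mulr1 ?mule1//.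
  by move=> i _; rewrite mul0r expr0n/= mul0r mul0r subrr expR0 mulr1.
move=> H.
have mwt : measurable_fun setT wt.
  have t01 : 0 <= (grid n n.+1 : R) <= 1 by rewrite gridn lexx ler01.
  apply: (measurable_filtration F_usual t01).
  apply: (measurable_euler_weight x0 F_usual W_brownian g00 gn1 (fun m _ => grid_lt n m)) => //.
have mi : measurable_fun setT (\1_(Y @^-1` [set k]) : Omega -> R) by exact: measurable_indic.
have wt0 w : 0 <= wt w by apply: prodr_ge0 => i _; rewrite mul1r expR_ge0.
apply: (@le_trans _ _ (\int[P]_w ((expR (4 * M ^+ 2))%:E * (\1_(Y @^-1` [set k]) w * wt w)%:E))%E).
  apply: ge0_le_integral => //.
  - apply/measurable_EFinP; apply: measurable_funX; apply: measurable_funM => //.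
    exact: measurableT_comp (measurable_euler_log_ratio n k j).
  - by apply: emeasurable_funM => //; apply/measurable_EFinP; exact: measurable_funM.
  move=> w _; rewrite -EFinM lee_fin indicE; case: (_ \in _); last by rewrite !mul0r expr0n mulr0.
  rewrite !mul1r -expRM_natl/= /wt /euler_weight.
  under eq_bigr do rewrite mul1r; rewrite -expR_sum -expRD ler_expR.
  rewrite /euler_log_ratio -mulr_natl mulr_sumr -lerBlDr -sumrB.
  apply: (@le_trans _ _ (\sum_(i < n.+1) 4 * M ^+ 2 * (grid n i.+1 - grid n i))); last first.
    by rewrite -mulr_sumr; under eq_bigr do rewrite gridB; rewrite sumr_const card_ord -[X in _ * X]mulr_natl divff// mulr1.
  apply: ler_sum => i _; rewrite /theta -/(euler_path n k i w).
  set u := euler_drift n j i _ - euler_drift n k i _.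
  set dW := W _ _ - W _ _; set dt := grid _ _ - grid _ _.
  have dt0 : 0 <= dt by rewrite /dt subr_ge0 grid_le.
  rewrite [leLHS](_ : _ = u ^+ 2 * dt); last by field.
  have -> : 4 * M ^+ 2 = (M + M) ^+ 2 by ring.
  rewrite ler_wpM2r// -(real_normK (num_real u)) lerXn2r ?nnegrE ?addr_ge0//.
  by rewrite (le_trans (ler_normB _ _))// lerD// beta_bnd.
rewrite ge0_integralZl//.
- have -> : (\int[P]_w (\1_(Y @^-1` [set k]) w * wt w)%:E = P (Y @^-1` [set k]))%E.
    by rewrite -H; apply: eq_integral => w _; rewrite mule1.
  rewrite -[leRHS]mule1 lee_wpmul2l//; exact: probability_le1.
- by apply/measurable_EFinP; exact: measurable_funM.
- by move=> w _; rewrite lee_fin mulr_ge0.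
Qed.

(** An upper limit is defined and path measurable everywhere, whether or not the sums converge;
    where it is infinite, [fine] returns 0, which happens only on a null set under the almost sure
    convergence shown above. *)
Definition path_log_likelihood (j : 'I_K) (w : Omega) : R :=
  fine (limn_esup (fun n => (grid_log_likelihood (phi n) j w)%:E)).

Lemma path_log_likelihoodE w j : good_point w -> ito_identity w ->
  path_log_likelihood j w = LL j w.
Proof.
move=> gw Jw; have h := @grid_log_likelihood_cvg w j gw Jw.
have hE : (grid_log_likelihood (phi n) j w)%:E @[n --> \oo] --> (LL j w)%:E.
  by apply: cvg_EFin; [exact: nearW|exact: h].
by rewrite /path_log_likelihood (cvg_limn_einf_sup hE).2.
Qed.

Lemma measurable_path_log_likelihood j :
  measurable_fun [set: path_space xi] (path_log_likelihood j).
Proof.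
apply: measurableT_comp; first exact: fine_measurable.
apply: measurable_fun_limn_esup => n; apply/measurable_EFinP.
apply: measurable_sum => -[i iN]/=.
have mx l : (l <= (phi n).+1)%N -> measurable_fun [set: path_space xi] (xi (grid (phi n) l)).
  by move=> lN; apply: measurable_path_space; exact: grid01.
have md : measurable_fun [set: path_space xi] (drift_on_grid (phi n) j i).
  exact: measurableT_comp (measurable_euler_drift (phi n) j i) (mx _ (ltnW iN)).
apply: measurable_funB.
  apply: measurable_funM => //; apply: measurable_funB; first exact: mx.
  exact: mx (ltnW iN).
by apply: measurable_funM => //; apply: measurable_funM => //; exact: measurable_funX.
Qed.

Lemma euler_path_floor_cvg w t : good_path w -> 0 <= t <= 1 ->
  euler_path (phi n) (Y w) (grid_floor (phi n) t) w @[n --> \oo] --> xi t w.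
Proof.
move=> gw t01.
have h1 : xi (grid (phi n) (grid_floor (phi n) t)) w @[n --> \oo] --> xi t w.
  apply: (cvg_comp_ge (a := fun n => xi (grid n (grid_floor n t)) w) phin).
  apply: (@xi_seq w _ _ _ t01 (grid_floor_cvg t01)) => n.
  by apply: grid01; exact: grid_floor_le.
have h2 : xi (grid (phi n) (grid_floor (phi n) t)) w
    - euler_path (phi n) (Y w) (grid_floor (phi n) t) w @[n --> \oo] --> (0 : R).
  apply: (cvg_comp_ge (a := fun n => xi (grid n (grid_floor n t)) w
    - euler_path n (Y w) (grid_floor n t) w) phin).
  apply/cvgrPdist_le => e e0; apply: filterS (euler_path_cvg gw e0) => n hn.
  by rewrite sub0r normrN hn// grid_floor_le.
rewrite -[X in _ --> X]subr0.
rewrite (_ : (fun n => _) = (fun n => xi (grid (phi n) (grid_floor (phi n) t)) w -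
  (xi (grid (phi n) (grid_floor (phi n) t)) w
    - euler_path (phi n) (Y w) (grid_floor (phi n) t) w))).
  exact: (cvgB h1 h2).
by apply/funext => n; rewrite subKr.
Qed.

Hypothesis good_ae : {ae P, forall w, good_point w /\ ito_identity w}.

Let rho k j w := expR (path_log_likelihood j w - path_log_likelihood k w).

Let mind k : measurable_fun setT (\1_(Y @^-1` [set k]) : Omega -> R).
Proof. by apply: measurable_indic; case: (Y_uniform k). Qed.

Let mrho k j : measurable_fun setT (rho k j).
Proof.
apply: measurableT_comp => //; apply: (path_space_measurable measurable_solution).
by apply: measurable_funB; exact: measurable_path_log_likelihood.
Qed.

(** The limit of [euler_change_of_drift] along [phi]: the left side converges by uniform
    integrability, the right side by bounded convergence. *)
Lemma likelihood_ratio_finite_dim (T : finType) (tt : T -> R) (g : T -> R -> R) k j :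
  (forall p, 0 <= tt p <= 1) -> (forall p, continuous (g p)) ->
  (forall p x, 0 <= g p x <= 1) ->
  (\int[P]_w (\1_(Y @^-1` [set k]) w * \prod_p g p (xi (tt p) w) * rho k j w)%:E =
   \int[P]_w (\1_(Y @^-1` [set j]) w * \prod_p g p (xi (tt p) w))%:E)%E.
Proof.
move=> tt01 gc g01.
have mg p : measurable_fun setT (g p) by exact: continuous_measurable_fun.
have g0 p x : 0 <= g p x by case/andP: (g01 p x).
have g1 p x : g p x <= 1 by case/andP: (g01 p x).
have p0 (x : T -> R) : 0 <= \prod_p g p (x p) by exact: prodr_ge0.
have p1 (x : T -> R) : \prod_p g p (x p) <= 1.
  by apply: prodr_le1 => p _; rewrite g0 g1.
have ind0 l w : 0 <= \1_(Y @^-1` [set l]) w :> R by rewrite indicE.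
have mEul n l : measurable_fun setT (fun w => \prod_p g p (euler_path n l (grid_floor n (tt p)) w)).
  apply: measurable_prod => p _; apply: measurableT_comp (mg p) _.
  have fp := grid_floor_le n (tt01 p).
  exact: (measurable_filtration F_usual (grid01 fp) (@measurable_euler_path n l _ fp)).
have mxi : measurable_fun setT (fun w => \prod_p g p (xi (tt p) w)).
  apply: measurable_prod => p _; apply: measurableT_comp (mg p) _.
  exact: measurable_solution.
have pcvg w l : good_path w -> \1_(Y @^-1` [set l]) w *
    \prod_p g p (euler_path (phi n) l (grid_floor (phi n) (tt p)) w) @[n --> \oo] -->
    \1_(Y @^-1` [set l]) w * \prod_p g p (xi (tt p) w).
  move=> gw; rewrite indicE; have [|_] := boolP (w \in _); last first.
    by rewrite mul0r; under eq_fun do rewrite mul0r; exact: cvg_cst.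
  rewrite inE/= => <-; apply: cvgM; first exact: cvg_cst.
  apply: prod_cvg => p; apply: (cvg_comp _ _ (euler_path_floor_cvg gw (tt01 p))).
  exact: gc.
apply: (@limit_integral_square_bounded _ _ _ P (fun n w => \1_(Y @^-1` [set k]) w *
  \prod_p g p (euler_path (phi n) k (grid_floor (phi n) (tt p)) w)
  * expR (euler_log_ratio (phi n) k j w)) _ (expR (4 * M ^+ 2))).
- move=> n; apply: measurable_funM; first exact: measurable_funM.
  exact: measurableT_comp (measurable_euler_log_ratio _ _ _).
- by move=> n w; rewrite !mulr_ge0// expR_ge0.
- by apply: measurable_funM => //; exact: measurable_funM.
- by move=> w; rewrite !mulr_ge0// expR_ge0.
- apply: filterS good_ae => w [gw Jw]; have [gpw _] := gw.
  (* Off Y = k every term vanishes; on it [k] is the true label, for which the convergence results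
     hold. *)
  have [Yk|Yk] := pselect (Y w = k); last first.
    rewrite indicE memNset// !mul0r; under eq_fun do rewrite !mul0r; exact: cvg_cst.
  apply: cvgM; first exact: pcvg.
  rewrite /rho !path_log_likelihoodE// -Yk log_likelihoodB//.
  exact: (cvg_comp _ _ (@euler_log_ratio_cvg w j gw) (@continuous_expR R _)).
- move=> n; apply: le_trans (euler_log_ratio_square (phi n) k j).
  apply: ge0_le_integral => //.
  + by move=> w _; rewrite lee_fin sqr_ge0.
  + apply/measurable_EFinP; apply: measurable_funX; apply: measurable_funM; first exact: measurable_funM.
    exact: measurableT_comp (measurable_euler_log_ratio _ _ _).
  + apply/measurable_EFinP; apply: measurable_funX; apply: measurable_funM => //.
    exact: measurableT_comp (measurable_euler_log_ratio _ _ _).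
  + move=> w _; rewrite lee_fin lerXn2r ?nnegrE ?mulr_ge0 ?expR_ge0//.
    by rewrite ler_wpM2r ?expR_ge0// ler_piMr.
(* After the exact change of drift the density is gone and the integrands are bounded by 1. *)
- under eq_cvg do rewrite (euler_change_of_drift tt01 mg g0).
  have h n : measurable_fun setT (fun w => (\1_(Y @^-1` [set j]) w *
      \prod_p g p (euler_path (phi n) j (grid_floor (phi n) (tt p)) w))%:E).
    by apply/measurable_EFinP; exact: measurable_funM.
  have h' : measurable_fun setT (fun w => (\1_(Y @^-1` [set j]) w *
      \prod_p g p (xi (tt p) w))%:E).
    by apply/measurable_EFinP; exact: measurable_funM.
  have := @dominated_convergence _ _ _ P setT measurableT _ _ (cst 1%E) h h'.
  case=> //.
  + apply: filterS good_ae => w [[gw _] _] _; apply: cvg_EFin; first exact: nearW.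
    exact: pcvg.
  + exact: finite_measure_integrable_cst.
  + apply: aeW => w n _; rewrite abse_EFin lee_fin ger0_norm ?mulr_ge0//.
    by rewrite mulr_ile1// indicE; case: (_ \in _).
Qed.

(** The indicator of the cylinder is the limit of the powers of a continuous function with values in
    [0, 1] that equals 1 exactly on it. *)
Lemma likelihood_ratio_indicator (T : finType) (tt a : T -> R) k j :
  (forall p, 0 <= tt p <= 1) ->
  (\int[P]_w (\1_[set w | forall p, xi (tt p) w <= a p] w *
      (\1_(Y @^-1` [set k]) w * rho k j w))%:E =
   P ([set w | forall p, (xi (tt p) w <= a p)%R] `&` Y @^-1` [set j]))%E.
Proof.
move=> tt01; set A := [set w | _].
(* The exponent is minus twice the positive part of [x - a p], so [q p] is 1 up to [a p] and less
   than 1 beyond. *)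
pose q p x := expR (- (x - a p + `|x - a p|)).
have q01 p x : 0 <= q p x <= 1.
  rewrite expR_ge0 -[leRHS]expR0 ler_expR oppr_le0 -[x in x + _]opprK addrC subr_ge0.
  by rewrite -normrN ler_norm.
have qc p : continuous (q p).
  move=> x; apply: continuous_comp; last exact: continuous_expR.
  apply: cvgN; apply: cvgD; first by apply: cvgB; [exact: cvg_id|exact: cvg_cst].
  by apply: cvg_norm; apply: cvgB; [exact: cvg_id|exact: cvg_cst].
have ind0 l w : 0 <= \1_(Y @^-1` [set l]) w :> R by rewrite indicE.
pose z w := \prod_p q p (xi (tt p) w).
have z01 w : 0 <= z w <= 1.
  rewrite prodr_ge0/= => [|p _]; last by case/andP: (q01 p (xi (tt p) w)).
  by apply: prodr_le1.
have mz : measurable_fun setT z.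
  apply: measurable_prod => p _; apply: measurableT_comp (continuous_measurable_fun (qc p)) _.
  exact: measurable_solution.
have zc w : z w ^+ m @[m --> \oo] --> (\1_A w : R).
  rewrite indicE; have [|wA] := boolP (w \in A).
    rewrite inE/= => wA; rewrite /z big1; first by under eq_fun do rewrite expr1n; exact: cvg_cst.
    move=> p _; rewrite /q ler0_norm ?subrr ?oppr0 ?expR0//.
    by rewrite subr_le0.
  have /existsNP[p /negP] : ~ A w by move=> Aw; move/negP: wA; apply; rewrite inE.
  rewrite -ltNge => ap; apply: cvg_expr; have /andP[z0 _] := z01 w.
  rewrite ger0_norm// /z (bigD1 p)//=.
  have qp1 : q p (xi (tt p) w) < 1.
    rewrite -[ltRHS]expR0 ltr_expR oppr_lt0 ger0_norm ?subr_ge0 ?ltW//.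
    by rewrite addr_gt0// subr_gt0.
  apply: le_lt_trans qp1; rewrite ler_piMr ?expR_ge0//.
  by apply: prodr_le1.
have zm0 w m : 0 <= z w ^+ m by rewrite exprn_ge0//; case/andP: (z01 w).
have zm1 w m : z w ^+ m <= 1 by rewrite exprn_ile1//; case/andP: (z01 w).
have id m : (\int[P]_w (\1_(Y @^-1` [set k]) w * z w ^+ m * rho k j w)%:E =
   \int[P]_w (\1_(Y @^-1` [set j]) w * z w ^+ m)%:E)%E.
  under eq_integral do rewrite /z -prodrXl.
  under [RHS]eq_integral do rewrite /z -prodrXl.
  apply: (likelihood_ratio_finite_dim (g := fun p x => q p x ^+ m)) => // p x.
    exact: continuous_comp (qc p x) (@exprn_continuous _ _ _).
  by have /andP[q0 q1] := q01 p x; rewrite exprn_ge0// exprn_ile1.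
have mA : measurable A by apply: (cylinder_measurable measurable_solution); exists T, tt, a.
(* The power m = 0 of the identity gives the mass of the density, namely P(Y = j), hence the
   integrable dominating function used below. *)
have rho_int : P.-integrable setT (fun w => (\1_(Y @^-1` [set k]) w * rho k j w)%:E).
  apply/integrableP; split; first by apply/measurable_EFinP; exact: measurable_funM.
  under eq_integral do rewrite abse_EFin ger0_norm ?mulr_ge0 ?expR_ge0//.
  have -> : (\int[P]_w (\1_(Y @^-1` [set k]) w * rho k j w)%:E =
      \int[P]_w (\1_(Y @^-1` [set j]) w : R)%:E)%E.
    by apply: (etrans (etrans _ (id 0%N))); apply: eq_integral => w _; rewrite expr0 mulr1.
  have [mYj _] := Y_uniform j.
  by rewrite integral_indic// setIT (le_lt_trans (probability_le1 P mYj))// ltry.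
have meas1 m : measurable_fun setT (fun w => (\1_(Y @^-1` [set k]) w * z w ^+ m * rho k j w)%:E).
  apply/measurable_EFinP; apply: measurable_funM => //; apply: measurable_funM => //.
  exact: measurable_funX.
have meas2 : measurable_fun setT (fun w => (\1_A w * (\1_(Y @^-1` [set k]) w * rho k j w))%:E).
  by apply/measurable_EFinP; do 2 (apply: measurable_funM => //); exact: measurable_indic.
have [||_ _ L1] := @dominated_convergence _ _ _ P setT measurableT _ _ _ meas1 meas2 _ rho_int.
- apply: aeW => w _; apply: cvg_EFin; first exact: nearW.
  rewrite mulrA [\1_A w * _]mulrC; apply: cvgM; last exact: cvg_cst.
  by apply: cvgM; [exact: cvg_cst|exact: zc].
- apply: aeW => w m _; rewrite abse_EFin lee_fin ger0_norm ?mulr_ge0 ?expR_ge0//.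
  by rewrite ler_wpM2r ?expR_ge0// ler_piMr.
have meas3 m : measurable_fun setT (fun w => (\1_(Y @^-1` [set j]) w * z w ^+ m)%:E).
  by apply/measurable_EFinP; apply: measurable_funM => //; exact: measurable_funX.
have meas4 : measurable_fun setT (fun w => (\1_(A `&` Y @^-1` [set j]) w : R)%:E).
  by apply/measurable_EFinP/measurable_indic/measurableI => //; case: (Y_uniform j).
have [|||_ _ L2] := @dominated_convergence _ _ _ P setT measurableT _ _ (cst 1%E) meas3 meas4.
- apply: aeW => w _; apply: cvg_EFin; first exact: nearW.
  rewrite indicI/= mulrC; apply: cvgM; first exact: cvg_cst.
  exact: zc.
- exact: finite_measure_integrable_cst.
- apply: aeW => w m _; rewrite abse_EFin lee_fin ger0_norm ?mulr_ge0//.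
  by rewrite mulr_ile1// indicE; case: (_ \in _).
rewrite integral_indic ?setIT in L2 => //; last by apply: measurableI => //; case: (Y_uniform j).
have E : [sequence (\int[P]_w (\1_(Y @^-1` [set k]) w * z w ^+ m * rho k j w)%:E)%E]_m =
  [sequence (\int[P]_w (\1_(Y @^-1` [set j]) w * z w ^+ m)%:E)%E]_m.
  by apply/funext => m /=; exact: id.
by apply: cvg_unique L2; [exact: ereal_hausdorff|rewrite -E].
Qed.

End euler_approximation.

(** * Bayes' formula on the path sigma-algebra *)

Theorem proposition3p2 (R : realType) (d : measure_display)
    (Omega : measurableType d) (P : probability Omega R)
    (F : R -> set (set Omega))
    (K : nat) (x0 : R) (b : 'I_K -> R -> R -> R) (L : R)
    (Y : Omega -> 'I_K) (W xi : R -> Omega -> R)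
    (mu : 'I_K -> R -> probability (measurableTypeR R) R)
    (J : 'I_K -> Omega -> R)
    (K_gt0 : (0 < K)%N)
    (b_bounded : forall k, exists M : R, forall x y, `|b k x y| <= M)
    (L_gt0 : 0 < L)
    (b_lipschitz : forall k x1 y1 x2 y2,
      `|b k x1 y1 - b k x2 y2| <= L * (`|x1 - x2| + `|y1 - y2|))
    (F_usual : usual_filtration P F)
    (Y_uniform : uniform_label P Y)
    (Y_F0 : forall k, F 0 (Y @^-1` [set k]))
    (W_brownian : brownian_motion P F W)
    (W_indep_Y : independent_label P W Y)
    (xi_solution : mckean_vlasov_solution P F x0 b Y W xi mu)
    (J_integral : forall k,
      is_ito_process_integral P F W
        (fun s w => drift_along b xi mu (Y w) s w)
        (drift_along b xi mu k) (J k)) :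
  forall (k : 'I_K) (pi_k : Omega -> R),
    is_cond_prob P (sigma_process xi) (Y @^-1` [set k]) pi_k ->
    {ae P, forall w,
      pi_k w = expR (log_likelihood b xi mu k (J k) w)
               / \sum_(j < K) expR (log_likelihood b xi mu j (J j) w)}.
Proof.
move=> k pi_k pi_cond.
have [M_ hM] := boolp.choice b_bounded.
(* A single bound for all labels, obtained by summing the individual ones. *)
pose M := \sum_k `|M_ k|.
have b_bnd l x y : `|b l x y| <= M.
  rewrite (le_trans (hM l x y))// (le_trans (ler_norm _))// /M (bigD1 l)//= lerDl.
  by apply: sumr_ge0.
have exI l : exists Il, is_ito_integral P F W (drift_along b xi mu l) Il /\
    {ae P, forall w, J l w =
      \int[lebesgue_measure]_(s in `[0%R, 1%R])
        (drift_along b xi mu l s w * drift_along b xi mu (Y w) s w) + Il w}.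
  by have [Il h1 h2] := J_integral l; exists Il.
have [I hI] := boolp.choice exI.
have I_ito l := (hI l).1.
have [phi phin phi_ae] := grid_integral_subsequence b_bnd (ltW L_gt0) b_lipschitz F_usual
  Y_uniform Y_F0 W_brownian xi_solution I_ito.
have good_ae : {ae P, forall w,
    good_point x0 b Y W xi mu I phi w /\ ito_identity b Y xi mu I J w}.
  have J_ae : {ae P, forall w, ito_identity b Y xi mu I J w}.
    (* The finitely many labels are enumerated by natural numbers through [insub], so that a
       countable intersection of almost sure events applies. *)
    have h : {ae P, forall w, forall n, if insub n is Some l then
       J l w = \int[lebesgue_measure]_(s in `[0%R, 1%R])
        (drift_along b xi mu l s w * drift_along b xi mu (Y w) s w) + I l w else True}.
      by apply/ae_foralln => n; case: (insub n) => [l|]; [exact: (hI l).2|exact: aeW].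
    by apply: filterS h => w hw l; have := hw l; rewrite valK.
  have g_ae := good_path_ae W_brownian xi_solution.
  by apply: filterS3 g_ae phi_ae J_ae => w; split.
(* From here on the log-likelihoods are handled through their path-measurable versions. *)
pose ell j w := path_log_likelihood b xi mu phi j w.
have ellE w j : good_point x0 b Y W xi mu I phi w /\ ito_identity b Y xi mu I J w ->
    ell j w = log_likelihood b xi mu j (J j) w.
  move=> [gw Jw].
  exact: (path_log_likelihoodE b_bnd (ltW L_gt0) b_lipschitz F_usual Y_uniform xi_solution phin _ gw Jw).
have mxi := measurable_solution F_usual xi_solution.
have mell j : measurable_fun [set: path_space xi] (ell j).
  exact: (@measurable_path_log_likelihood _ _ _ _ b L M xi mu b_bnd (ltW L_gt0) b_lipschitz phi j).
have mrho j : measurable_fun setT (fun w => expR (ell j w - ell k w)).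
  apply: measurableT_comp => //; apply: (path_space_measurable mxi).
  exact: measurable_funB.
have mY j : measurable (Y @^-1` [set j]) := (Y_uniform j).1.
have mind j : measurable_fun setT (\1_(Y @^-1` [set j]) : Omega -> R).
  exact: measurable_indic.
have ind0 j w : 0 <= \1_(Y @^-1` [set j]) w :> R by rewrite indicE.
have sub : sigma_process xi `<=` measurable by exact: sigma_process_measurable.
have ratio j A : sigma_process xi A ->
    (\int[P]_(w in A) (\1_(Y @^-1` [set k]) w * expR (ell j w - ell k w))%:E
     = P (A `&` Y @^-1` [set j]))%E.
  move=> /sigma_process_cylinder; apply: integral_eq_sigma_algebra => //.
  - exact: cylinder_measurable.
  - exact: cylinder_setI.
  - exact: cylinder_setT.
  - exact: measurable_funM.
  move=> _ [T [t [a [t01 ->]]]].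
  have h := likelihood_ratio_indicator b_bnd (ltW L_gt0) b_lipschitz F_usual
    Y_uniform Y_F0 W_brownian xi_solution phin good_ae a k j t01.
  rewrite -h -ge0_integral_indic_setI//.
  by apply: (cylinder_measurable mxi); exists T, t, a.
(* The inverse of [S] is the claimed quotient after division of numerator and denominator by
   exp(F_k). *)
pose S w := \sum_j expR (ell j w - ell k w).
(* Summing the likelihood-ratio identity over [j] exhausts all labels, so the events Y = j add up to
   the whole space. *)
have SP A : sigma_process xi A ->
    (\int[P]_(w in A) (\1_(Y @^-1` [set k]) w * S w)%:E = P A)%E.
  move=> GA; have mA := sub _ GA.
  transitivity (\sum_j \int[P]_(w in A) (\1_(Y @^-1` [set k]) w * expR (ell j w - ell k w))%:E)%E.
    rewrite -ge0_integral_sum//.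
    - by apply: eq_integral => w _; rewrite sumEFin /S mulr_sumr.
    - move=> j; apply/measurable_EFinP; apply: measurable_funTS; exact: measurable_funM.
  rewrite (eq_bigr _ (fun j _ => ratio j A GA)).
  transitivity (\sum_j \int[P]_(w in A) (\1_(Y @^-1` [set j]) w : R)%:E)%E.
    by apply: eq_bigr => j _; rewrite integral_indic// setIC.
  rewrite -ge0_integral_sum//.
  - rewrite -[RHS]mul1e -integral_cst//; apply: eq_integral => w _.
    rewrite sumEFin (bigD1 (Y w))//= big1 ?addr0 ?indicE ?mem_set//.
    by move=> j jY; rewrite indicE memNset//= => Yj; rewrite Yj eqxx in jY.
  - by move=> j; apply/measurable_EFinP; exact: measurable_funTS.
have mS : measurable_wrt (sigma_process xi) S.
  have : measurable_fun [set: path_space xi] S.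
    apply: measurable_sum => j; apply: measurableT_comp => //.
    exact: measurable_funB.
  by move=> h B mB; rewrite -[_ @^-1` _]setTI; exact: h.
have S0 w : 0 < S w.
  by rewrite /S (bigD1 k)//= ltr_pwDl ?expR_gt0// sumr_ge0// => j _; exact: expR_ge0.
have sG : sigma_algebra setT (sigma_process xi) by exact: smallest_sigma_algebra.
have := cond_prob_inverse_density sG sub (mY k) pi_cond mS S0 SP.
apply: filterS2 good_ae => w gw ->.
rewrite /S; under eq_bigr do rewrite !ellE// expRB.
by rewrite -mulr_suml invf_div.
Qed.
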